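(* The Newey and Robins plug-in estimator $\hat\psi^{\mathrm{NR}}_k$ without sample splitting of $\psi(\mathbb P)=\mathbb E_{\mathbb P}[\mathrm{Cov}_{\mathbb P}(A,Y\mid X)]$ over $\mathcal P_{(\alpha,\beta)}$ (defined in the context) requires undersmoothing $k$ when $\alpha<\beta\wedge\frac d2$ and oversmoothing $k$ when $\beta<\alpha\wedge\frac d2$ to achieve its best rate for estimating $\psi(\mathbb P)$ (i.e. $n^{-1}$ when $\frac{\alpha+\beta}2\ge\frac d2$ and $n^{-\frac{2\alpha+2\beta}{\alpha+\beta+d}}$ when $\frac{\alpha+\beta}2<\frac d2$).
   Context: Notation. $a\vee b=\max(a,b)$, $a\wedge b=\min(a,b)$; integrals are over $[0,1]^d$. For nonnegative sequences, $a_n\lesssim b_n$ means there is a constant $C>0$ with $a_n\le Cb_n$ for all $n\ge n_0$; $a_n\gtrsim b_n$ means $b_n\lesssim a_n$; $a_n\asymp b_n$ means both; $a_n\ll b_n$ means $a_n/b_n\to0$; $a_n\gg b_n$ means $a_n/b_n\to\infty$. The resolution $k$ is a sequence that may depend on $n$. Wavelets. Fix a compactly supported Cohen–Daubechies–Vial type orthonormal wavelet basis $\{\Phi_{J_0m},\Psi^{\iota}_{lm'}: m\in\mathcal Z_{J_0},\,m'\in\mathcal Z_l,\,\iota\in\{0,1\}^d\setminus\{0\},\,l\ge J_0\}$ of $L^2([0,1]^d)$ of regularity $S\ge1$, $S>\alpha\vee\beta$, with $2^{J_0}\ge S$, $|\mathcal Z_l|\asymp 2^{ld}$. For $j\ge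 J_0$ let $V_j=\mathrm{span}\{\Phi_{jm}:m\in\mathcal Z_j\}$ ($\{\Phi_{jm}\}_m$ the orthonormal scaling functions at level $j$; the $V_j$ are nested). A resolution is a number $k=2^{jd}$, $j\ge J_0$ (so prescribed values such as $c\,n^a$ are understood up to bounded constant factors); write $V_k,\Phi_{km},\mathcal Z_k$ for $V_j,\Phi_{jm},\mathcal Z_j$. Standard properties: $|\Phi_{km}|\lesssim\sqrt k$ uniformly with support in a set of Lebesgue measure $O(1/k)$; $V_k$ contains all polynomials of degree at most $S-1$. The projection kernel is $K_{V_k}(x,y)=\sum_{m\in\mathcal Z_k}\Phi_{km}(x)\Phi_{km}(y)$. Hölder ball. $H(\alpha,M)$ is the set of uniformly continuous $h:[0,1]^d\to\mathbb R$ with $2^{J_0(\alpha+d/2)}\max_m|\langle h,\Phi_{J_0m}\rangle|+\sup_{l\ge J_0,m\in\mathcal Z_l,\iota}2^{l(\alpha+d/2)}|\langle h,\Psi^\iota_{lm}\rangle|\le M$. Model. $\mathcal P_{(\alpha,\beta)}$ is the set of distributions $\mathbb P$ of $(X,A,Y)\in[0,1]^d\times\mathbb R\times\mathbb R$ with $X\sim\mathrm{Uniform}([0,1]^d)$, $A,Y\in[C_1,C_2]$ a.s., $p(x):=\mathbb E_{\mathbb P}[A\mid X=x]\in H(\alpha,M)$ and $b(x):=\mathbb E_{\mathbb P}[Y\mid X=x]\in H(\beta,M)$, where $C_1,C_2\in\mathbb R$, $\alpha,\beta,M>0$ are fixed known constants. The functional is $\psi(\mathbb P)=\mathbb E_{\mathbb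 P}[\mathrm{Cov}_{\mathbb P}(A,Y\mid X)]$. Estimator. Let $\mathcal D_1$ be a sample of $n$ i.i.d. observations from $\mathbb P$. Put $\hat b_k(x)=\frac1n\sum_{i\in\mathcal D_1}Y_iK_{V_k}(X_i,x)$ and $\hat\psi^{\mathrm{NR}}_k=\frac1n\sum_{i\in\mathcal D_1}A_i(Y_i-\hat b_k(X_i))$. Rates and tuning. For a given resolution sequence let $R_n=\sup_{\mathbb P\in\mathcal P_{(\alpha,\beta)}}\mathbb E_{\mathbb P}[(\hat\psi^{\mathrm{NR}}_k-\psi(\mathbb P))^2]$. The best rate is $r_n$ if some choice of $k$ gives $R_n\lesssim r_n$ while every choice gives $R_n\gtrsim r_n$; a choice achieves the best rate if it gives $R_n\lesssim r_n$. The prediction-optimal resolution is $k_2^{\mathrm{pred}}=c_2n^{\frac d{2\beta+d}}$ for fixed $c_2>0$. Undersmoothing (oversmoothing) $k$ means choosing $k\gg k_2^{\mathrm{pred}}$ ($k\ll k_2^{\mathrm{pred}}$); ''requires undersmoothing (oversmoothing) $k$ to achieve its best rate'' means every choice of $k$ achieving the best rate satisfies $k\gg k_2^{\mathrm{pred}}$ ($k\ll k_2^{\mathrm{pred}}$).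
   Formalization: Added: the class of laws stays nonempty when M, C1, C2 are replaced by M-e, C1+e, C2-e for some e>0; without such a condition the claim fails, e.g. for C1=C2=0, where the risk is 0 for every k, or when the class is empty. *)

(* Defs.v *)
From HB Require Import structures.
From mathcomp Require Import all_boot all_order all_algebra.
From mathcomp Require Import all_classical all_reals all_analysis.

Set Implicit Arguments.
Unset Strict Implicit.
Unset Printing Implicit Defensive.

Import Order.TTheory GRing.Theory Num.Theory.
Import numFieldNormedType.Exports.

Local Open Scope classical_set_scope.
Local Open Scope ring_scope.

(* n-fold product of a probability measure: the law of n i.i.d. draws. *)
Section iid_law.
Local Open Scope ereal_scope.
Context d (T : measurableType d) (R : realType).

Definition cons_pair n (p : T * n.-tuple T) : n.+1.-tuple T :=
  [tuple of p.1 :: p.2].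

Lemma measurable_cons_pair n : measurable_fun setT (@cons_pair n).
Proof. exact: measurable_cons. Qed.

HB.instance Definition _ n :=
  isMeasurableFun.Build _ _ _ _ (@cons_pair n) (@measurable_cons_pair n).

Section prod_prob.
Context n (P : probability T R) (Q : probability (n.-tuple T) R).

Definition prod_prob : set (T * n.-tuple T) -> \bar R := P \x Q.

HB.instance Definition _ := Measure.on prod_prob.

Let prod_prob_setT : prod_prob setT = 1.
Proof.
rewrite /prod_prob -setXTT product_measure1E//.
rewrite [X in X * _](_ : _ = 1); last exact: (probability_setT P).
by rewrite [X in _ * X](_ : _ = 1) ?mule1//; exact: (probability_setT Q).
Qed.

HB.instance Definition _ :=
  Measure_isProbability.Build _ _ _ prod_prob prod_prob_setT.

End prod_prob.

Fixpoint iid_law (P : probability T R) n : probability (n.-tuple T) R :=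
  match n return probability (n.-tuple T) R with
  | 0 => dirac [tuple]
  | n'.+1 => distribution (prod_prob P (iid_law P n')) (@cons_pair n')
  end.

End iid_law.

(* Conditional expectation of V given X as a function of the value of X. *)
Section conditional_expectation.
Context d d' (T : measurableType d) (T' : measurableType d') (R : realType).
Variables (P : probability T R) (X : T -> T').

Definition is_cond_exp (V : T -> R) (f : T' -> R) : Prop :=
  [/\ measurable_fun setT f,
      P.-integrable setT (EFin \o (f \o X)) &
      forall B, measurable B ->
        (\int[P]_(z in X @^-1` B) (V z)%:E
         = \int[P]_(z in X @^-1` B) (f (X z))%:E)%E].

Definition cond_exp (V : T -> R) : T' -> R :=
  xget (fun=> 0) [set f | is_cond_exp V f].

Definition cond_cov (U V : T -> R) : T' -> R :=
  cond_exp (fun z => (U z - cond_exp U (X z)) * (V z - cond_exp V (X z))).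

End conditional_expectation.

(* uniform_prob is a measure on measurableTypeR R; unif01 is the same set
   function as a probability on R with its canonical Borel structure. *)
Section unif01.
Local Open Scope ereal_scope.
Context (R : realType).
Local Notation U := (uniform_prob (@ltr01 R)).

Definition unif01 : set R -> \bar R := U.

Let unif01_set0 : unif01 set0 = 0. Proof. exact: (measure0 U). Qed.

Let unif01_ge0 A : 0 <= unif01 A. Proof. exact: (measure_ge0 U). Qed.

Let unif01_sigma_additive : semi_sigma_additive unif01.
Proof. exact: (@measure_semi_sigma_additive _ _ _ U). Qed.

HB.instance Definition _ := isMeasure.Build _ _ _ unif01
  unif01_set0 unif01_ge0 unif01_sigma_additive.

Let unif01_setT : unif01 setT = 1. Proof. exact: (probability_setT U). Qed.

HB.instance Definition _ := Measure_isProbability.Build _ _ _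
  unif01 unif01_setT.

End unif01.

Section unit_cube.
Context (R : realType) (d : nat).

Definition cube : set (d.-tuple R) :=
  [set x | forall i, 0 <= tnth x i <= 1].

Definition unif_cube : probability (d.-tuple R) R :=
  iid_law (@unif01 R) d.

(* Integration against unif_cube is Lebesgue integration over [0,1]^d. *)
Definition ip (f g : d.-tuple R -> R) : R :=
  \int[unif_cube]_(x in cube) (f x * g x).

Definition ucont (f : d.-tuple R -> R) : Prop :=
  forall e, 0 < e -> exists2 del, 0 < del &
    forall x y, cube x -> cube y ->
      (forall i, `|tnth x i - tnth y i| < del) -> `|f x - f y| < e.

Definition square_integrable (f : d.-tuple R -> R) : Prop :=
  measurable_fun cube f /\
  (\int[unif_cube]_(x in cube) ((f x) ^+ 2)%:E < +oo)%E.

End unit_cube.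
Arguments cube {R d}.
Arguments unif_cube {R d}.

Section wavelets.
Context (R : realType) (d : nat).

Definition span_on_cube (I : finType) (F : I -> d.-tuple R -> R)
    (f : d.-tuple R -> R) : Prop :=
  exists c : I -> R, forall x, cube x -> f x = \sum_m c m * F m x.

(* Compact support and L^oo-normalisation at scale 2^-j: size at most
   C 2^(jd/2), support in a box of side 2 C 2^-j (of measure O(2^-jd)), and at
   most N members of a given level overlapping at any point. *)
Definition localized (J0 : nat) (I : nat -> finType)
    (F : forall j, I j -> d.-tuple R -> R) : Prop :=
  exists (C : R) (N : nat), forall j, (J0 <= j)%N ->
    [/\ forall m x, cube x -> `|F j m x| <= C * Num.sqrt (2 ^+ (j * d)),
        forall m, exists a : d.-tuple R, forall x, cube x -> F j m x != 0 ->
          forall i, `|tnth x i - tnth a i| <= C / 2 ^+ j &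
        forall x, cube x -> (#|[pred m | (F j m x != 0)%R]| <= N)%N].

(* {0,1}^d \ {0} *)
Definition wtype := {iota : {ffun 'I_d -> bool} | iota != [ffun=> false]}.

(* Compactly supported orthonormal wavelet bases of L^2([0,1]^d) of
   Cohen-Daubechies-Vial type with regularity S and coarsest level J0.
   Functions live on R^d but only their restriction to the cube matters;
   measurability on all of R^d is a normalisation (extend by 0). Regularity S
   is used through continuity of the basis functions and reproduction of
   polynomials of degree at most S - 1. *)
Record cdv_basis (S J0 : nat) := CDVBasis {
  Z : nat -> finType;
  Phi : forall j, Z j -> d.-tuple R -> R;
  Psi : forall l, wtype * Z l -> d.-tuple R -> R;
  card_Z : exists c C : R, 0 < c /\ forall l, (J0 <= l)%N ->
    c * 2 ^+ (l * d) <= #|Z l|%:R <= C * 2 ^+ (l * d);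
  measurable_Phi : forall j m, (J0 <= j)%N -> measurable_fun setT (@Phi j m);
  measurable_Psi : forall l m, (J0 <= l)%N -> measurable_fun setT (@Psi l m);
  ucont_Phi : forall j m, (J0 <= j)%N -> ucont (@Phi j m);
  ucont_Psi : forall l m, (J0 <= l)%N -> ucont (@Psi l m);
  localized_Phi : localized J0 Phi;
  localized_Psi : localized J0 Psi;
  orthonormal_Phi : forall j (m m' : Z j), (J0 <= j)%N ->
    ip (Phi m) (Phi m') = (m == m')%:R;
  orthonormal_Psi : forall l (m m' : wtype * Z l), (J0 <= l)%N ->
    ip (Psi m) (Psi m') = (m == m')%:R;
  orthogonal_Psi : forall l l' (m : wtype * Z l) (m' : wtype * Z l'),
    (J0 <= l)%N -> (J0 <= l')%N -> l != l' -> ip (Psi m) (Psi m') = 0;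
  orthogonal_Phi_Psi : forall l (m : Z J0) (m' : wtype * Z l),
    (J0 <= l)%N -> ip (Phi m) (Psi m') = 0;
  (* V_(j+1) = V_j + W_j; in particular the V_j are nested *)
  multiresolution : forall j, (J0 <= j)%N -> forall f,
    span_on_cube (@Phi j.+1) f <->
    exists g h, [/\ span_on_cube (@Phi j) g, span_on_cube (@Psi j) h &
                    forall x, cube x -> f x = g x + h x];
  dense_V : forall f, square_integrable f -> forall e : R, 0 < e ->
    exists j g, [/\ (J0 <= j)%N, span_on_cube (@Phi j) g &
      (\int[unif_cube]_(x in cube) ((f x - g x) ^+ 2)%:E < e%:E)%E];
  polynomials_V : forall j, (J0 <= j)%N -> forall a : 'I_d -> nat,
    (\sum_i a i < S)%N ->
    span_on_cube (@Phi j) (fun x => \prod_i tnth x i ^+ a i)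
}.

Definition proj_kernel S J0 (W : cdv_basis S J0) (j : nat)
    (x y : d.-tuple R) : R :=
  \sum_(m : Z W j) Phi m x * Phi m y.

Definition holder_ball S J0 (W : cdv_basis S J0) (alpha M : R)
    (h : d.-tuple R -> R) : Prop :=
  ucont h /\
  ((2 `^ (J0%:R * (alpha + d%:R / 2))
      * \big[Num.max/0]_(m : Z W J0) `|ip h (Phi m)|)%:E
   + ereal_sup [set s | exists l (m : wtype * Z W l), (J0 <= l)%N /\
       s = (2 `^ (l%:R * (alpha + d%:R / 2)) * `|ip h (Psi m)|)%:E]
   <= M%:E)%E.

End wavelets.

Section model.
Context (R : realType) (d : nat).

Notation obs := (d.-tuple R * R * R)%type.

Definition obsX (z : obs) : d.-tuple R := z.1.1.
Definition obsA (z : obs) : R := z.1.2.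
Definition obsY (z : obs) : R := z.2.

Definition model S J0 (W : cdv_basis R d S J0) (alpha beta M C1 C2 : R) :
    set (probability obs R) :=
  [set P : probability obs R | [/\ forall B, measurable B -> P (obsX @^-1` B) = unif_cube B,
               {ae P, forall z, C1 <= obsA z <= C2 /\ C1 <= obsY z <= C2},
               exists2 p, is_cond_exp P obsX obsA p & holder_ball W alpha M p &
               exists2 b, is_cond_exp P obsX obsY b & holder_ball W beta M b]].

Definition psi (P : probability obs R) : R :=
  \int[P]_z cond_cov P obsX obsA obsY (obsX z).

Section estimator.
Context S J0 (W : cdv_basis R d S J0) (j n : nat) (D1 : n.-tuple obs).

Definition bhat (x : d.-tuple R) : R :=
  n%:R^-1 * \sum_(i < n)
    obsY (tnth D1 i) * proj_kernel W j (obsX (tnth D1 i)) x.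

Definition psi_NR : R :=
  n%:R^-1 * \sum_(i < n)
    obsA (tnth D1 i) * (obsY (tnth D1 i) - bhat (obsX (tnth D1 i))).

End estimator.

(* R_n for the resolution sequence k = 2^(j n * d), as a function of j, n *)
Definition max_risk S J0 (W : cdv_basis R d S J0) (alpha beta M C1 C2 : R)
    (j : nat -> nat) (n : nat) : \bar R :=
  ereal_sup [set ('E_(iid_law P n)[
                    fun D1 => ((psi_NR W (j n) D1 - psi P) ^+ 2)%R])%E
            | P in model W alpha beta M C1 C2].

End model.

Section rates.
Context (R : realType).

Definition lesssim (a b : nat -> \bar R) : Prop :=
  exists2 C : R, 0 < C & \forall n \near \oo, (a n <= C%:E * b n)%E.

Definition much_less (a b : nat -> R) : Prop :=
  (fun n => a n / b n) @ \oo --> (0 : R).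

Definition much_greater (a b : nat -> R) : Prop :=
  (fun n => a n / b n) @ \oo --> +oo.

Definition resolution (d : nat) (j : nat -> nat) : nat -> R :=
  fun n => 2 ^+ (j n * d).

Definition admissible (J0 : nat) (j : nat -> nat) : Prop :=
  forall n, (J0 <= j n)%N.

Definition achieves (risk : (nat -> nat) -> nat -> \bar R) (r : nat -> R)
    (j : nat -> nat) : Prop :=
  lesssim (risk j) (EFin \o r).

Definition is_best_rate (J0 : nat) (risk : (nat -> nat) -> nat -> \bar R)
    (r : nat -> R) : Prop :=
  (exists2 j, admissible J0 j & achieves risk r j) /\
  (forall j, admissible J0 j -> lesssim (EFin \o r) (risk j)).

Definition k_pred (d : nat) (beta c2 : R) : nat -> R :=
  fun n => c2 * n%:R `^ (d%:R / (2 * beta + d%:R)).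

Definition requires_undersmoothing (d J0 : nat)
    (risk : (nat -> nat) -> nat -> \bar R) (r kp : nat -> R) : Prop :=
  forall j, admissible J0 j -> achieves risk r j ->
    much_greater (resolution d j) kp.

Definition requires_oversmoothing (d J0 : nat)
    (risk : (nat -> nat) -> nat -> \bar R) (r kp : nat -> R) : Prop :=
  forall j, admissible J0 j -> achieves risk r j ->
    much_less (resolution d j) kp.

Definition rate_NR (d : nat) (alpha beta : R) : nat -> R :=
  fun n => if d%:R / 2 <= (alpha + beta) / 2 then n%:R^-1
           else n%:R `^ (- ((2 * alpha + 2 * beta) / (alpha + beta + d%:R))).

End rates.

(* Main.v *)
Require Import Defs.
From HB Require Import structures.
From mathcomp Require Import all_boot all_order all_algebra.
From mathcomp Require Import all_classical all_reals all_analysis.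
From mathcomp Require Import measurable_realfun ring lra.

Set Implicit Arguments.
Unset Strict Implicit.
Unset Printing Implicit Defensive.

Import Order.TTheory GRing.Theory Num.Theory.
Import numFieldNormedType.Exports.

Local Open Scope classical_set_scope.
Local Open Scope ring_scope.

(** Write k = 2 ^ (j d) for the resolution. The estimator is the sample mean of AY
    minus the mean of A_i Y_i' K(X_i, X_i') over all pairs of observations, the
    pairs (i, i) included, and each bias or variance term can be read off from
    this form:
    - the terms with i <> i' estimate the inner product of the projections of the
      two regression functions p and q on V_j, which differs from that of p and q
      by the truncation bias, at most of order k ^ (- (alpha + beta) / d);
    - the diagonal terms add a bias of order k / n;
    - the linear part of the error has variance of order 1 / n, and the quadratic
      part has mean square of order (k / n) ^ 2.
    Hence the maximal risk is at most of the order of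
      [risk_order] = 1 / n + k ^ (- 2 (alpha + beta) / d) + (k / n) ^ 2
    ([risk_upper]). The truncation bias is bounded by Cauchy-Schwarz and the
    squared distances of p and q to V_j ([holder_tail]), the quadratic part by a
    fourth moment bound for sums of independent centred vectors
    ([mean_norm4_Sum]).

    The same three terms bound the maximal risk from below for every resolution
    ([risk_lower]). All lower bounds use explicit laws in which, given X = x, the
    responses are p x + u and q x + v with u and v equal to eta or - eta.
    - Equal and opposite residuals give the same p and q but opposite conditional
      covariances, hence biases that differ by a multiple of k / n
      ([risk_ge_diag]).
    - Adding to p and q, with all four sign combinations, small multiples of the
      sum of all wavelets at level j moves the truncation bias by the full order
      k ^ (- (alpha + beta) / d), while the diagonal terms cannot compensate for
      it unless k is at least of order n, where they dominate anyway
      ([risk_ge_mixed]).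
    - Correlating the estimator with the score of the conditional covariance at
      independent residuals gives a variance of order 1 / n
      ([parametric_lower_bound]).

    It remains to minimise [risk_order]. The terms balance at k = n ^ a, where
    a = d / (alpha + beta + d) if alpha + beta < d, and at k = n ^ (1 / 2), which
    already reaches the rate 1 / n, otherwise. A resolution within the best rate
    has a truncation bias within the rate, hence grows at least like n ^ a if
    alpha + beta < d, and at least like n ^ (d / (2 (alpha + beta))) otherwise;
    both powers exceed n ^ (d / (2 beta + d)) when alpha < min (beta, d / 2)
    ([undersmoothing_growth]). Likewise, its diagonal bias is within the rate, so
    that k is at most of order n ^ a, a smaller power than n ^ (d / (2 beta + d))
    when beta < min (alpha, d / 2) ([oversmoothing_growth]). *)

(** * The mean of a bounded measurable function *)

Lemma discriminant_le0 (R : realFieldType) (a b c : R) :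
  (forall s t, 0 <= s ^+ 2 * a + 2 * s * t * c + t ^+ 2 * b) -> c ^+ 2 <= a * b.
Proof.
move=> quad.
have a0 : 0 <= a by have := quad 1 0; rewrite expr1n mul1r !mulr0 expr0n !mul0r !addr0.
have b0 : 0 <= b by have := quad 0 1; rewrite expr1n mul1r !mulr0 expr0n !mul0r !add0r.
have [b_eq0|b_neq0] := eqVneq b 0.
  have := quad c (- (a + 1)); have := quad c (a + 1); rewrite b_eq0 !mulr0 !addr0.
  nra.
have b_gt0 : 0 < b by rewrite lt_def b_neq0 b0.
have := quad b (- c); have -> : b ^+ 2 * a + 2 * b * - c * c + (- c) ^+ 2 * b
  = b * (a * b - c ^+ 2) by ring.
by rewrite pmulr_rge0// subr_ge0.
Qed.

Lemma sum_Cauchy_Schwarz (R : realFieldType) (I : finType) (u v : I -> R) :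
  (\sum_i u i * v i) ^+ 2 <= (\sum_i u i ^+ 2) * (\sum_i v i ^+ 2).
Proof.
apply: discriminant_le0 => s t.
rewrite !mulr_sumr -!big_split /=; apply: sumr_ge0 => i _.
rewrite (_ : _ + _ = (s * u i + t * v i) ^+ 2); first exact: sqr_ge0.
ring.
Qed.

Section bounded_mfun.
Context d (T : measurableType d) (R : realType).
Implicit Types f g : T -> R.

(** Bounded functions have finite moments of all orders, so that the moment
    computations below can be carried out with real numbers. *)
Definition bounded_mfun f :=
  measurable_fun setT f /\ exists M, forall x, `|f x| <= M.

Lemma bounded_mfunW f : bounded_mfun f -> measurable_fun setT f.
Proof. by case. Qed.

Lemma bounded_mfun_cst (c : R) : bounded_mfun (fun=> c).
Proof. by split; [exact: measurable_cst | exists `|c|]. Qed.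

Lemma bounded_mfunD f g : bounded_mfun f -> bounded_mfun g ->
  bounded_mfun (fun x => f x + g x).
Proof.
move=> [mf [M Mf]] [mg [N Ng]]; split; first exact: measurable_funD.
by exists (M + N) => x; rewrite (le_trans (ler_normD _ _))// lerD.
Qed.

Lemma bounded_mfunM f g : bounded_mfun f -> bounded_mfun g ->
  bounded_mfun (fun x => f x * g x).
Proof.
move=> [mf [M Mf]] [mg [N Ng]]; split; first exact: measurable_funM.
by exists (M * N) => x; rewrite normrM ler_pM.
Qed.

Lemma bounded_mfunN f : bounded_mfun f -> bounded_mfun (fun x => - f x).
Proof.
move=> [mf [M Mf]]; split; first exact: measurableT_comp.
by exists M => x; rewrite normrN.
Qed.

Lemma bounded_mfunB f g : bounded_mfun f -> bounded_mfun g ->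
  bounded_mfun (fun x => f x - g x).
Proof. by move=> bf bg; apply: bounded_mfunD => //; exact: bounded_mfunN. Qed.

Lemma bounded_mfunX f n : bounded_mfun f -> bounded_mfun (fun x => f x ^+ n).
Proof.
move=> bf; elim: n => [|n IH]; first exact: bounded_mfun_cst.
by under eq_fun do rewrite exprS; exact: bounded_mfunM.
Qed.

Lemma bounded_mfun_sum (I : Type) (s : seq I) (F : I -> T -> R) :
  (forall i, bounded_mfun (F i)) -> bounded_mfun (fun x => \sum_(i <- s) F i x).
Proof.
move=> bF; elim: s => [|i s IH].
  by under eq_fun do rewrite big_nil; exact: bounded_mfun_cst.
by under eq_fun do rewrite big_cons; exact: bounded_mfunD.
Qed.

Lemma bounded_mfun_indic (A : set T) : measurable A ->
  bounded_mfun (\1_A : T -> R).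
Proof.
move=> mA; split; first exact: measurable_indic.
by exists 1 => x; rewrite indicE; case: (_ \in _); rewrite ?normr1 ?normr0.
Qed.

End bounded_mfun.

Ltac bounded_tac := repeat first
  [ assumption | solve [trivial] | exact: bounded_mfun_cst | apply: bounded_mfunD
  | apply: bounded_mfunB | apply: bounded_mfunN | apply: bounded_mfunM
  | apply: bounded_mfunX | apply: bounded_mfun_sum => ? ].

Section mean.
Context d (T : measurableType d) (R : realType).
Implicit Types (P : probability T R) (f g h : T -> R).

Definition mean P f : R := \int[P]_x f x.

Lemma bounded_mfun_integrable P f : bounded_mfun f ->
  P.-integrable setT (EFin \o f).
Proof.
move=> [mf [M Mf]]; apply: measurable_bounded_integrable => //.
  by apply: (@le_lt_trans _ _ 1%E); [exact: probability_le1|exact: ltry].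
exists M; split; first exact: num_real.
by move=> x Mx y _; exact: le_trans (Mf y) (ltW Mx).
Qed.

Lemma EFin_mean P f : bounded_mfun f -> (mean P f)%:E = (\int[P]_x (f x)%:E)%E.
Proof.
move=> bf; rewrite /mean /Rintegral fineK//.
by apply: integrable_fin_num => //; exact: bounded_mfun_integrable.
Qed.

Lemma eq_mean P f g : f =1 g -> mean P f = mean P g.
Proof. by move=> /funext ->. Qed.

Lemma meanD P f g : bounded_mfun f -> bounded_mfun g ->
  mean P (fun x => f x + g x) = mean P f + mean P g.
Proof. by move=> bf bg; apply: RintegralD => //; exact: bounded_mfun_integrable. Qed.

Lemma meanB P f g : bounded_mfun f -> bounded_mfun g ->
  mean P (fun x => f x - g x) = mean P f - mean P g.
Proof. by move=> bf bg; apply: RintegralB => //; exact: bounded_mfun_integrable. Qed.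

Lemma meanZl P c f : bounded_mfun f -> mean P (fun x => c * f x) = c * mean P f.
Proof. by move=> bf; apply: RintegralZl => //; exact: bounded_mfun_integrable. Qed.

Lemma mean_cst P c : mean P (fun=> c) = c.
Proof.
rewrite /mean Rintegral_cst//; set x := fine _; suff -> : x = 1 by rewrite mulr1.
by rewrite /x (_ : (_ : set T -> \bar R) _ = 1%E)//; exact: probability_setT.
Qed.

Lemma mean_sum P (I : Type) (s : seq I) (F : I -> T -> R) :
  (forall i, bounded_mfun (F i)) ->
  mean P (fun x => \sum_(i <- s) F i x) = \sum_(i <- s) mean P (F i).
Proof.
move=> bF; elim: s => [|i s IH].
  by rewrite big_nil (@eq_mean _ _ (fun=> 0)) ?mean_cst// => x; rewrite big_nil.
rewrite big_cons -IH -meanD//; last exact: bounded_mfun_sum.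
by apply: eq_mean => x; rewrite big_cons.
Qed.

Lemma mean_ge0 P f : (forall x, 0 <= f x) -> 0 <= mean P f.
Proof. by move=> f0; apply: Rintegral_ge0. Qed.

Lemma le_mean P f g : bounded_mfun f -> bounded_mfun g ->
  (forall x, f x <= g x) -> mean P f <= mean P g.
Proof.
move=> bf bg fg; rewrite -subr_ge0 -meanB//.
by apply: mean_ge0 => x; rewrite subr_ge0.
Qed.

Lemma ae_eq_mean P f g (A : set T) : bounded_mfun f -> bounded_mfun g ->
  measurable A -> P A = 1%E -> (forall x, A x -> f x = g x) ->
  mean P f = mean P g.
Proof.
move=> bf bg mA PA fg; rewrite /mean /Rintegral; congr fine.
have PCA : P (~` A) = 0%E by rewrite probability_setC// PA subee.
apply: ae_eq_integral => //.
- by apply/measurable_EFinP; case: bf.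
- by apply/measurable_EFinP; case: bg.
exists (~` A); split; [exact: measurableC|exact: PCA|].
by move=> x /= Hx Ax; apply: Hx => _; rewrite fg.
Qed.

Lemma mean_Cauchy_Schwarz P f g : bounded_mfun f -> bounded_mfun g ->
  mean P (fun x => f x * g x) ^+ 2
    <= mean P (fun x => f x ^+ 2) * mean P (fun x => g x ^+ 2).
Proof.
move=> bf bg; set a := mean P (fun x => f x ^+ 2); set b := mean P (fun x => g x ^+ 2).
set c := mean P _.
have bff : bounded_mfun (fun x => f x ^+ 2) by exact: bounded_mfunX.
have bgg : bounded_mfun (fun x => g x ^+ 2) by exact: bounded_mfunX.
have bfg : bounded_mfun (fun x => f x * g x) by exact: bounded_mfunM.
apply: discriminant_le0 => s t.
have -> : s ^+ 2 * a + 2 * s * t * c + t ^+ 2 * b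
    = mean P (fun x => (s * f x + t * g x) ^+ 2).
  rewrite /a /b /c -!meanZl// -!meanD; try by bounded_tac.
  by apply: eq_mean => x; ring.
by apply: mean_ge0 => x; exact: sqr_ge0.
Qed.

Lemma sqr_mean_le P f : bounded_mfun f ->
  mean P f ^+ 2 <= mean P (fun x => f x ^+ 2).
Proof.
move=> bf; have := @mean_Cauchy_Schwarz P f (fun=> 1) bf (@bounded_mfun_cst _ T R 1).
under eq_mean do rewrite mulr1.
by under [X in _ * X]eq_mean do rewrite expr1n; rewrite mean_cst mulr1.
Qed.

Lemma mean_centered_sqr_le P f : bounded_mfun f ->
  mean P (fun x => (f x - mean P f) ^+ 2) <= mean P (fun x => f x ^+ 2).
Proof.
move=> bf; set c := mean P f.
rewrite (@eq_mean _ _ (fun x => f x ^+ 2 - 2 * c * f x + c ^+ 2)); last first.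
  by move=> x; ring.
rewrite meanD ?meanB ?meanZl ?mean_cst; try by bounded_tac.
by rewrite -/c -subr_ge0 (_ : _ - _ = c ^+ 2) ?sqr_ge0//; ring.
Qed.

End mean.

Lemma bounded_mfun_comp d d' (T : measurableType d) (T' : measurableType d')
    (R : realType) (h : T -> T') (f : T' -> R) :
  measurable_fun setT h -> bounded_mfun f -> bounded_mfun (f \o h).
Proof.
move=> mh [mf [M Mf]]; split; first exact: measurableT_comp.
by exists M => x; exact: Mf.
Qed.

Lemma mean_pushforward d d' (T : measurableType d) (T' : measurableType d')
    (R : realType) (P : probability T R) (Q : probability T' R) (h : T -> T')
    (f : T' -> R) :
  measurable_fun setT h -> (forall B, measurable B -> Q B = P (h @^-1` B)) ->
  bounded_mfun f -> mean Q f = mean P (f \o h).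
Proof.
move=> mh QP bf.
have := @integral_pushforward _ _ _ _ _ _ mh P setT (EFin \o f).
rewrite preimage_setT => pf; apply: EFin_inj.
rewrite !EFin_mean//; last exact: bounded_mfun_comp.
rewrite -[RHS]pf//; last 2 first.
- by apply/measurable_EFinP; case: bf.
- by apply: bounded_mfun_integrable; exact: bounded_mfun_comp.
by apply: eq_measure_integral => A mA _; exact: QP.
Qed.

(** * Sums over an i.i.d. sample *)

Section mean_product.
Context d1 d2 (T1 : measurableType d1) (T2 : measurableType d2) (R : realType).
Variables (P : probability T1 R) (Q : probability T2 R).
Variable f : T1 * T2 -> R.
Hypothesis bf : bounded_mfun f.

Lemma bounded_mfun_pair x : bounded_mfun (fun y => f (x, y)).
Proof.
exact: (@bounded_mfun_comp _ _ _ _ _ (pair x) f).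
Qed.

Let integrable_prod : (P \x Q)%E.-integrable setT (EFin \o f).
Proof.
have [mf [M Mf]] := bf.
have PQ_fin : ((P \x Q) setT < +oo)%E.
  rewrite -setXTT product_measure1E//.
  apply: (@le_lt_trans _ _ (1 * 1)%E); last by rewrite mule1 ltry.
  by apply: lee_pmul => //; exact: probability_le1.
apply: measurable_bounded_integrable => //; last first.
  exists M; split; first exact: num_real.
  by move=> x Mx y _; exact: le_trans (Mf y) (ltW Mx).
Qed.

Lemma bounded_mfun_mean : bounded_mfun (fun x => mean Q (fun y => f (x, y))).
Proof.
split; last first.
  have [_ [M Mf]] := bf; exists M => x; rewrite ler_norml.
  have bx := bounded_mfun_pair x.
  have fM y : - M <= f (x, y) <= M by rewrite -ler_norml.
  rewrite -{1}(mean_cst Q (- M)) -{2}(mean_cst Q M).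
  apply/andP; split; apply: le_mean; bounded_tac => //;
    by move=> y; case/andP: (fM y).
apply/measurable_EFinP.
rewrite (_ : EFin \o _ = fubini_F Q (EFin \o f)).
  exact: measurable_fubini_F integrable_prod.
by apply/funext => x; rewrite /= EFin_mean//; exact: bounded_mfun_pair.
Qed.

Lemma mean_prod (PQ : probability (T1 * T2)%type R) :
  (forall A, measurable A -> PQ A = (P \x Q)%E A) ->
  mean PQ f = mean P (fun x => mean Q (fun y => f (x, y))).
Proof.
move=> PQE; apply: EFin_inj; rewrite !EFin_mean//; last exact: bounded_mfun_mean.
rewrite (eq_measure_integral (P \x Q)%E); last by move=> A mA _; exact: PQE.
rewrite -(integral12_prod_meas1 integrable_prod).
apply: eq_integral => x _ /=.
by rewrite EFin_mean//; exact: bounded_mfun_pair.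
Qed.

End mean_product.

Section iid.
Context d (T : measurableType d) (R : realType) (P : probability T R).

Lemma bounded_mfun_cons n (f : n.+1.-tuple T -> R) : bounded_mfun f ->
  bounded_mfun (fun p : T * n.-tuple T => f [tuple of p.1 :: p.2]).
Proof.
move=> bf; exact: (@bounded_mfun_comp _ _ _ _ _ (@cons_pair _ T n) f).
Qed.

(** Splitting off the first observation is the induction step of the moment
    computations for sample sums. *)
Lemma mean_iid_cons n (f : n.+1.-tuple T -> R) : bounded_mfun f ->
  mean (iid_law P n.+1) f
  = mean P (fun z => mean (iid_law P n) (fun t => f [tuple of z :: t])).
Proof.
move=> bf; pose g p := f (@cons_pair _ T n p).
have bg : bounded_mfun g by exact: bounded_mfun_cons.
rewrite -(@mean_prod _ _ _ _ _ P (iid_law P n) g bg (prod_prob P (iid_law P n)))//.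
by apply: mean_pushforward => //; exact: measurable_cons_pair.
Qed.

Lemma bounded_mfun_mean_cons n (f : n.+1.-tuple T -> R) : bounded_mfun f ->
  bounded_mfun (fun z => mean (iid_law P n) (fun t => f [tuple of z :: t])).
Proof.
by move=> /bounded_mfun_cons bf; exact: (bounded_mfun_mean P (iid_law P n) bf).
Qed.

Lemma measurable_iid_all n (G : set T) : measurable G ->
  measurable [set t : n.-tuple T | forall i, G (tnth t i)].
Proof.
move=> mG; rewrite (_ : [set _ | _] =
    \bigcap_(i in [set: 'I_n]) (@tnth n T ^~ i) @^-1` G).
  apply: fin_bigcap_measurable => // i _.
  by rewrite -[X in measurable X]setTI; exact: measurable_tnth.
by apply/seteqP; split => t /= Ht i; [move=> _; exact: Ht|exact: (Ht i I)].
Qed.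

Lemma iid_law_all n (G : set T) : measurable G -> P G = 1%E ->
  iid_law P n [set t | forall i, G (tnth t i)] = 1%E.
Proof.
move=> mG PG; elim: n => [|n IH] /=.
  by rewrite diracE mem_set// => -[].
rewrite /distribution /pushforward /=.
rewrite (_ : _ @^-1` _ = G `*` [set t : n.-tuple T | forall i, G (tnth t i)]).
  rewrite /prod_prob product_measure1E//; last exact: measurable_iid_all.
  by rewrite [X in (X * _)%E]PG [X in (_ * X)%E]IH mule1.
apply/seteqP; split => -[z t] /= => [Ht|[Gz Gt] i].
  split; first exact: (Ht ord0).
  by move=> i; have := Ht (lift ord0 i); rewrite tnthS.
by case: (unliftP ord0 i) => [j|] ->; rewrite ?tnthS// tnth0.
Qed.

Definition Sum n (f : T -> R) (t : n.-tuple T) : R := \sum_(i < n) f (tnth t i).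

Lemma Sum_cons n f z (t : n.-tuple T) : Sum f [tuple of z :: t] = f z + Sum f t.
Proof.
rewrite /Sum big_ord_recl tnth0; congr (_ + _).
by apply: eq_bigr => i _; rewrite tnthS.
Qed.

Lemma bounded_mfun_Sum n f : bounded_mfun f -> bounded_mfun (@Sum n f).
Proof.
move=> bf; apply: bounded_mfun_sum => i.
by apply: (@bounded_mfun_comp _ _ _ _ _ (@tnth n T ^~ i) f) => //; exact: measurable_tnth.
Qed.

Lemma mean_Sum n f : bounded_mfun f ->
  mean (iid_law P n) (Sum f) = n%:R * mean P f.
Proof.
move=> bf; elim: n => [|n IH].
  by rewrite mul0r (@eq_mean _ _ _ _ _ (fun=> 0)) ?mean_cst// => t; rewrite /Sum big_ord0.
have bS := @bounded_mfun_Sum n f bf.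
rewrite mean_iid_cons; last exact: bounded_mfun_Sum.
under eq_mean => z.
  under eq_mean do rewrite Sum_cons.
  rewrite meanD ?mean_cst ?IH; [|by bounded_tac..].
  over.
by rewrite meanD ?mean_cst; [ring|by bounded_tac..].
Qed.

End iid.

Section iid_moments.
Context d (T : measurableType d) (R : realType) (P : probability T R).
Implicit Types f g h : T -> R.

Ltac Sum_bounded := repeat first
  [ assumption | solve [trivial] | exact: bounded_mfun_cst | apply: bounded_mfun_Sum
  | apply: bounded_mfunD | apply: bounded_mfunM | apply: bounded_mfunX
  | apply: bounded_mfun_sum => ? ].

Ltac mean_linear := rewrite !(meanD, meanZl, mean_cst); try by Sum_bounded.

Lemma mean_Sum2 n f g : bounded_mfun f -> bounded_mfun g ->
  mean (iid_law P n) (fun t => Sum f t * Sum g t)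
  = n%:R * mean P (fun z => f z * g z)
    + n%:R * (n%:R - 1) * (mean P f * mean P g).
Proof.
move=> bf bg; elim: n => [|n IH].
  rewrite !mul0r addr0 (@eq_mean _ _ _ _ _ (fun=> 0)) ?mean_cst// => t.
  by rewrite /Sum big_ord0 mul0r.
rewrite mean_iid_cons; last by Sum_bounded.
rewrite (@eq_mean _ _ _ _ _ (fun z => f z * g z + n%:R * mean P g * f z
    + n%:R * mean P f * g z + mean (iid_law P n) (fun t => Sum f t * Sum g t))).
  by mean_linear; rewrite IH -natr1; ring.
move=> z; rewrite (@eq_mean _ _ _ _ _ (fun t => f z * g z + f z * Sum g t
    + g z * Sum f t + Sum f t * Sum g t)).
  by mean_linear; rewrite !mean_Sum//; ring.
by move=> t; rewrite !Sum_cons; ring.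
Qed.

(** A mean-zero [h] that is uncorrelated with [f] and with [g] only sees the
    diagonal terms of a product of two sample sums. *)
Lemma mean_Sum3 n f g h : bounded_mfun f -> bounded_mfun g -> bounded_mfun h ->
  mean P h = 0 -> mean P (fun z => f z * h z) = 0 ->
  mean P (fun z => g z * h z) = 0 ->
  mean (iid_law P n) (fun t => Sum f t * Sum g t * Sum h t)
  = n%:R * mean P (fun z => f z * g z * h z).
Proof.
move=> bf bg bh h0 fh0 gh0; elim: n => [|n IH].
  rewrite mul0r (@eq_mean _ _ _ _ _ (fun=> 0)) ?mean_cst// => t.
  by rewrite /Sum big_ord0 !mul0r.
rewrite mean_iid_cons; last by Sum_bounded.
rewrite (@eq_mean _ _ _ _ _ (fun z => f z * g z * h z
    + n%:R * mean P g * (f z * h z) + n%:R * mean P f * (g z * h z)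
    + mean (iid_law P n) (fun t => Sum f t * Sum g t) * h z
    + mean (iid_law P n) (fun t => Sum f t * Sum g t * Sum h t))).
  by mean_linear; rewrite IH h0 fh0 gh0 -natr1; ring.
move=> z; rewrite (@eq_mean _ _ _ _ _ (fun t => f z * g z * h z
    + f z * g z * Sum h t + f z * h z * Sum g t + f z * (Sum g t * Sum h t)
    + g z * h z * Sum f t + g z * (Sum f t * Sum h t)
    + h z * (Sum f t * Sum g t) + Sum f t * Sum g t * Sum h t)).
  mean_linear; rewrite !mean_Sum// (@mean_Sum2 n f h)// (@mean_Sum2 n g h)//.
  by rewrite h0 fh0 gh0; ring.
by move=> t; rewrite !Sum_cons; ring.
Qed.

Section vector_sums.
Variables (I : finType) (xi : I -> T -> R) (B : R).
Hypotheses (bxi : forall m, bounded_mfun (xi m))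
  (xi0 : forall m, mean P (xi m) = 0)
  (xiB : forall z, \sum_m xi m z ^+ 2 <= B).

Let N n (t : n.-tuple T) := \sum_m Sum (xi m) t ^+ 2.

Lemma mean_sqr_norm_Sum n : mean (iid_law P n) (@N n) <= n%:R * B.
Proof.
rewrite mean_sum; last by move=> m; Sum_bounded.
under eq_bigr => m _.
  rewrite (@eq_mean _ _ _ _ _ (fun t => Sum (xi m) t * Sum (xi m) t))//.
  rewrite mean_Sum2// xi0 !mulr0 addr0.
  over.
rewrite -mulr_sumr ler_wpM2l// -mean_sum; last by move=> m; Sum_bounded.
rewrite -[leRHS](mean_cst P); apply: le_mean; [by Sum_bounded..|].
by move=> z; rewrite (le_trans _ (xiB z)).
Qed.

(** The independent centred increments make the cross term of odd order
    vanish; the remaining ones are controlled by the norm bound on the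
    increment, so that passing from [n] to [n + 1] costs at most
    [8 n B ^ 2 + 3 B ^ 2]. *)
Lemma mean_norm4_Sum n :
  mean (iid_law P n) (fun t => N t ^+ 2) <= 4 * n%:R ^+ 2 * B ^+ 2.
Proof.
elim: n => [|n IH].
  rewrite (@eq_mean _ _ _ _ _ (fun=> 0)) ?mean_cst; first by rewrite expr0n /= mulr0 mul0r.
  by move=> t; rewrite /N big1 ?expr0n// => m _; rewrite /Sum big_ord0 expr0n.
rewrite mean_iid_cons; last by Sum_bounded.
pose D z := \sum_m mean (iid_law P n) (fun t => N t * Sum (xi m) t) * xi m z.
have step z : mean (iid_law P n) (fun t => N [tuple of z :: t] ^+ 2)
    <= mean (iid_law P n) (fun t => N t ^+ 2) + 4 * D z
       + 8 * B * mean (iid_law P n) (@N n) + 3 * B ^+ 2.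
  pose L (t : n.-tuple T) := \sum_m xi m z * Sum (xi m) t.
  have -> : D z = mean (iid_law P n) (fun t => N t * L t).
    rewrite (@eq_mean _ _ _ _ _ (fun t => \sum_m xi m z * (N t * Sum (xi m) t))).
      rewrite mean_sum; last by move=> m; Sum_bounded.
      by apply: eq_bigr => m _; rewrite meanZl; [rewrite mulrC|Sum_bounded].
    by move=> t; rewrite mulr_sumr; apply: eq_bigr => m _; ring.
  have bL : bounded_mfun L by Sum_bounded.
  set q := \sum_m xi m z ^+ 2.
  rewrite (@eq_mean _ _ _ _ _ (fun t => (N t + 2 * L t + q) ^+ 2)); last first.
    move=> t; congr (_ ^+ 2).
    rewrite /N /L /q mulr_sumr -!big_split /=; apply: eq_bigr => m _.
    by rewrite Sum_cons; ring.
  rewrite -!meanZl; try by Sum_bounded.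
  rewrite -(mean_cst (iid_law P n) (3 * B ^+ 2)) -!meanD; try by Sum_bounded.
  apply: le_mean; [by Sum_bounded..|].
  move=> t.
  have N0 : 0 <= N t by apply: sumr_ge0 => m _; exact: sqr_ge0.
  have q0 : 0 <= q by apply: sumr_ge0 => m _; exact: sqr_ge0.
  have qB : q <= B by exact: xiB.
  have LNq : L t ^+ 2 <= N t * q by rewrite mulrC sum_Cauchy_Schwarz.
  have NqB : N t * q <= N t * B by rewrite ler_wpM2l.
  have qB2 : q ^+ 2 <= B ^+ 2 by rewrite lerXn2r// nnegrE (le_trans q0).
  have : 4 * (L t * q) <= 2 * L t ^+ 2 + 2 * q ^+ 2.
    rewrite -subr_ge0 (_ : _ - _ = 2 * (L t - q) ^+ 2); last by ring.
    by rewrite mulr_ge0// sqr_ge0.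
  rewrite (_ : (N t + 2 * L t + q) ^+ 2 = N t ^+ 2 + 4 * (N t * L t)
    + 4 * L t ^+ 2 + 2 * (N t * q) + 4 * (L t * q) + q ^+ 2); last by ring.
  by rewrite -(mulrA 8) (mulrC B); lra.
have bD : bounded_mfun D by Sum_bounded.
apply: le_trans.
  apply: (@le_mean _ _ _ _ _ _ _ _ step); last by Sum_bounded.
  by apply: (@bounded_mfun_mean_cons _ _ _ P n (fun t => N t ^+ 2)); Sum_bounded.
mean_linear.
have -> : mean P D = 0.
  rewrite mean_sum; last by move=> m; Sum_bounded.
  by rewrite big1// => m _; rewrite meanZl// xi0 mulr0.
have B0 : 0 <= B.
  rewrite -(mean_cst P B); apply: mean_ge0 => z.
  by apply: le_trans (xiB z); apply: sumr_ge0 => m _; exact: sqr_ge0.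
have := mean_sqr_norm_Sum n => N1.
have : B * mean (iid_law P n) (@N n) <= n%:R * B ^+ 2.
  by rewrite (_ : n%:R * _ = B * (n%:R * B)); [rewrite ler_wpM2l|ring].
have : 0 <= B ^+ 2 by exact: sqr_ge0.
move: IH; rewrite -(natr1 n); set x := n%:R.
rewrite (_ : 4 * (x + 1) ^+ 2 * B ^+ 2 = 4 * x ^+ 2 * B ^+ 2 + 8 * (x * B ^+ 2) + 4 * B ^+ 2); last by ring.
rewrite mulr0 addr0 -(mulrA 8). lra.
Qed.

End vector_sums.
End iid_moments.

(** * Orthonormal families in mean square *)

Section orthonormal.
Context d (T : measurableType d) (R : realType) (P : probability T R).
Variables (I : finType) (F : I -> T -> R).
Hypotheses (bF : forall i, bounded_mfun (F i))
  (orthoF : forall i j, mean P (fun x => F i x * F j x) = (i == j)%:R).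

Definition coef (f : T -> R) i := mean P (fun x => f x * F i x).

Lemma mean_residual_mul f g (a b : I -> R) : bounded_mfun f -> bounded_mfun g ->
  mean P (fun x => (f x - \sum_i a i * F i x) * (g x - \sum_i b i * F i x))
  = mean P (fun x => f x * g x) - \sum_i a i * coef g i
    - \sum_i b i * coef f i + \sum_i a i * b i.
Proof.
move=> bf bg.
have mean_lin h (c : I -> R) : bounded_mfun h ->
    mean P (fun x => h x * \sum_i c i * F i x) = \sum_i c i * coef h i.
  move=> bh; rewrite (@eq_mean _ _ _ _ _ (fun x => \sum_i c i * (h x * F i x))).
    rewrite mean_sum; last by move=> i; bounded_tac.
    by apply: eq_bigr => i _; rewrite meanZl//; bounded_tac.
  by move=> x; rewrite mulr_sumr; apply: eq_bigr => i _; ring.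
have coefF j : coef (fun x => \sum_i b i * F i x) j = b j.
  rewrite /coef (@eq_mean _ _ _ _ _ (fun x => F j x * \sum_i b i * F i x)).
    rewrite mean_lin// (bigD1 j)//= big1 ?addr0 /coef ?orthoF ?eqxx ?mulr1//.
    by move=> i ij; rewrite orthoF eq_sym (negbTE ij) mulr0.
  by move=> x; rewrite mulrC.
rewrite (@eq_mean _ _ _ _ _ (fun x => f x * g x - g x * (\sum_i a i * F i x)
    - f x * (\sum_i b i * F i x)
    + (\sum_i b i * F i x) * (\sum_i a i * F i x))); last by move=> x; ring.
rewrite !(meanB, meanD); try by bounded_tac.
rewrite !mean_lin//; last by bounded_tac.
by congr (_ + _); apply: eq_bigr => i _; rewrite coefF.
Qed.

Lemma mean_residual_sqr f (a : I -> R) : bounded_mfun f ->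
  mean P (fun x => (f x - \sum_i a i * F i x) ^+ 2)
  = mean P (fun x => f x ^+ 2) - \sum_i coef f i ^+ 2
    + \sum_i (a i - coef f i) ^+ 2.
Proof.
move=> bf; have := mean_residual_mul a a bf bf.
rewrite (_ : (fun x => _ * _) = fun x => (f x - \sum_i a i * F i x) ^+ 2)// => ->.
rewrite -!addrA; congr (_ + _).
rewrite -!sumrN -!big_split /=; apply: eq_bigr => i _; ring.
Qed.

Lemma best_approximation f (a : I -> R) : bounded_mfun f ->
  mean P (fun x => f x ^+ 2) - \sum_i coef f i ^+ 2
  <= mean P (fun x => (f x - \sum_i a i * F i x) ^+ 2).
Proof.
move=> bf; rewrite mean_residual_sqr// lerDl.
by apply: sumr_ge0 => i _; exact: sqr_ge0.
Qed.

Lemma residual_sqr f : bounded_mfun f ->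
  mean P (fun x => (f x - \sum_i coef f i * F i x) ^+ 2)
  = mean P (fun x => f x ^+ 2) - \sum_i coef f i ^+ 2.
Proof.
move=> bf; rewrite mean_residual_sqr// [X in _ + X]big1 ?addr0// => i _.
by rewrite subrr expr0n.
Qed.

Lemma Bessel f : bounded_mfun f ->
  \sum_i coef f i ^+ 2 <= mean P (fun x => f x ^+ 2).
Proof.
move=> bf; rewrite -subr_ge0 -residual_sqr//.
by apply: mean_ge0 => x; exact: sqr_ge0.
Qed.

Lemma mean_sqr_expansion (a : I -> R) :
  mean P (fun x => (\sum_i a i * F i x) ^+ 2) = \sum_i a i ^+ 2.
Proof.
have b0 := @bounded_mfun_cst _ T R 0.
have := mean_residual_sqr a b0.
have -> : mean P (fun=> 0 ^+ 2 : R) = 0 by rewrite mean_cst expr0n.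
have coef0 i : coef (fun=> 0) i = 0.
  by rewrite /coef (@eq_mean _ _ _ _ _ (fun=> 0)) ?mean_cst// => x; rewrite mul0r.
rewrite big1 ?subr0 ?add0r; last by move=> i _; rewrite coef0 expr0n.
under [RHS]eq_bigr do rewrite coef0 subr0.
by move=> <-; apply: eq_mean => x; rewrite sub0r sqrrN.
Qed.

(** The inner product of the residuals is what truncation loses in the inner
    product of [f] and [g]; Cauchy-Schwarz then bounds it by both errors. *)
Lemma truncation_bias f g : bounded_mfun f -> bounded_mfun g ->
  (mean P (fun x => f x * g x) - \sum_i coef f i * coef g i) ^+ 2
  <= (mean P (fun x => f x ^+ 2) - \sum_i coef f i ^+ 2)
     * (mean P (fun x => g x ^+ 2) - \sum_i coef g i ^+ 2).
Proof.
move=> bf bg; rewrite -!residual_sqr//.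
rewrite (_ : _ - _ = mean P (fun x => (f x - \sum_i coef f i * F i x)
    * (g x - \sum_i coef g i * F i x))).
  by apply: mean_Cauchy_Schwarz; bounded_tac.
rewrite mean_residual_mul//.
under [X in _ - X + _]eq_bigr do rewrite mulrC.
ring.
Qed.

End orthonormal.

(** * Functions on the unit cube *)

Section cube_functions.
Context (R : realType) (d : nat).
Implicit Types f g : d.-tuple R -> R.

Lemma unif01_itv : @unif01 R [set x | 0 <= x <= 1] = 1%E.
Proof.
apply: (integral_uniform_pdf1 (@ltr01 R)) => x /=.
by rewrite in_itv.
Qed.

Lemma measurable_itv01 : measurable [set x : R | 0 <= x <= 1].
Proof.
rewrite (_ : [set _ | _] = `[0, 1]%classic); first exact: measurable_itv.
by apply/seteqP; split => x /=; rewrite in_itv.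
Qed.

Lemma measurable_cube : measurable (@cube R d).
Proof. exact: measurable_iid_all measurable_itv01. Qed.

Lemma unif_cube_cube : @unif_cube R d cube = 1%E.
Proof. exact: iid_law_all measurable_itv01 unif01_itv. Qed.

(** Basis functions are only controlled on the cube; extending them by zero
    makes them bounded without changing any integral. *)
Definition cut f x := f x * \1_(@cube R d) x.

Lemma cutE f x : cube x -> cut f x = f x.
Proof. by move=> cx; rewrite /cut indicE mem_set// mulr1. Qed.

Lemma cut_out f x : ~ cube x -> cut f x = 0.
Proof. by move=> cx; rewrite /cut indicE memNset// mulr0. Qed.

Lemma bounded_cut f M : measurable_fun setT f ->
  (forall x, cube x -> `|f x| <= M) -> bounded_mfun (cut f).
Proof.
move=> mf Mf; split.
  by apply: measurable_funM => //; apply: measurable_indic; exact: measurable_cube.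
exists (Num.max M 0) => x; have [cx|cx] := pselect (cube x).
  by rewrite cutE// le_max Mf.
by rewrite cut_out// normr0 le_max lexx orbT.
Qed.

Lemma ip_mean f g : ip f g = mean unif_cube (fun x => cut f x * cut g x).
Proof.
rewrite /ip Rintegral_mkcond; apply: eq_mean => x; rewrite patchE.
case: ifPn => [/set_mem cx|/negP cx]; first by rewrite !cutE.
by rewrite cut_out ?mul0r// => cx'; apply: cx; exact: mem_set.
Qed.

End cube_functions.

(** * Approximation in the wavelet basis *)

Lemma sum_sparse_le (R : realDomainType) (I : finType) (a : I -> R) (N : nat) (D : R) :
  0 <= D -> (forall i, a i <= D) -> (#|[pred i | (a i != 0)%R]| <= N)%N ->
  \sum_i a i <= N%:R * D.
Proof.
move=> D0 aD aN; rewrite (bigID [pred i | a i != 0]) /= [X in _ + X]big1 ?addr0.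
  apply: le_trans (ler_sum _ (fun i _ => aD i)) _.
  by rewrite sumr_const -[leLHS]mulr_natl ler_wpM2r// ler_nat.
by move=> i; rewrite negbK => /eqP.
Qed.

Section wavelets.
Context (R : realType) (d S J0 : nat) (W : cdv_basis R d S J0).

Local Notation U := (@unif_cube R d).

Definition phi j (m : Z W j) := cut (Phi m).
Definition psi_ j (i : wtype d * Z W j) := cut (Psi i).

Definition dim j : R := 2 ^+ (j * d).

Lemma dim_gt0 j : 0 < dim j. Proof. exact: exprn_gt0. Qed.

Lemma cut_localized (I : nat -> finType) (F : forall j, I j -> d.-tuple R -> R) :
  localized J0 F -> exists C N, 0 < C /\ forall j, (J0 <= j)%N ->
    (forall m x, cut (F j m) x ^+ 2 <= C * dim j) /\
    (forall x, (#|[pred m | (cut (F j m) x != 0)%R]| <= N)%N).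
Proof.
move=> [C [N H]]; exists (C ^+ 2 + 1), N; split.
  by rewrite ltr_wpDl// sqr_ge0.
move=> j jJ; have [HC _ HN] := H j jJ; split => [m x|x].
  have [cx|cx] := pselect (cube x); last first.
    by rewrite cut_out// expr0n /= mulr_ge0 ?addr_ge0 ?sqr_ge0// ltW// dim_gt0.
  rewrite cutE// -real_normK ?num_real//.
  have /(_ m x cx) HCx := HC.
  apply: (@le_trans _ _ ((C * Num.sqrt (dim j)) ^+ 2)).
    by rewrite lerXn2r// nnegrE// (le_trans _ HCx).
  rewrite exprMn sqr_sqrtr; last exact/ltW/dim_gt0.
  by rewrite ler_wpM2r ?lerDl// ltW// dim_gt0.
have [cx|cx] := pselect (cube x).
  apply: leq_trans (HN x cx); apply: eq_leq; apply: eq_card => m.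
  by rewrite !inE cutE.
by rewrite eq_card0// => m; rewrite !inE cut_out// eqxx.
Qed.

Lemma bounded_phi j (m : Z W j) : (J0 <= j)%N -> bounded_mfun (phi m).
Proof.
move=> jJ; have [C [N /(_ j jJ)[HC _ _]]] := localized_Phi W.
apply: (@bounded_cut _ _ _ (C * Num.sqrt (2 ^+ (j * d)))) => //.
  exact: measurable_Phi.
by move=> x; exact: HC.
Qed.

Lemma bounded_psi j (i : wtype d * Z W j) : (J0 <= j)%N -> bounded_mfun (psi_ i).
Proof.
move=> jJ; have [C [N /(_ j jJ)[HC _ _]]] := localized_Psi W.
apply: (@bounded_cut _ _ _ (C * Num.sqrt (2 ^+ (j * d)))) => //.
  exact: measurable_Psi.
by move=> x; exact: HC.
Qed.

Lemma ortho_phi j (m m' : Z W j) : (J0 <= j)%N ->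
  mean U (fun x => phi m x * phi m' x) = (m == m')%:R.
Proof. by move=> jJ; rewrite -ip_mean orthonormal_Phi. Qed.

Lemma ortho_psi j (m m' : wtype d * Z W j) : (J0 <= j)%N ->
  mean U (fun x => psi_ m x * psi_ m' x) = (m == m')%:R.
Proof. by move=> jJ; rewrite -ip_mean orthonormal_Psi. Qed.

Lemma cut_span (I : finType) (F : I -> d.-tuple R -> R) f :
  span_on_cube F f -> exists c, forall x, cut f x = \sum_m c m * cut (F m) x.
Proof.
move=> [c fc]; exists c => x; have [cx|cx] := pselect (cube x).
  by rewrite cutE// fc//; apply: eq_bigr => m _; rewrite cutE.
by rewrite cut_out// big1// => m _; rewrite cut_out ?mulr0.
Qed.

Lemma span_member (I : finType) (F : I -> d.-tuple R -> R) (c : I -> R) :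
  span_on_cube F (fun x => \sum_m c m * F m x).
Proof. by exists c. Qed.

Lemma phi_split j (c : Z W j.+1 -> R) : (J0 <= j)%N ->
  exists a b, forall x, \sum_m c m * phi m x
    = \sum_m a m * @phi j m x + \sum_i b i * @psi_ j i x.
Proof.
move=> jJ.
have /(multiresolution W jJ)[g [h [/cut_span[a ga] /cut_span[b hb] gh]]] :=
  span_member (@Phi _ _ _ _ W j.+1) c.
exists a, b => x; rewrite -ga -hb.
have [cx|cx] := pselect (cube x).
  by rewrite !cutE// -gh//; apply: eq_bigr => m _; rewrite /phi cutE.
by rewrite !cut_out// addr0 big1// => m _; rewrite /phi cut_out ?mulr0.
Qed.

(** A function of [V_(j+1)] splits into a part in [V_j] and a part in [W_j], so
    orthogonality to all finer wavelets propagates from the coarsest level. *)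
Lemma ortho_phi_psi j l (m : Z W j) (i : wtype d * Z W l) :
  (J0 <= j)%N -> (j <= l)%N -> mean U (fun x => phi m x * psi_ i x) = 0.
Proof.
elim: j => [|j IH] in m *; rewrite leq_eqVlt => /orP[/eqP jJ|jJ] jl.
- by move: m; rewrite -jJ => m; rewrite -ip_mean orthogonal_Phi_Psi// jJ.
- by [].
- by move: m; rewrite -jJ => m; rewrite -ip_mean orthogonal_Phi_Psi// jJ.
have [a [b ab]] := phi_split (fun m' => (m' == m)%:R) jJ.
have Jl : (J0 <= l)%N by exact: leq_trans (ltnW jJ) jl.
rewrite (@eq_mean _ _ _ _ _ (fun x => \sum_m a m * (phi m x * psi_ i x)
    + \sum_i' b i' * (@psi_ j i' x * psi_ i x))); last first.
  move=> x; have := ab x; rewrite (bigD1 m)//= eqxx mul1r big1 ?addr0; last first.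
    by move=> m' /negbTE ->; rewrite mul0r.
  move=> ->; rewrite mulrDl !mulr_suml.
  by congr (_ + _); apply: eq_bigr => m' _; rewrite mulrA.
have bp : forall m, bounded_mfun (@phi j m) by move=> ?; exact: bounded_phi.
have bq : forall m, bounded_mfun (@psi_ j m) by move=> ?; exact: bounded_psi.
have bi := bounded_psi i Jl.
have bt1 m' : bounded_mfun (fun x => a m' * (phi m' x * psi_ i x)).
  by have := bp m'; move=> ?; bounded_tac.
have bt2 m' : bounded_mfun (fun x => b m' * (psi_ m' x * psi_ i x)).
  by have := bq m'; move=> ?; bounded_tac.
rewrite meanD; [|by apply: bounded_mfun_sum..].
rewrite !mean_sum// !big1 ?addr0// => m' _; rewrite meanZl;
  do ?by apply: bounded_mfunM.
  by rewrite -ip_mean orthogonal_Psi ?mulr0// neq_ltn jl.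
by rewrite IH ?mulr0// ltnW.
Qed.

(** The squared distance to [V_j] and the energy at wavelet level [j]. *)
Definition tail_energy j (f : d.-tuple R -> R) : R :=
  mean U (fun x => f x ^+ 2) - \sum_(m : Z W j) coef U (@phi j) f m ^+ 2.

Definition level_energy j (f : d.-tuple R -> R) : R :=
  \sum_(i : wtype d * Z W j) coef U (@psi_ j) f i ^+ 2.

Definition phi_psi j (s : Z W j + wtype d * Z W j) :=
  match s with inl m => phi m | inr i => psi_ i end.

Lemma ortho_phi_psi_sum j (s s' : Z W j + wtype d * Z W j) : (J0 <= j)%N ->
  mean U (fun x => phi_psi s x * phi_psi s' x) = (s == s')%:R.
Proof.
move=> jJ; case: s s' => [m|i] [m'|i'] /=.
- by rewrite ortho_phi.
- by rewrite ortho_phi_psi.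
- by under eq_mean do rewrite mulrC; rewrite ortho_phi_psi.
- by rewrite ortho_psi.
Qed.

(** The best approximation from [V_(j+1)] belongs to [V_j + W_j], so that it is
    no better than the best one from that sum. *)
Lemma tail_energy_step j f : (J0 <= j)%N -> bounded_mfun f ->
  tail_energy j f <= tail_energy j.+1 f + level_energy j f.
Proof.
move=> jJ bf; have jJ1 := leqW jJ.
have [a [b ab]] := phi_split (coef U (@phi j.+1) f) jJ.
have bp : forall m, bounded_mfun (@phi j m) by move=> ?; exact: bounded_phi.
have bq : forall m, bounded_mfun (@psi_ j m) by move=> ?; exact: bounded_psi.
have bs s : bounded_mfun (@phi_psi j s) by case: s.
have := best_approximation bs (fun s s' => ortho_phi_psi_sum s s' jJ)
  (fun s => match s with inl m => a m | inr i => b i end) bf.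
rewrite big_sumType /=.
rewrite /tail_energy /level_energy => H.
rewrite -(@residual_sqr _ _ _ U _ (@phi j.+1))//; [|by move=> m; exact: bounded_phi|by move=> *; exact: ortho_phi].
rewrite -lerBlDr -addrA -opprD; apply: le_trans H _.
rewrite le_eqVlt; apply/orP; left; apply/eqP/eq_mean => x.
by rewrite big_sumType /= ab.
Qed.

End wavelets.

Section smoothness.
Context (R : realType) (d S J0 : nat) (W : cdv_basis R d S J0).

(** The factor by which Hoelder smoothness [a] reduces approximation errors
    from one resolution level to the next. *)
Definition decay (a : R) : R := 2 `^ (- a).

Lemma decay_gt0 a : 0 < decay a. Proof. by rewrite powR_gt0. Qed.

Lemma decay_lt1 a : 0 < a -> decay a < 1.
Proof.
move=> a0; rewrite /decay powRN invf_lt1 ?powR_gt0//.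
have : (1 : R) `^ a < 2 `^ a by apply: gt0_ltr_powR => //; rewrite ?nnegrE ?ltr1n.
by rewrite powR1.
Qed.

Lemma span_Phi_le i j f : (J0 <= i)%N -> (i <= j)%N ->
  span_on_cube (@Phi _ _ _ _ W i) f -> span_on_cube (@Phi _ _ _ _ W j) f.
Proof.
move=> Ji /subnKC <-; elim: (j - i)%N => [|n IH] fi; first by rewrite addn0.
rewrite addnS; apply/multiresolution; first by rewrite (leq_trans Ji)// leq_addr.
exists f, (fun=> 0); split; [exact: IH| |by move=> x _; rewrite addr0].
by exists (fun=> 0) => x _; rewrite big1// => m _; rewrite mul0r.
Qed.

Lemma tail_energy_dense j (p : d.-tuple R -> R) (B e : R) : (J0 <= j)%N -> measurable_fun setT p ->
  (forall x, cube x -> `|p x| <= B) -> 0 < e ->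
  exists2 J, (j <= J)%N & tail_energy W J (cut p) <= e.
Proof.
move=> jJ mp pB e0; have bp := bounded_cut mp pB.
have sq : square_integrable p.
  split; first exact: measurable_funTS.
  rewrite integral_mkcond.
  rewrite (_ : _ \_ _ = fun x => (cut p x ^+ 2)%:E).
    by rewrite -EFin_mean ?ltry//; exact: bounded_mfunX.
  apply/funext => x; rewrite patchE; case: ifPn => [/set_mem cx|/negP cx].
    by rewrite cutE.
  by rewrite cut_out ?expr0n// => cx'; apply: cx; exact: mem_set.
have [i [g [Ji gi Hg]]] := dense_V W sq e0.
exists (maxn i j); first exact: leq_maxr.
have [a ga] := cut_span (span_Phi_le Ji (leq_maxl i j) gi).
have Jm : (J0 <= maxn i j)%N by rewrite (leq_trans jJ)// leq_maxr.
have bphi (m : Z W (maxn i j)) : bounded_mfun (phi m) by exact: bounded_phi.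
apply: le_trans (best_approximation bphi (fun m m' => ortho_phi m m' Jm) a bp) _.
rewrite -lee_fin EFin_mean; last by bounded_tac.
apply: le_trans (ltW Hg); rewrite [leRHS]integral_mkcond le_eqVlt.
apply/orP; left; apply/eqP/eq_integral => x _.
rewrite patchE; case: ifPn => [/set_mem cx|/negP cx].
  by rewrite -ga !cutE.
rewrite -ga !cut_out ?subrr ?expr0n// => cx'; apply: cx; exact: mem_set.
Qed.

Lemma tail_energy_le j n f : (J0 <= j)%N -> bounded_mfun f ->
  tail_energy W j f
  <= tail_energy W (j + n) f + \sum_(l < n) level_energy W (j + l) f.
Proof.
move=> jJ bf; elim: n => [|n IH]; first by rewrite addn0 big_ord0 addr0.
apply: (le_trans IH); rewrite big_ord_recr /= addrA (addrAC _ (\sum__ _)) lerD2r.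
by rewrite addnS; apply: tail_energy_step => //; rewrite (leq_trans jJ)// leq_addr.
Qed.

Lemma holder_coef a M (p : d.-tuple R -> R) l (i : wtype d * Z W l) : holder_ball W a M p ->
  (J0 <= l)%N -> ip p (Psi i) ^+ 2 <= M ^+ 2 * (decay a ^+ l) ^+ 2 / dim R d l.
Proof.
move=> [_ Hp] Jl.
have HM : 2 `^ (l%:R * (a + d%:R / 2)) * `|ip p (Psi i)| <= M.
  rewrite -lee_fin; apply: le_trans Hp.
  apply: le_trans (leeDr _ _); last first.
    rewrite lee_fin mulr_ge0 ?powR_ge0//.
    by elim/big_ind: _ => // x y x0 y0; rewrite le_max x0.
  by apply: ereal_sup_ubound; exists l, i.
have M0 : 0 <= M by apply: le_trans HM; rewrite mulr_ge0 ?powR_ge0.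
have : (2 `^ (l%:R * (a + d%:R / 2)) * `|ip p (Psi i)|) ^+ 2 <= M ^+ 2.
  by rewrite lerXn2r// nnegrE ?mulr_ge0 ?powR_ge0.
rewrite exprMn real_normK ?num_real//.
rewrite (_ : (2 `^ _) ^+ 2 = dim R d l / (decay a ^+ l) ^+ 2).
  move=> H; rewrite ler_pdivlMr ?dim_gt0//.
  have q0 : decay a ^+ l != 0 by rewrite gt_eqF// exprn_gt0// decay_gt0.
  rewrite (_ : _ * dim R d l = dim R d l / (decay a ^+ l) ^+ 2 * ip p (Psi i) ^+ 2
    * (decay a ^+ l) ^+ 2); last by field.
  by apply: ler_wpM2r => //; exact: sqr_ge0.
have powX (x : R) n : (2 `^ x) ^+ n = 2 `^ (x * n%:R).
  by rewrite powRrM powR_mulrn ?powR_ge0.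
rewrite /dim /decay -(@powR_mulrn R 2 (l * d))// !powX -powRB; last by rewrite pnatr_eq0 implybT.
by congr (_ `^ _); rewrite natrM; field.
Qed.

Lemma level_energy_holder a M : exists2 C, 0 < C & forall l (p : d.-tuple R -> R), (J0 <= l)%N ->
  holder_ball W a M p -> level_energy W l (cut p) <= C * (decay a ^+ l) ^+ 2.
Proof.
have [c [C [c0 HC]]] := card_Z W.
have C0 : 0 <= C.
  have /andP[lo up] := HC _ (leqnn J0); have := le_trans lo up.
  rewrite ler_pM2r ?exprn_gt0//; exact/le_trans/ltW.
exists (#|{: wtype d}|%:R * C * M ^+ 2 + 1).
  by rewrite ltr_wpDl// mulr_ge0 ?sqr_ge0// mulr_ge0.
move=> l p Jl Hp; have /andP[_ up] := HC l Jl.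
apply: (@le_trans _ _ (\sum_(i : wtype d * Z W l)
    M ^+ 2 * (decay a ^+ l) ^+ 2 / dim R d l)).
  apply: ler_sum => i _; rewrite /coef /psi_ -ip_mean; exact: holder_coef.
rewrite sumr_const card_prod -[leLHS]mulr_natl natrM.
apply: (@le_trans _ _ (#|{: wtype d}|%:R * (C * dim R d l) * (M ^+ 2 * (decay a ^+ l) ^+ 2 / dim R d l))).
  apply: ler_wpM2r; last exact: ler_wpM2l.
  by apply: divr_ge0; [apply: mulr_ge0; exact: sqr_ge0|exact/ltW/dim_gt0].
rewrite (_ : _ * _ = #|{: wtype d}|%:R * C * M ^+ 2 * (decay a ^+ l) ^+ 2).
  by rewrite ler_wpM2r ?sqr_ge0// lerDl.
by field; rewrite gt_eqF// dim_gt0.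
Qed.

(** Telescoping the level energies bounds the distance to [V_j] by a geometric
    series plus the distance to a finer space, which density makes small. *)
Lemma holder_tail a M : 0 < a -> exists2 C, 0 < C & forall j (p : d.-tuple R -> R) B, (J0 <= j)%N ->
  measurable_fun setT p -> (forall x, cube x -> `|p x| <= B) ->
  holder_ball W a M p -> tail_energy W j (cut p) <= C * (decay a ^+ j) ^+ 2.
Proof.
move=> a0; have [C C0 HC] := level_energy_holder a M.
pose q := decay a ^+ 2.
have q0 : 0 < q by rewrite exprn_gt0// decay_gt0.
have q1 : q < 1 by rewrite exprn_ilt1 ?decay_lt1// ltW// decay_gt0.
exists (C / (1 - q)); first by rewrite divr_gt0// subr_gt0.
move=> j p B jJ mp pB Hp; apply/ler_addgt0Pr => e e0.
have [J jJ' HJ] := tail_energy_dense jJ mp pB e0.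
have := tail_energy_le (J - j) jJ (bounded_cut mp pB); rewrite subnKC// => H.
apply: (le_trans H); rewrite addrC lerD//.
apply: (@le_trans _ _ (\sum_(l < J - j) C * (decay a ^+ j) ^+ 2 * q ^+ l)).
  apply: ler_sum => l _; apply: le_trans (HC _ _ _ Hp) _.
    by rewrite (leq_trans jJ)// leq_addr.
  by rewrite exprD exprMn mulrA /q (exprAC _ 2).
rewrite -mulr_sumr [leRHS]mulrAC; apply: ler_wpM2l.
  by rewrite mulr_ge0 ?sqr_ge0// ltW.
have : (1 - q) * \sum_(l < J - j) q ^+ l <= 1.
  by rewrite -opprB mulNr -subrX1 opprB lerBlDr lerDl exprn_ge0// ltW.
by move=> Hq; rewrite -[leRHS]div1r ler_pdivlMr ?subr_gt0// mulrC.
Qed.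

End smoothness.

(** * Conditional expectations given a covariate *)

Lemma staircase (R : realFieldType) (e : R) K y : 0 < e -> 0 <= y -> y <= K%:R * e ->
  `|y - e * \sum_(i < K) (i.+1%:R * e <= y)%R%:R| <= e.
Proof.
move=> e0; elim: K y => [|K IH] y y0 yK.
  by rewrite big_ord0 mulr0 subr0 ger0_norm// (le_trans yK)// mul0r ltW.
have [ye|ey] := ltP y e.
  rewrite big1 ?mulr0 ?subr0 ?ger0_norm// ?ltW// => i _.
  rewrite (_ : (_ <= y) = false)//; apply/negbTE; rewrite -ltNge (lt_le_trans ye)//.
  by rewrite ler_peMl ?ler1n// ltW.
rewrite big_ord_recl /= mul1r ey /=.
have := IH (y - e); rewrite subr_ge0 => /(_ ey).
rewrite lerBlDr (_ : K%:R * e + e = K.+1%:R * e) ?yK; last by rewrite -natr1; ring.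
move=> /(_ isT); rewrite mulrDr mulr1 opprD addrA.
congr (`|_ - e * _| <= _); apply: eq_bigr => i _; congr ((nat_of_bool _)%:R).
by rewrite lerBrDr -[X in _ + X]mul1r -mulrDl natr1.
Qed.

Section conditional.
Context d d' (T : measurableType d) (T' : measurableType d') (R : realType).
Variables (P : probability T R) (X : T -> T').
Hypothesis mX : measurable_fun setT X.

Let mXB B : measurable B -> measurable (X @^-1` B).
Proof. by move=> mB; rewrite -[X in measurable X]setTI; exact: mX. Qed.

(** Testing against indicators of [X] is enough, because a bounded function of
    [X] is uniformly close to a staircase of indicators of its superlevel
    sets. *)
Lemma mean_orthogonal_indic (D : T -> R) : bounded_mfun D ->
  (forall B, measurable B -> mean P (fun z => D z * \1_B (X z)) = 0) ->
  forall g, bounded_mfun g -> mean P (fun z => D z * g (X z)) = 0.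
Proof.
move=> bD D0 g bg; have [mg [L Lg]] := bg; have [mD [M MD]] := bD.
have bgX : bounded_mfun (g \o X) by exact: bounded_mfun_comp.
have [L0|] := leP 0 L; last first.
  move=> L0; rewrite (@eq_mean _ _ _ _ _ (fun=> 0)) ?mean_cst// => z.
  by have := le_lt_trans (Lg (X z)) L0; rewrite normr_lt0.
suff H : forall e, 0 < e -> `|mean P (fun z => D z * g (X z))| <= Num.max M 0 * e.
  apply/eqP; rewrite -normr_le0; apply/ler_addgt0Pr => e e0; rewrite add0r.
  apply: le_trans (H (e / (Num.max M 0 + 1)) _) _.
    by rewrite divr_gt0// ltr_wpDl// le_max lexx orbT.
  have M1 : 0 <= Num.max M 0 by rewrite le_max lexx orbT.
  by rewrite mulrA ler_pdivrMr ?ltr_wpDl// mulrC ler_wpM2l ?lerDl// ltW.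
move=> e e0.
pose K := (Num.truncn (2 * L / e)).+1.
have KL : 2 * L <= K%:R * e.
  by rewrite -ler_pdivrMr// ltW// truncnS_gt.
pose B (i : 'I_K) := [set x : T' | i.+1%:R * e <= g x + L].
have mB i : measurable (B i).
  rewrite (_ : B i = g @^-1` [set y | i.+1%:R * e - L <= y]).
    by rewrite -[X in measurable X]setTI; apply: mg => //; rewrite -set_itvcy.
  by apply/seteqP; split => x; rewrite /B /= lerBlDr.
pose gs x := - L + e * \sum_(i < K) \1_(B i) x.
have gsE x : `|g x - gs x| <= e.
  have := @staircase _ e K (g x + L) e0.
  have /andP[g1 g2] : - L <= g x <= L by rewrite -ler_norml.
  have -> : 0 <= g x + L by rewrite -lerBlDr sub0r.
  have -> : g x + L <= K%:R * e.
    by apply: le_trans KL; rewrite mulr2n mulrDl mul1r lerD2r.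
  move=> /(_ isT isT); rewrite /gs opprD opprK addrA.
  congr (`|_ - e * _| <= _); apply: eq_bigr => i _.
  rewrite indicE; congr ((nat_of_bool _)%:R).
  by apply/idP/idP => [|/set_mem//]; move=> h; exact: mem_set.
have b1 i : bounded_mfun (fun z => \1_(B i) (X z) : R).
  by apply: (@bounded_mfun_comp _ _ _ _ _ X (\1_(B i))) => //; exact: bounded_mfun_indic.
have bgs : bounded_mfun (fun z => gs (X z)) by rewrite /gs; bounded_tac.
have gs0 : mean P (fun z => D z * gs (X z)) = 0.
  rewrite (@eq_mean _ _ _ _ _ (fun z => - L * (D z * \1_setT (X z))
      + \sum_(i < K) e * (D z * \1_(B i) (X z)))); last first.
    move=> z; rewrite /gs indicT mulr1 mulrDr [X in X + _]mulrC; congr (_ + _).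
    by rewrite !mulr_sumr; apply: eq_bigr => i _; ring.
  have bT : bounded_mfun (fun z => \1_[set: T'] (X z) : R).
    by rewrite indicT; exact: bounded_mfun_cst.
  rewrite meanD ?meanZl ?mean_sum; try by bounded_tac.
    rewrite D0// mulr0 add0r big1// => i _; rewrite meanZl ?D0 ?mulr0//.
    by bounded_tac.
  by move=> i; bounded_tac.
rewrite -[X in `|X|]subr0 -{1}gs0 -meanB; try by bounded_tac.
rewrite ler_norml -{1}(mean_cst P (- _)) -{2}(mean_cst P (_ * e)).
have bound z : `|D z * g (X z) - D z * gs (X z)| <= Num.max M 0 * e.
  by rewrite -mulrBr normrM ler_pM// le_max MD.
apply/andP; split; apply: le_mean; try by bounded_tac.
  by move=> z; have := bound z; rewrite ler_norml => /andP[].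
by move=> z; have := bound z; rewrite ler_norml => /andP[].
Qed.

Lemma integral_good (G D : set T) (u v : T -> R) : measurable G -> P G = 1%E ->
  measurable D -> measurable_fun setT u -> measurable_fun setT v ->
  (forall z, G z -> u z = v z) ->
  (\int[P]_(z in D) (u z)%:E = \int[P]_(z in D) (v z)%:E)%E.
Proof.
move=> mG PG mD mu mv uv.
have PCG : P (~` G) = 0%E by rewrite probability_setC// PG subee.
apply: ae_eq_integral => //.
- by apply/measurable_EFinP; exact: measurable_funTS.
- by apply/measurable_EFinP; exact: measurable_funTS.
exists (~` G); split; [exact: measurableC|exact: PCG|].
by move=> x /= Hx Gx; apply: Hx => _; rewrite uv.
Qed.

Lemma integral_indicX (D : T -> R) (B : set T') : bounded_mfun D -> measurable B ->
  (mean P (fun z => D z * \1_B (X z)))%:E = (\int[P]_(z in X @^-1` B) (D z)%:E)%E.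
Proof.
move=> bD mB; rewrite EFin_mean; last first.
  apply: bounded_mfunM => //.
  by apply: (@bounded_mfun_comp _ _ _ _ _ X (\1_B)) => //; exact: bounded_mfun_indic.
rewrite [RHS]integral_mkcond; apply: eq_integral => z _.
rewrite patchE indicE; case: ifPn => [/set_mem Bz|/negP Bz].
  by rewrite mem_set// mulr1.
by rewrite memNset ?mulr0// => Bz'; apply: Bz; exact: mem_set.
Qed.

Section cond_exp.
Variables (G : set T) (V V' : T -> R).
(* [V'] is a bounded version of [V]. *)
Hypotheses (mG : measurable G) (PG : P G = 1%E) (mV : measurable_fun setT V)
  (bV' : bounded_mfun V') (VV' : forall z, G z -> V z = V' z).

Lemma is_cond_exp_mean f f' : is_cond_exp P X V f -> bounded_mfun f' ->
  (forall z, G z -> f (X z) = f' (X z)) ->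
  forall g, bounded_mfun g ->
  mean P (fun z => V' z * g (X z)) = mean P (fun z => f' (X z) * g (X z)).
Proof.
move=> [mf intf fE] bf' ff' g bg.
have bfX : bounded_mfun (fun z => f' (X z)) by exact: (bounded_mfun_comp mX bf').
have bgX : bounded_mfun (fun z => g (X z)) by exact: (bounded_mfun_comp mX bg).
have bD : bounded_mfun (fun z => V' z - f' (X z)) by bounded_tac.
apply/eqP; rewrite -subr_eq0 -meanB; try by bounded_tac.
rewrite (@eq_mean _ _ _ _ _ (fun z => (V' z - f' (X z)) * g (X z))); last first.
  by move=> z; rewrite mulrBl.
apply/eqP/mean_orthogonal_indic => // B mB.
have b1 : bounded_mfun (fun z => \1_B (X z) : R).
  by apply: (@bounded_mfun_comp _ _ _ _ _ X (\1_B)) => //; exact: bounded_mfun_indic.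
rewrite (@eq_mean _ _ _ _ _ (fun z => V' z * \1_B (X z) - f' (X z) * \1_B (X z))).
  rewrite meanB; try by bounded_tac.
  apply/eqP; rewrite subr_eq0; apply/eqP/EFin_inj; rewrite !integral_indicX//.
  rewrite -(@integral_good G _ V V')//; [|exact: mXB|by case: bV'].
  rewrite -(@integral_good G _ (f \o X) (f' \o X))//; [exact: fE|exact: mXB| |].
    exact: measurableT_comp.
  by case: bfX.
by move=> z; rewrite mulrBl.
Qed.

(** The conditional expectation is the density, with respect to the law of [X],
    of the image under [X] of the charge with density [V']. *)
Lemma is_cond_exp_exists : exists f, is_cond_exp P X V f.
Proof.
have intV := bounded_mfun_integrable P bV'.
pose X' : {mfun T >-> T'} := HB.pack X (isMeasurableFun.Build _ _ _ _ X mX).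
(* the charge structure on a pushforward takes the measurability of the map *)
pose nu_ : {charge set T' -> \bar R} := pushforward (induced_charge intV) X.
pose nu := nu_ mX.
pose mu : probability T' R := distribution P X'.
have numu : nu `<< mu.
  apply/null_content_dominatesP => A mA muA0.
  apply: (@null_set_integral _ _ _ P (X @^-1` A) (EFin \o V')) => //.
    exact: mXB.
  by apply/measurable_EFinP/measurable_funTS; case: bV'.
have RN_fin x := Radon_Nikodym_fin_num x numu.
pose f x := fine (Radon_Nikodym nu mu x).
have fE x : (f x)%:E = Radon_Nikodym nu mu x by rewrite fineK.
have intRN := Radon_Nikodym_integrable numu.
have mRN : measurable_fun setT (Radon_Nikodym nu mu) := measurable_int _ intRN.
have mf : measurable_fun setT f.
  by apply/measurable_EFinP; rewrite (_ : EFin \o f = Radon_Nikodym nu mu)//; exact/funext.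
have intfX : P.-integrable setT (EFin \o (f \o X)).
  have /integrableP[_ fin] := intRN.
  apply/integrableP; split; first by apply/measurable_EFinP; exact: measurableT_comp.
  move: fin; rewrite ge0_integral_distribution//; last exact: measurableT_comp.
  by apply: le_lt_trans; rewrite le_eqVlt; apply/orP; left; apply/eqP/eq_integral => z _;
    rewrite /= -fE.
exists f; split => // B mB.
rewrite (@integral_good G _ V V')//; [|exact: mXB|by case: bV'].
rewrite (_ : (\int[P]_(z in _) (V' z)%:E)%E = nu B)//.
rewrite (Radon_Nikodym_integral numu mB).
rewrite (@integral_pushforward _ _ _ _ _ _ mX P B (Radon_Nikodym nu mu))//.
  by apply: eq_integral => z _; rewrite /= -fE.
rewrite (_ : _ \o X = EFin \o (f \o X)); last by apply/funext => z; rewrite /= -fE.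
by apply: (integrableS measurableT) => //; exact: mXB.
Qed.

Lemma cond_expP : is_cond_exp P X V (cond_exp P X V).
Proof.
have [f Hf] := is_cond_exp_exists.
by apply: (@xgetPex _ (fun=> 0) [set f | is_cond_exp P X V f]); exists f.
Qed.

End cond_exp.

Lemma is_cond_exp_unique V f f' : is_cond_exp P X V f -> is_cond_exp P X V f' ->
  exists G, [/\ measurable G, P G = 1%E & forall z, G z -> f (X z) = f' (X z)].
Proof.
move=> [mf intf fE] [mf' intf' fE'].
pose X' : {mfun T >-> T'} := HB.pack X (isMeasurableFun.Build _ _ _ _ X mX).
pose mu : probability T' R := distribution P X'.
have meas h : measurable_fun setT h -> measurable_fun setT (EFin \o h : T' -> _).
  by move=> ?; exact/measurable_EFinP.
have int_mu B h : measurable_fun setT h ->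
    P.-integrable setT (EFin \o (h \o X)) -> measurable B ->
    (\int[mu]_(x in B) (h x)%:E = \int[P]_(z in X @^-1` B) (h (X z))%:E)%E.
  move=> mh inth mB.
  rewrite (@integral_pushforward _ _ _ _ _ _ mX P B (EFin \o h))//; first exact: meas.
  by apply: (integrableS measurableT) => //; exact: mXB.
have : ae_eq mu setT (EFin \o f) (EFin \o f').
  apply: integral_ae_eq => //.
  - by apply: (@integrable_pushforward _ _ _ _ _ _ mX P setT) => //; exact: meas.
  - exact: meas.
  - by move=> B _ mB; rewrite !int_mu// -fE// -fE'.
move=> [N [mN N0 subN]]; exists (~` (X @^-1` N)); split.
- by apply: measurableC; exact: mXB.
- rewrite probability_setC; last exact: mXB.
  by rewrite (_ : P (X @^-1` N) = 0%E)// sube0.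
- move=> z; apply: contra_notP => ff'; apply: subN => /= H.
  by apply: ff'; apply: EFin_inj; exact: H.
Qed.

End conditional.

(** * Laws in the model *)

Lemma probability_setI1 d (T : measurableType d) (R : realType)
    (P : probability T R) (A B : set T) : measurable A -> measurable B ->
  P A = 1%E -> P B = 1%E -> P (A `&` B) = 1%E.
Proof.
move=> mA mB PA PB.
have mCA := measurableC mA; have mCB := measurableC mB.
have mI := measurableI _ _ mA mB.
have PCA : P (~` A) = 0%E by rewrite probability_setC// PA subee.
have PCB : P (~` B) = 0%E by rewrite probability_setC// PB subee.
suff PI0 : P (~` (A `&` B)) = 0%E.
  by rewrite -(setCK (A `&` B)) probability_setC ?PI0 ?sube0//; exact: measurableC.

apply/eqP; rewrite eq_le measure_ge0 andbT setCI.
apply: le_trans (measureU2 _ mCA mCB) _.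
by rewrite [X in (X + _)%E]PCA [X in (_ + X)%E]PCB adde0.
Qed.

(** Let [del] be the modulus of continuity at oscillation one: [N] steps of
    length less than [del] lead from the origin to any point of the cube. *)
Lemma ucont_bounded (R : realType) d (f : d.-tuple R -> R) : ucont f ->
  exists B, forall x, cube x -> `|f x| <= B.
Proof.
move=> /(_ 1 ltr01)[del del0 Hf].
pose N := (Num.truncn del^-1).+1.
have N0 : 0 < N%:R :> R by rewrite ltr0n.
have Ndel : N%:R^-1 < del.
  by rewrite -[ltRHS]invrK ltf_pV2 ?posrE ?invr_gt0// truncnS_gt.
pose y x (i : nat) : d.-tuple R := [tuple i%:R / N%:R * tnth x k | k < d].
have ycube x i : cube x -> (i <= N)%N -> cube (y x i).
  move=> cx iN k; rewrite tnth_mktuple; have /andP[x0 x1] := cx k.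
  rewrite mulr_ge0 ?divr_ge0//= mulr_ile1 ?divr_ge0//.
  by rewrite ler_pdivrMr// mul1r ler_nat.
pose f0 := f [tuple 0 | _ < d].
exists (`|f0| + N%:R) => x cx.
have step i : (i <= N)%N -> `|f (y x i)| <= `|f0| + i%:R.
  elim: i => [|i IH] iN.
    rewrite addr0 /f0 (_ : y x 0%N = [tuple 0 | _ < d])//.
    by apply: eq_from_tnth => k; rewrite !tnth_mktuple !mul0r.
  have {}IH := IH (ltnW iN).
  have : `|f (y x i.+1) - f (y x i)| < 1.
    apply: Hf; [exact: ycube|by apply: ycube => //; exact: ltnW|].
    move=> k; rewrite !tnth_mktuple -mulrBl -mulrBl -natrB// subSnn mul1r.
    have /andP[x0 x1] := cx k.
    rewrite normrM ger0_norm ?invr_ge0 ?ltW// (ger0_norm x0).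
    by apply: le_lt_trans Ndel; rewrite ler_piMr// invr_ge0 ltW.
  move=> h; rewrite -(subrK (f (y x i)) (f (y x i.+1))).
  rewrite (le_trans (ler_normD _ _))// -natr1 addrA addrC lerD// ltW//.
have := step N (leqnn N); rewrite (_ : y x N = x)//.
by apply: eq_from_tnth => k; rewrite tnth_mktuple divff ?mul1r// gt_eqF.
Qed.

Section model.
Context (R : realType) (d S J0 : nat) (W : cdv_basis R d S J0).

Local Notation obs := (d.-tuple R * R * R)%type.
Local Notation U := (@unif_cube R d).

Section good.
Variables C1 C2 : R.

(** The responses are bounded only almost surely; on this set of full measure
    they agree with their bounded versions [cutA] and [cutY]. *)
Definition good : set obs := [set z | cube (obsX z) /\
  (C1 <= obsA z <= C2 /\ C1 <= obsY z <= C2)].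

Definition cutA (z : obs) := obsA z * \1_good z.
Definition cutY (z : obs) := obsY z * \1_good z.

Lemma measurable_obsX : measurable_fun setT (@obsX R d).
Proof. exact: measurableT_comp measurable_fst measurable_fst. Qed.

Lemma measurable_obsA : measurable_fun setT (@obsA R d).
Proof. exact: measurableT_comp measurable_snd measurable_fst. Qed.

Lemma measurable_obsY : measurable_fun setT (@obsY R d).
Proof. exact: measurable_snd. Qed.

Lemma measurable_preimage_itv (f : obs -> R) : measurable_fun setT f ->
  measurable [set z | C1 <= f z <= C2].
Proof.
move=> mf; rewrite (_ : [set _ | _] = f @^-1` `[C1, C2]%classic).
  by rewrite -[X in measurable X]setTI; exact: mf.
by apply/seteqP; split => z /=; rewrite in_itv.
Qed.

Lemma measurable_range : measurable
  [set z : obs | C1 <= obsA z <= C2 /\ C1 <= obsY z <= C2].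
Proof.
apply: measurableI; apply: measurable_preimage_itv.
  exact: measurable_obsA.
exact: measurable_obsY.
Qed.

Lemma measurable_obsX_cube : measurable (@obsX R d @^-1` cube).
Proof.
rewrite -[X in measurable X]setTI; apply: measurable_obsX => //.
exact: measurable_cube.
Qed.

Lemma measurable_good : measurable good.
Proof. exact: measurableI measurable_obsX_cube measurable_range. Qed.

Definition range_bound : R := `|C1| + `|C2|.

Lemma norm_le_range_bound x : C1 <= x <= C2 -> `|x| <= range_bound.
Proof.
rewrite /range_bound => /andP[h1 h2]; have := ler_norm C2; have := ler_norm (- C1).
rewrite normrN; have := normr_ge0 C1; have := normr_ge0 C2.
by rewrite ler_norml => *; apply/andP; split; lra.
Qed.

Lemma cutAE z : good z -> cutA z = obsA z.
Proof. by move=> gz; rewrite /cutA indicE mem_set// mulr1. Qed.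

Lemma cutYE z : good z -> cutY z = obsY z.
Proof. by move=> gz; rewrite /cutY indicE mem_set// mulr1. Qed.

Lemma cutA_le z : `|cutA z| <= range_bound.
Proof.
have [gz|gz] := pselect (good z).
  by rewrite cutAE// norm_le_range_bound//; case: gz => _ [].
by rewrite /cutA indicE memNset// mulr0 normr0 addr_ge0.
Qed.

Lemma cutY_le z : `|cutY z| <= range_bound.
Proof.
have [gz|gz] := pselect (good z).
  by rewrite cutYE// norm_le_range_bound//; case: gz => _ [].
by rewrite /cutY indicE memNset// mulr0 normr0 addr_ge0.
Qed.

Lemma bounded_cutA : bounded_mfun cutA.
Proof.
split; last by exists range_bound; exact: cutA_le.
apply: measurable_funM; first exact: measurable_obsA.
by apply: measurable_indic; exact: measurable_good.
Qed.

Lemma bounded_cutY : bounded_mfun cutY.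
Proof.
split; last by exists range_bound; exact: cutY_le.
apply: measurable_funM; first exact: measurable_obsY.
by apply: measurable_indic; exact: measurable_good.
Qed.

End good.

Lemma bounded_obsX (g : d.-tuple R -> R) : bounded_mfun g ->
  bounded_mfun (fun z : obs => g (obsX z)).
Proof. by move=> bg; apply: (bounded_mfun_comp measurable_obsX bg). Qed.

Section law.
Variables (P : probability obs R) (a b M C1 C2 : R).
Hypothesis PM : model W a b M C1 C2 P.

Lemma mean_obsX g : bounded_mfun g ->
  mean P (fun z => g (obsX z)) = mean U g.
Proof.
have [PX _ _ _] := PM; move=> bg.
rewrite (@mean_pushforward _ _ _ _ _ P U (@obsX R d) g)//.
  exact: measurable_obsX.
by move=> B mB; rewrite PX.
Qed.

Lemma model_good : P (good C1 C2) = 1%E.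
Proof.
have [PX [N [mN N0 subN]] _ _] := PM.
apply: probability_setI1; [exact: measurable_obsX_cube|exact: measurable_range| |].
  by have := PX _ (@measurable_cube R d); rewrite unif_cube_cube.
apply/eqP; rewrite eq_le probability_le1/=; last exact: measurable_range.
have -> : 1%E = P (~` N) by rewrite probability_setC// (_ : P N = 0%E)// sube0.
apply: le_measure; rewrite ?inE; [exact: measurableC|exact: measurable_range|].
by move=> z Nz; apply: contrapT => h; apply: Nz; exact: subN.
Qed.

(** The functional is [E[AY]] minus the inner product of the regression
    functions: versions of a conditional expectation agree almost surely, so
    this holds whichever versions define the conditional covariance. *)
Lemma model_regression : exists p q : d.-tuple R -> R,
  [/\ [/\ measurable_fun setT p, exists B, forall x, cube x -> `|p x| <= B
        & holder_ball W a M p],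
      [/\ measurable_fun setT q, exists B, forall x, cube x -> `|q x| <= B
        & holder_ball W b M q],
      forall g, bounded_mfun g -> mean P (fun z => cutA C1 C2 z * g (obsX z))
        = mean U (fun x => cut p x * g x),
      forall g, bounded_mfun g -> mean P (fun z => cutY C1 C2 z * g (obsX z))
        = mean U (fun x => cut q x * g x) &
      psi P = mean P (fun z => cutA C1 C2 z * cutY C1 C2 z)
        - mean U (fun x => cut p x * cut q x)].
Proof.
have [PX _ [p Hp Hhp] [q Hq Hhq]] := PM.
have [mp _ _] := Hp; have [mq _ _] := Hq.
have [Bp HBp] := ucont_bounded (proj1 Hhp).
have [Bq HBq] := ucont_bounded (proj1 Hhq).
have bp : bounded_mfun (cut p) := bounded_cut mp HBp.
have bq : bounded_mfun (cut q) := bounded_cut mq HBq.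
have mG := measurable_good C1 C2.
have bA := bounded_cutA C1 C2; have bY := bounded_cutY C1 C2.
have EA z (gz : good C1 C2 z) := esym (cutAE gz).
have EY z (gz : good C1 C2 z) := esym (cutYE gz).
have pX z : good C1 C2 z -> p (obsX z) = cut p (obsX z) by move=> [cx _]; rewrite cutE.
have qX z : good C1 C2 z -> q (obsX z) = cut q (obsX z) by move=> [cx _]; rewrite cutE.
have regA g : bounded_mfun g -> mean P (fun z => cutA C1 C2 z * g (obsX z))
    = mean U (fun x => cut p x * g x).
  move=> bg; rewrite (is_cond_exp_mean measurable_obsX mG model_good measurable_obsA bA EA Hp bp pX bg).
  by rewrite -mean_obsX//; bounded_tac.
have regY g : bounded_mfun g -> mean P (fun z => cutY C1 C2 z * g (obsX z))
    = mean U (fun x => cut q x * g x).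
  move=> bg; rewrite (is_cond_exp_mean measurable_obsX mG model_good measurable_obsY bY EY Hq bq qX bg).
  by rewrite -mean_obsX//; bounded_tac.
exists p, q; split => //; [by split => //; exists Bp|by split => //; exists Bq|].
have cA := cond_expP measurable_obsX mG model_good measurable_obsA bA EA.
have cY := cond_expP measurable_obsX mG model_good measurable_obsY bY EY.
have [GA [mGA PGA EGA]] := is_cond_exp_unique measurable_obsX cA Hp.
have [GY [mGY PGY EGY]] := is_cond_exp_unique measurable_obsX cY Hq.
set p' := cond_exp P _ _ in cA EGA; set q' := cond_exp P _ _ in cY EGY.
pose V (z : obs) := (obsA z - p' (obsX z)) * (obsY z - q' (obsX z)).
pose V' (z : obs) := (cutA C1 C2 z - cut p (obsX z)) * (cutY C1 C2 z - cut q (obsX z)).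
have bpX := bounded_obsX bp; have bqX := bounded_obsX bq.
have bV' : bounded_mfun V' by rewrite /V'; bounded_tac.
have mV : measurable_fun setT V.
  have [mp' _ _] := cA; have [mq' _ _] := cY.
  apply: measurable_funM; apply: measurable_funB.
  - exact: measurable_obsA.
  - exact: measurableT_comp mp' measurable_obsX.
  - exact: measurable_obsY.
  - exact: measurableT_comp mq' measurable_obsX.
have mG' := measurableI _ _ mG (measurableI _ _ mGA mGY).
have PG' := probability_setI1 mG (measurableI _ _ mGA mGY) model_good
  (probability_setI1 mGA mGY PGA PGY).
have VV' z : (good C1 C2 `&` (GA `&` GY)) z -> V z = V' z.
  move=> [gz [GAz GYz]]; rewrite /V /V' EGA// EGY// cutAE// cutYE//.
  by rewrite pX// qX.
have [_ _ /(_ setT measurableT)] := cond_expP measurable_obsX mG' PG' mV bV' VV'.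
rewrite preimage_setT (integral_good mG' PG' measurableT mV (bounded_mfunW bV') VV').
rewrite -(EFin_mean P bV') => intV.
rewrite /psi /Rintegral (_ : (\int[P]_z _)%E = (mean P V')%:E) /=; last by rewrite intV.
rewrite (@eq_mean _ _ _ _ _ (fun z => cutA C1 C2 z * cutY C1 C2 z
  - cutA C1 C2 z * cut q (obsX z) - cutY C1 C2 z * cut p (obsX z)
  + cut p (obsX z) * cut q (obsX z))); last by move=> z; rewrite /V'; ring.
rewrite !(meanB, meanD); try by bounded_tac.
rewrite regA// regY// (@mean_obsX (fun x => cut p x * cut q x)); last by bounded_tac.
rewrite [X in _ - X + _](@eq_mean _ _ _ _ _ (fun x => cut p x * cut q x)).
  by rewrite subrK.
by move=> x; rewrite mulrC.
Qed.

End law.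
End model.

(** * The estimator as a polynomial in sample sums *)

Section estimator.
Context (R : realType) (d S J0 : nat) (W : cdv_basis R d S J0) (C1 C2 : R).

Local Notation obs := (d.-tuple R * R * R)%type.
Local Notation cutA := (@cutA R d C1 C2).
Local Notation cutY := (@cutY R d C1 C2).

Definition AY (z : obs) := cutA z * cutY z.
Definition Aphi j (m : Z W j) (z : obs) := cutA z * phi m (obsX z).
Definition Yphi j (m : Z W j) (z : obs) := cutY z * phi m (obsX z).

(** Expanding the projection kernel in the basis turns the estimator into a
    polynomial in sample sums of bounded functions of one observation. *)
Definition psi_cut j n (t : n.-tuple obs) : R :=
  n%:R^-1 * Sum AY t
  - n%:R^-1 ^+ 2 * \sum_m Sum (@Aphi j m) t * Sum (@Yphi j m) t.

Lemma bounded_AY : bounded_mfun AY.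
Proof. by apply: bounded_mfunM; [exact: bounded_cutA|exact: bounded_cutY]. Qed.

Lemma bounded_Aphi j (m : Z W j) : (J0 <= j)%N -> bounded_mfun (Aphi m).
Proof.
move=> jJ; apply: bounded_mfunM; first exact: bounded_cutA.
by apply: bounded_obsX; exact: bounded_phi.
Qed.

Lemma bounded_Yphi j (m : Z W j) : (J0 <= j)%N -> bounded_mfun (Yphi m).
Proof.
move=> jJ; apply: bounded_mfunM; first exact: bounded_cutY.
by apply: bounded_obsX; exact: bounded_phi.
Qed.

Lemma bounded_psi_cut j n : (J0 <= j)%N -> bounded_mfun (@psi_cut j n).
Proof.
move=> jJ; have bAY := bounded_AY.
have bA m := @bounded_Aphi j m jJ; have bY m := @bounded_Yphi j m jJ.
apply: bounded_mfunB; apply: bounded_mfunM; try exact: bounded_mfun_cst.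
  exact: bounded_mfun_Sum.
by apply: bounded_mfun_sum => m; apply: bounded_mfunM; exact: bounded_mfun_Sum.
Qed.

Lemma psi_NR_good j n (t : n.-tuple obs) : (forall i, good C1 C2 (tnth t i)) ->
  psi_NR W j t = psi_cut j t.
Proof.
move=> Gt; rewrite /psi_NR /psi_cut /bhat /proj_kernel.
rewrite (_ : \sum_(m : Z W j) Sum (Aphi m) t * Sum (Yphi m) t = \sum_(i < n) obsA (tnth t i) * \sum_(i' < n)
    obsY (tnth t i') * \sum_(m : Z W j) Phi m (obsX (tnth t i')) * Phi m (obsX (tnth t i))).
  rewrite [X in _ * X = _](eq_bigr (fun i => AY (tnth t i) - n%:R^-1 *
    (obsA (tnth t i) * \sum_(i' < n) obsY (tnth t i') *
     \sum_(m : Z W j) Phi m (obsX (tnth t i')) * Phi m (obsX (tnth t i))))).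
    by rewrite sumrB -mulr_sumr /Sum; ring.
  by move=> i _; rewrite /AY cutAE// cutYE//; ring.
under eq_bigr => m _ do rewrite /Sum mulr_suml.
rewrite exchange_big /=; apply: eq_bigr => i _.
under eq_bigr => m _ do rewrite mulr_sumr.
rewrite exchange_big /= mulr_sumr; apply: eq_bigr => i' _.
rewrite !mulr_sumr; apply: eq_bigr => m _.
rewrite /Aphi /Yphi cutAE// cutYE// /phi !cutE; [ring|by case: (Gt i')|by case: (Gt i)].
Qed.

Lemma measurable_psi_NR j n : (J0 <= j)%N ->
  measurable_fun setT (@psi_NR R d S J0 W j n).
Proof.
move=> jJ.
have mX i : measurable_fun setT (fun t : n.-tuple obs => obsX (tnth t i)).
  by apply: measurableT_comp; [exact: measurable_obsX|exact: measurable_tnth].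
have mA i : measurable_fun setT (fun t : n.-tuple obs => obsA (tnth t i)).
  by apply: measurableT_comp; [exact: measurable_obsA|exact: measurable_tnth].
have mY i : measurable_fun setT (fun t : n.-tuple obs => obsY (tnth t i)).
  by apply: measurableT_comp; [exact: measurable_obsY|exact: measurable_tnth].
have mPhi (m : Z W j) i : measurable_fun setT (fun t : n.-tuple obs => Phi m (obsX (tnth t i))).
  by apply: measurableT_comp (mX i); exact: measurable_Phi.
apply: measurable_funM => //; apply: measurable_sum => i.
apply: measurable_funM => //; apply: measurable_funB => //.
apply: measurable_funM => //; apply: measurable_sum => i'.
apply: measurable_funM => //; apply: measurable_sum => m.
exact: measurable_funM.
Qed.

Section risk.
Variables (P : probability obs R) (a b M : R).
Hypothesis PM : model W a b M C1 C2 P.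

Lemma risk_mean j n : (J0 <= j)%N ->
  ('E_(iid_law P n)[fun D1 => ((psi_NR W j D1 - psi P) ^+ 2)%R]
   = (mean (iid_law P n) (fun t => (psi_cut j t - psi P) ^+ 2))%:E)%E.
Proof.
move=> jJ; have bc := @bounded_psi_cut j n jJ.
have bc2 : bounded_mfun (fun t : n.-tuple obs => (psi_cut j t - psi P) ^+ 2).
  by apply: bounded_mfunX; apply: bounded_mfunB => //; exact: bounded_mfun_cst.
rewrite unlock EFin_mean//.
apply: (@integral_good _ _ _ _ [set t | forall i, good C1 C2 (tnth t i)]) => //.
- by apply: measurable_iid_all; exact: measurable_good.
- by apply: iid_law_all; [exact: measurable_good|exact: model_good PM].
- apply: measurable_funX; apply: measurable_funB => //.
  exact: measurable_psi_NR.
- exact: bounded_mfunW.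
- by move=> t Gt; rewrite psi_NR_good.
Qed.

End risk.
End estimator.

(** * Risk upper bound *)

Section upper.
Context (R : realType) (d S J0 : nat) (W : cdv_basis R d S J0).

Local Notation obs := (d.-tuple R * R * R)%type.
Local Notation U := (@unif_cube R d).

Lemma Sum_subr_cst d0 (T : measurableType d0) n (f : T -> R) (c : R) (t : n.-tuple T) :
  Sum (fun z => f z - c) t = Sum f t - n%:R * c.
Proof. by rewrite /Sum sumrB sumr_const card_ord mulr_natl. Qed.

Lemma kernel_diag_le : exists2 C, 0 < C & forall j x, (J0 <= j)%N ->
  \sum_(m : Z W j) phi m x ^+ 2 <= C * dim R d j.
Proof.
have [C [N [C0 H]]] := cut_localized (localized_Phi W).
exists (N%:R * C + 1); first by rewrite ltr_wpDl// mulr_ge0// ltW.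
move=> j x jJ; have [HC HN] := H j jJ.
apply: le_trans (@sum_sparse_le _ _ _ N (C * dim R d j) _ _ _) _.
- by rewrite mulr_ge0// ltW// dim_gt0.
- by move=> m; exact: HC.
- by apply: leq_trans (HN x); apply: eq_leq; apply: eq_card => m; rewrite !inE sqrf_eq0.
- by rewrite mulrA ler_wpM2r ?lerDl// ltW// dim_gt0.
Qed.

Lemma dim_ge1 j : 1 <= dim R d j.
Proof. by rewrite /dim exprn_ege1// ler1n. Qed.

Lemma sqr_add3_le (x y z : R) :
  (x + y + z) ^+ 2 <= 3 * (x ^+ 2 + y ^+ 2 + z ^+ 2).
Proof.
rewrite -subr_ge0 (_ : _ - _ = (x - y) ^+ 2 + (y - z) ^+ 2 + (x - z) ^+ 2); last by ring.
by rewrite !addr_ge0 ?sqr_ge0.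
Qed.

Section fixed_law.
Variables (C1 C2 : R) (P : probability obs R) (p q : d.-tuple R -> R) (j n : nat).
Hypotheses (jJ : (J0 <= j)%N) (n0 : (0 < n)%N).
Hypotheses (bp : bounded_mfun (cut p)) (bq : bounded_mfun (cut q)).
Hypothesis PX : forall g, bounded_mfun g -> mean P (fun z => g (obsX z)) = mean U g.
Hypothesis regA : forall g, bounded_mfun g ->
  mean P (fun z => cutA C1 C2 z * g (obsX z)) = mean U (fun x => cut p x * g x).
Hypothesis regY : forall g, bounded_mfun g ->
  mean P (fun z => cutY C1 C2 z * g (obsX z)) = mean U (fun x => cut q x * g x).

Local Notation cutA := (@cutA R d C1 C2).
Local Notation cutY := (@cutY R d C1 C2).
Local Notation B := (range_bound C1 C2).

Let bphi (m : Z W j) : bounded_mfun (phi m) := bounded_phi m jJ.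
Let bA : bounded_mfun cutA := @bounded_cutA R d C1 C2.
Let bY : bounded_mfun cutY := @bounded_cutY R d C1 C2.
Let bAm (m : Z W j) := bounded_Aphi C1 C2 m jJ.
Let bYm (m : Z W j) := bounded_Yphi C1 C2 m jJ.
Let bAY : bounded_mfun _ := bounded_AY d C1 C2.
Let ortho (m m' : Z W j) := ortho_phi m m' jJ.

Definition coefA (m : Z W j) := coef U (@phi _ _ _ _ W j) (cut p) m.
Definition coefY (m : Z W j) := coef U (@phi _ _ _ _ W j) (cut q) m.

Lemma mean_Aphi m : mean P (Aphi C1 C2 m) = coefA m.
Proof. by rewrite /Aphi regA. Qed.

Lemma mean_Yphi m : mean P (Yphi C1 C2 m) = coefY m.
Proof. by rewrite /Yphi regY. Qed.

(** Conditional means inherit the bound on the response in mean square, since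
    testing the regression function against itself is Cauchy-Schwarz. *)
Lemma mean_sqr_regression (V : obs -> R) (f : d.-tuple R -> R) :
  bounded_mfun V -> (forall z, `|V z| <= B) -> bounded_mfun f ->
  (forall g, bounded_mfun g ->
    mean P (fun z => V z * g (obsX z)) = mean U (fun x => f x * g x)) ->
  mean U (fun x => f x ^+ 2) <= B ^+ 2.
Proof.
move=> bV VB bf reg; have bfX := bounded_obsX bf.
have := mean_Cauchy_Schwarz P bV bfX; rewrite reg//.
rewrite [X in _ <= _ * X -> _](@PX (fun x => f x ^+ 2)); last exact: bounded_mfunX.
set e := mean U _; rewrite -/e => H.
have e0 : 0 <= e by apply: mean_ge0 => x; exact: sqr_ge0.
have V2 : mean P (fun z => V z ^+ 2) <= B ^+ 2.
  rewrite -(mean_cst P (B ^+ 2)); apply: le_mean; [by bounded_tac..|] => z.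
  by rewrite -(real_normK (num_real (V z))) lerXn2r// nnegrE// (le_trans _ (VB z)).
have [->|en0] := eqVneq e 0; first exact: sqr_ge0.
have : e ^+ 2 <= B ^+ 2 * e by apply: le_trans H _; rewrite ler_wpM2r.
by rewrite expr2 ler_pM2r// lt_def en0.
Qed.

Lemma sum_coefA_le : \sum_m coefA m ^+ 2 <= B ^+ 2.
Proof.
apply: le_trans (Bessel bphi ortho bp) _.
exact: (@mean_sqr_regression cutA) (@cutA_le _ _ _ _) bp regA.
Qed.

Lemma sum_coefY_le : \sum_m coefY m ^+ 2 <= B ^+ 2.
Proof.
apply: le_trans (Bessel bphi ortho bq) _.
exact: (@mean_sqr_regression cutY) (@cutY_le _ _ _ _) bq regY.
Qed.

(** The first-order term of the estimator in each single observation. *)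
Definition linear_part (z : obs) := AY C1 C2 z
  - \sum_(m : Z W j) coefY m * Aphi C1 C2 m z - \sum_(m : Z W j) coefA m * Yphi C1 C2 m z.

Let bL : bounded_mfun linear_part.
Proof.
apply: bounded_mfunB; first apply: bounded_mfunB => //;
  by apply: bounded_mfun_sum => m; apply: bounded_mfunM => //; exact: bounded_mfun_cst.
Qed.

Let cov := mean U (fun x => cut p x * cut q x).
Let bias := cov - \sum_(m : Z W j) coefA m * coefY m.

(** Centring both factors of the bilinear term of the estimator leaves a centred
    sample mean, the truncation bias and a remainder that is quadratic in
    centred sums. *)
Lemma error_decomposition (t : n.-tuple obs) :
  psi_cut W C1 C2 j t - (mean P (AY C1 C2) - cov)
  = n%:R^-1 * Sum (fun z => linear_part z - mean P linear_part) t
    + bias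
    + - (n%:R^-1 ^+ 2 * \sum_(m : Z W j) Sum (fun z => Aphi C1 C2 m z - coefA m) t
                 * Sum (fun z => Yphi C1 C2 m z - coefY m) t).
Proof.
rewrite Sum_subr_cst /bias.
have -> : mean P linear_part = mean P (AY C1 C2) - 2 * \sum_(m : Z W j) coefA m * coefY m.
  have bAm' m : bounded_mfun (fun z => coefY m * Aphi C1 C2 m z).
    by apply: bounded_mfunM => //; exact: bounded_mfun_cst.
  have bYm' m : bounded_mfun (fun z => coefA m * Yphi C1 C2 m z).
    by apply: bounded_mfunM => //; exact: bounded_mfun_cst.
  have bS1 := bounded_mfun_sum (index_enum (Z W j)) bAm'.
  have bS2 := bounded_mfun_sum (index_enum (Z W j)) bYm'.
  rewrite /linear_part meanB ?meanB ?mean_sum//; last exact: bounded_mfunB.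
  rewrite -addrA -opprD -big_split mulr_sumr /=; congr (_ - _).
  by apply: eq_bigr => m _; rewrite !meanZl// mean_Aphi mean_Yphi; ring.
have -> : Sum linear_part t = Sum (AY C1 C2) t
    - \sum_(m : Z W j) coefY m * Sum (Aphi C1 C2 m) t - \sum_(m : Z W j) coefA m * Sum (Yphi C1 C2 m) t.
  rewrite /Sum /linear_part !sumrB.
  rewrite [X in _ - X - _]exchange_big [X in _ - X]exchange_big /=.
  by congr (_ - _ - _); apply: eq_bigr => m _; rewrite mulr_sumr.
have -> : \sum_(m : Z W j) Sum (fun z => Aphi C1 C2 m z - coefA m) t
      * Sum (fun z => Yphi C1 C2 m z - coefY m) t
    = \sum_(m : Z W j) Sum (Aphi C1 C2 m) t * Sum (Yphi C1 C2 m) t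
      - n%:R * \sum_(m : Z W j) coefY m * Sum (Aphi C1 C2 m) t
      - n%:R * \sum_(m : Z W j) coefA m * Sum (Yphi C1 C2 m) t
      + n%:R ^+ 2 * \sum_(m : Z W j) coefA m * coefY m.
  rewrite !mulr_sumr -!sumrN -!big_split /=; apply: eq_bigr => m _.
  by rewrite !Sum_subr_cst; ring.
have nn0 : n%:R != 0 :> R by rewrite pnatr_eq0 -lt0n.
by rewrite /psi_cut; field.
Qed.

Lemma mean_sqr_linear :
  mean (iid_law P n) (fun t => (n%:R^-1 *
    Sum (fun z => linear_part z - mean P linear_part) t) ^+ 2)
  <= 9 * B ^+ 4 * n%:R^-1.
Proof.
set h := fun z => linear_part z - mean P linear_part.
have bh : bounded_mfun h by rewrite /h; bounded_tac.
have h0 : mean P h = 0 by rewrite /h meanB ?mean_cst ?subrr//; bounded_tac.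
have nn0 : n%:R != 0 :> R by rewrite pnatr_eq0 -lt0n.
have bS := @bounded_mfun_Sum _ _ _ n h bh.
rewrite (@eq_mean _ _ _ _ _ (fun t => n%:R^-1 ^+ 2 * (Sum h t * Sum h t))); last first.
  by move=> t; rewrite exprMn -expr2.
rewrite meanZl ?mean_Sum2//; last by bounded_tac.
rewrite h0 !mulr0 addr0 mulrA (_ : n%:R^-1 ^+ 2 * n%:R = n%:R^-1); last by field.
rewrite mulrC ler_wpM2r ?invr_ge0//.
apply: (le_trans (mean_centered_sqr_le P bL)).
pose Piq x := \sum_m coefY m * phi m x.
pose Pip x := \sum_m coefA m * phi m x.
have bPiq : bounded_mfun Piq by rewrite /Piq; bounded_tac.
have bPip : bounded_mfun Pip by rewrite /Pip; bounded_tac.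
have bPiqX := bounded_obsX bPiq; have bPipX := bounded_obsX bPip.
have absB V : `|V| <= B -> V ^+ 2 <= B ^+ 2.
  by move=> VB; rewrite -(real_normK (num_real V)) lerXn2r// nnegrE// (le_trans _ VB).
apply: (@le_trans _ _ (mean P (fun z => 3 * (B ^+ 4
    + B ^+ 2 * Piq (obsX z) ^+ 2 + B ^+ 2 * Pip (obsX z) ^+ 2)))).
  apply: le_mean; [by bounded_tac..|] => z.
  rewrite (_ : linear_part z = AY C1 C2 z + - (cutA z * Piq (obsX z))
      + - (cutY z * Pip (obsX z))); last first.
    rewrite /linear_part /Piq /Pip !mulr_sumr.
    by congr (_ - _ - _); apply: eq_bigr => m _; rewrite /Aphi /Yphi mulrCA.
  apply: le_trans (sqr_add3_le _ _ _) _; rewrite ler_pM2l// !sqrrN.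
  have sqrM (x y : R) : (x * y) ^+ 2 = x ^+ 2 * y ^+ 2 by exact: exprMn.
  rewrite /AY (sqrM (cutA z) (cutY z)) (sqrM (cutA z) (Piq _)) (sqrM (cutY z) (Pip _)).
  have A2 := absB _ (@cutA_le _ _ C1 C2 z); have Y2 := absB _ (@cutY_le _ _ C1 C2 z).
  rewrite !lerD//; try by rewrite ler_wpM2r// sqr_ge0.
  by rewrite (exprD B 2 2); apply: ler_pM; rewrite ?sqr_ge0.
rewrite meanZl ?meanD ?meanZl ?mean_cst; try by bounded_tac.
rewrite (@PX (fun x => Piq x ^+ 2)) ?(@PX (fun x => Pip x ^+ 2)); try by bounded_tac.
rewrite /Piq /Pip !(mean_sqr_expansion bphi ortho).
have := sum_coefA_le; have := sum_coefY_le; set u := \sum_m _; set v := \sum_m _ => hu hv.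
have B2 : 0 <= B ^+ 2 by exact: sqr_ge0.
have : B ^+ 2 * u <= B ^+ 2 * B ^+ 2 by rewrite ler_wpM2l.
have : B ^+ 2 * v <= B ^+ 2 * B ^+ 2 by rewrite ler_wpM2l.
by rewrite (exprD B 2 2); lra.
Qed.

(** By Cauchy-Schwarz the remainder is at most a product of norms of centred
    vector sums, and the vectors of basis values have squared norm at most of
    the order of the dimension. *)
Lemma mean_sqr_remainder C : 0 < C ->
  (forall x, \sum_(m : Z W j) phi m x ^+ 2 <= C * dim R d j) ->
  mean (iid_law P n) (fun t => (- (n%:R^-1 ^+ 2 *
    \sum_(m : Z W j) Sum (fun z => Aphi C1 C2 m z - coefA m) t
         * Sum (fun z => Yphi C1 C2 m z - coefY m) t)) ^+ 2)
  <= 16 * B ^+ 4 * (C + 1) ^+ 2 * (dim R d j / n%:R) ^+ 2.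
Proof.
move=> C0 HC; have nn0 : n%:R != 0 :> R by rewrite pnatr_eq0 -lt0n.
pose xi (V : Z W j -> obs -> R) (c : Z W j -> R) m z := V m z - c m.
(* [(a - c) ^ 2 <= 2 a ^ 2 + 2 c ^ 2] for the centred entries, and [dim >= 1] *)
set K := 2 * B ^+ 2 * (C + 1) * dim R d j.
have fourth (V : obs -> R) (c : Z W j -> R) : bounded_mfun V ->
    (forall z, `|V z| <= B) -> \sum_m c m ^+ 2 <= B ^+ 2 ->
    (forall m, mean P (fun z => V z * phi m (obsX z)) = c m) ->
    bounded_mfun (fun t : n.-tuple obs =>
      \sum_(m : Z W j) Sum (fun z => V z * phi m (obsX z) - c m) t ^+ 2) /\
    mean (iid_law P n) (fun t => (\sum_(m : Z W j)
      Sum (fun z => V z * phi m (obsX z) - c m) t ^+ 2) ^+ 2)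
    <= 4 * n%:R ^+ 2 * K ^+ 2.
  move=> bV VB cB mV.
  have bphiX m := bounded_obsX (bphi m).
  have bVm m : bounded_mfun (fun z => V z * phi m (obsX z) - c m).
    by have := bphiX m => ?; bounded_tac.
  split.
    by apply: bounded_mfun_sum => m; apply: bounded_mfunX; exact: bounded_mfun_Sum.
  apply: mean_norm4_Sum => //.
    move=> m; have := bphiX m => ?.
    by rewrite meanB ?mean_cst ?mV ?subrr//; bounded_tac.
  move=> z; apply: (@le_trans _ _ (\sum_m (2 * (B ^+ 2 * phi m (obsX z) ^+ 2)
      + 2 * c m ^+ 2))).
    apply: ler_sum => m _.
    have V2 : V z ^+ 2 <= B ^+ 2.
      by rewrite -(real_normK (num_real (V z))) lerXn2r// nnegrE// (le_trans _ (VB z)).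
    have : V z ^+ 2 * phi m (obsX z) ^+ 2 <= B ^+ 2 * phi m (obsX z) ^+ 2.
      by rewrite ler_wpM2r// sqr_ge0.
    rewrite -exprMn; have := sqr_ge0 (V z * phi m (obsX z) + c m).
    by rewrite sqrrB sqrrD; lra.
  rewrite big_split -!mulr_sumr /= /K.
  have h1 := HC (obsX z); have h2 := dim_ge1 j.
  have B2 : 0 <= B ^+ 2 by exact: sqr_ge0.
  have := ler_wpM2l B2 h1.
  have := ler_wpM2l B2 h2.
  rewrite (_ : 2 * B ^+ 2 * (C + 1) * dim R d j = 2 * (B ^+ 2 * (C * dim R d j))
    + 2 * (B ^+ 2 * dim R d j)); last by ring.
  by rewrite mulr1; lra.
have [bA4 mA4] := fourth cutA coefA bA (@cutA_le _ _ C1 C2) sum_coefA_le mean_Aphi.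
have [bY4 mY4] := fourth cutY coefY bY (@cutY_le _ _ C1 C2) sum_coefY_le mean_Yphi.
pose NA (t : n.-tuple obs) := \sum_(m : Z W j) Sum (fun z => Aphi C1 C2 m z - coefA m) t ^+ 2.
pose NY (t : n.-tuple obs) := \sum_(m : Z W j) Sum (fun z => Yphi C1 C2 m z - coefY m) t ^+ 2.
have bNA : bounded_mfun NA by exact: bA4.
have bNY : bounded_mfun NY by exact: bY4.
apply: (@le_trans _ _ (mean (iid_law P n)
    (fun t => n%:R^-1 ^+ 4 * (2^-1 * (NA t ^+ 2 + NY t ^+ 2))))).
  apply: le_mean; last 2 first.
  - by bounded_tac.
  - move=> t; rewrite sqrrN exprMn -exprM ler_wpM2l ?exprn_ge0 ?invr_ge0//.
    apply: le_trans (sum_Cauchy_Schwarz _ _) _; rewrite -/(NA t) -/(NY t).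
    have := sqr_ge0 (NA t - NY t); rewrite sqrrB; lra.
  apply: bounded_mfunX; apply: bounded_mfunN; apply: bounded_mfunM.
    exact: bounded_mfun_cst.
  apply: bounded_mfun_sum => m; apply: bounded_mfunM; apply: bounded_mfun_Sum.
    by apply: bounded_mfunB => //; exact: bounded_mfun_cst.
  by apply: bounded_mfunB => //; exact: bounded_mfun_cst.
rewrite !meanZl ?meanD; try by bounded_tac.
apply: (@le_trans _ _ (n%:R^-1 ^+ 4 * (4 * n%:R ^+ 2 * K ^+ 2))).
  rewrite ler_wpM2l ?exprn_ge0 ?invr_ge0//; move: mA4 mY4.
  rewrite -[mean _ (fun t => NA t ^+ 2)]/(mean _ _) /NA /NY /Aphi /Yphi; lra.
by rewrite /K le_eqVlt; apply/orP; left; apply/eqP; field.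
Qed.

Lemma mean_sqr_error C : 0 < C ->
  (forall x, \sum_(m : Z W j) phi m x ^+ 2 <= C * dim R d j) ->
  mean (iid_law P n)
    (fun t => (psi_cut W C1 C2 j t - (mean P (AY C1 C2) - cov)) ^+ 2)
  <= 3 * (9 * B ^+ 4 * n%:R^-1
          + tail_energy W j (cut p) * tail_energy W j (cut q)
          + 16 * B ^+ 4 * (C + 1) ^+ 2 * (dim R d j / n%:R) ^+ 2).
Proof.
move=> C0 HC.
pose X (t : n.-tuple obs) := n%:R^-1 *
    Sum (fun z => linear_part z - mean P linear_part) t.
pose Q (t : n.-tuple obs) := - (n%:R^-1 ^+ 2 *
    \sum_(m : Z W j) Sum (fun z => Aphi C1 C2 m z - coefA m) t
         * Sum (fun z => Yphi C1 C2 m z - coefY m) t).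
have bX : bounded_mfun X.
  apply: bounded_mfunM; first exact: bounded_mfun_cst.
  by apply: bounded_mfun_Sum; bounded_tac.
have bQ : bounded_mfun Q.
  apply: bounded_mfunN; apply: bounded_mfunM; first exact: bounded_mfun_cst.
  apply: bounded_mfun_sum => m; apply: bounded_mfunM; apply: bounded_mfun_Sum.
    by apply: bounded_mfunB => //; exact: bounded_mfun_cst.
  by apply: bounded_mfunB => //; exact: bounded_mfun_cst.
rewrite (@eq_mean _ _ _ _ _ (fun t => (X t + bias + Q t) ^+ 2)); last first.
  by move=> t; rewrite error_decomposition.
apply: (@le_trans _ _ (mean (iid_law P n)
    (fun t => 3 * (X t ^+ 2 + bias ^+ 2 + Q t ^+ 2)))).
  by apply: le_mean; [by bounded_tac..|] => t; exact: sqr_add3_le.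
rewrite meanZl; last by bounded_tac.
rewrite ler_pM2l// !meanD ?mean_cst; try by bounded_tac.
rewrite !lerD//; [exact: mean_sqr_linear| |exact: mean_sqr_remainder].
exact: (truncation_bias bphi ortho bp bq).
Qed.

End fixed_law.
End upper.

Section risk_upper.
Context (R : realType) (d S J0 : nat) (W : cdv_basis R d S J0).
Variables (alpha beta M C1 C2 : R).
Hypotheses (alpha_gt0 : 0 < alpha) (beta_gt0 : 0 < beta).

(** The summands are the orders of the variance, of the squared truncation bias
    and of the squared contribution of the diagonal terms; the last one is also
    the order of the quadratic remainder. *)
Definition risk_order j n : R := n%:R^-1
  + ((decay alpha * decay beta) ^+ j) ^+ 2 + (dim R d j / n%:R) ^+ 2.

Lemma risk_upper : exists2 C, 0 < C & forall (j : nat -> nat) n,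
  (J0 <= j n)%N -> (0 < n)%N ->
  (max_risk W alpha beta M C1 C2 j n <= (C * risk_order (j n) n)%:E)%E.
Proof.
have [Cp Cp0 HCp] := holder_tail W M alpha_gt0.
have [Cq Cq0 HCq] := holder_tail W M beta_gt0.
have [CK CK0 HCK] := kernel_diag_le W.
set B := range_bound C1 C2.
have B4 : 0 <= B ^+ 4 by rewrite (exprM _ 2 2) sqr_ge0.
pose K1 := 9 * B ^+ 4; pose K2 := Cp * Cq; pose K3 := 16 * B ^+ 4 * (CK + 1) ^+ 2.
have K10 : 0 <= K1 by rewrite mulr_ge0.
have K20 : 0 <= K2 by rewrite mulr_ge0// ltW.
have K30 : 0 <= K3 by rewrite mulr_ge0 ?sqr_ge0// mulr_ge0.
exists (3 * (K1 + K2 + K3) + 1).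
  by rewrite ltr_wpDl// mulr_ge0// !addr_ge0.
move=> j n jJ n0; apply: ge_ereal_sup => _ [P PM <-].
rewrite (risk_mean PM)// lee_fin.
have [p [q [[mp [Bp HBp] Hp] [mq [Bq HBq] Hq] regA regY ->]]] := model_regression PM.
have bp := bounded_cut mp HBp; have bq := bounded_cut mq HBq.
apply: le_trans (mean_sqr_error jJ n0 bp bq (mean_obsX PM) regA regY CK0 (fun x => HCK (j n) x jJ)) _.
rewrite -/B -/K1 -/K3.
have tp := HCp _ _ _ jJ mp HBp Hp; have tq := HCq _ _ _ jJ mq HBq Hq.
have tp0 : 0 <= tail_energy W (j n) (cut p).
  rewrite subr_ge0; apply: (Bessel _ _ bp); first by move=> m; exact: bounded_phi.
  by move=> m m'; exact: ortho_phi.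
have tq0 : 0 <= tail_energy W (j n) (cut q).
  rewrite subr_ge0; apply: (Bessel _ _ bq); first by move=> m; exact: bounded_phi.
  by move=> m m'; exact: ortho_phi.
have := ler_pM tp0 tq0 tp tq.
rewrite /risk_order; set x := n%:R^-1; set z := (dim R d (j n) * x) ^+ 2.
rewrite (exprMn (j n)) (exprMn 2 (decay alpha ^+ j n)).
rewrite (_ : _ * _ * (_ * _) = K2 * ((decay alpha ^+ j n) ^+ 2 * (decay beta ^+ j n) ^+ 2));
  last by rewrite /K2; ring.
set y := _ ^+ 2 * _ ^+ 2 => H.
have x0 : 0 <= x by rewrite invr_ge0.
have y0 : 0 <= y by rewrite mulr_ge0// sqr_ge0.
have z0 : 0 <= z by exact: sqr_ge0.
have := mulr_ge0 K10 y0; have := mulr_ge0 K10 z0; have := mulr_ge0 K20 x0.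
have := mulr_ge0 K20 z0; have := mulr_ge0 K30 x0; have := mulr_ge0 K30 y0.
by lra.
Qed.

End risk_upper.

(** * Two-point mixtures and a parametric submodel *)

Section mixture.
Context d (T : measurableType d) (R : realType) (P Q : probability T R).

Definition half : {nonneg R} := NngNum (ltW (ltac:(by rewrite invr_gt0) : 0 < (2 : R)^-1)).

Definition mixture : set T -> \bar R := measure_add (mscale half P) (mscale half Q).

HB.instance Definition _ := Measure.on mixture.

Lemma mixtureE A : mixture A = (2^-1%:E * P A + 2^-1%:E * Q A)%E.
Proof. by rewrite /mixture measure_addE. Qed.

Let mixture_setT : mixture setT = 1%E.
Proof.
rewrite mixtureE !probability_setT !mule1 -EFinD; congr (_%:E); lra.
Qed.

HB.instance Definition _ :=
  Measure_isProbability.Build _ _ _ mixture mixture_setT.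

Lemma mean_mixture f : bounded_mfun f ->
  mean mixture f = 2^-1 * (mean P f + mean Q f).
Proof.
move=> bf; have [mf [M Mf]] := bf.
have fM0 x : 0 <= f x + M.
  by rewrite -lerBlDr sub0r; have := Mf x; rewrite ler_norml => /andP[].
have bg : bounded_mfun (fun x => f x + M) by bounded_tac.
have fE (P' : probability T R) : mean P' f = mean P' (fun x => f x + M) - M.
  by rewrite meanD ?mean_cst ?addrK//; bounded_tac.
rewrite !fE; suff -> : mean mixture (fun x => f x + M)
    = 2^-1 * (mean P (fun x => f x + M) + mean Q (fun x => f x + M)) by lra.
have mg : measurable_fun setT (fun x => (f x + M)%:E).
  by apply/measurable_EFinP; case: bg.
have g0 x : setT x -> (0 <= (f x + M)%:E)%E by move=> _; rewrite lee_fin.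
apply: EFin_inj; rewrite mulrDr EFinD !EFinM !EFin_mean//.
rewrite ge0_integral_measure_add//.
by rewrite !ge0_integral_mscale.
Qed.

End mixture.

Section submodel.
Context (R : realType) (d S J0 : nat) (W : cdv_basis R d S J0).

Local Notation obs := (d.-tuple R * R * R)%type.
Local Notation U := (@unif_cube R d).

Variables (C1 C2 eta : R) (p q : d.-tuple R -> R).
Hypotheses (eta0 : 0 < eta) (mp : measurable_fun setT p) (mq : measurable_fun setT q).
Hypotheses (p_range : forall x, C1 + eta <= p x <= C2 - eta)
  (q_range : forall x, C1 + eta <= q x <= C2 - eta).

Local Notation cutA := (@cutA R d C1 C2).
Local Notation cutY := (@cutY R d C1 C2).

Definition point (u v : R) (x : d.-tuple R) : obs := (x, p x + u, q x + v).

Lemma measurable_point u v : measurable_fun setT (point u v).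
Proof.
apply/measurable_fun_pairP; split => /=.
  apply/measurable_fun_pairP; split => /=; first exact: measurable_id.
  exact: measurable_funD.
exact: measurable_funD.
Qed.

Definition point_mfun u v : {mfun d.-tuple R >-> obs} :=
  HB.pack (point u v) (isMeasurableFun.Build _ _ _ _ _ (measurable_point u v)).

Definition point_law u v : probability obs R := distribution U (point_mfun u v).

Lemma good_point u v x : `|u| <= eta -> `|v| <= eta -> cube x ->
  good C1 C2 (point u v x).
Proof.
rewrite !ler_norml => /andP[u1 u2] /andP[v1 v2] cx; split => //=.
have /andP[p1 p2] := p_range x; have /andP[q1 q2] := q_range x.
by split; apply/andP; split; rewrite /obsA /obsY /=; lra.
Qed.

Lemma bound_range x : `|p x| <= range_bound C1 C2 /\ `|q x| <= range_bound C1 C2.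
Proof.
have := ltW eta0; have /andP[p1 p2] := p_range x; have /andP[q1 q2] := q_range x.
by move=> *; split; apply: norm_le_range_bound; apply/andP; split; lra.
Qed.

Lemma bounded_p : bounded_mfun (cut p).
Proof. by apply: (@bounded_cut _ _ _ (range_bound C1 C2)) => // x _; case: (bound_range x). Qed.

Lemma bounded_q : bounded_mfun (cut q).
Proof. by apply: (@bounded_cut _ _ _ (range_bound C1 C2)) => // x _; case: (bound_range x). Qed.

Lemma mean_point_law u v f f' : bounded_mfun f -> bounded_mfun f' ->
  (forall x, cube x -> f (point u v x) = f' x) ->
  mean (point_law u v) f = mean U f'.
Proof.
move=> bf bf' ff'.
rewrite (@mean_pushforward _ _ _ _ _ U _ (point u v))//; last exact: measurable_point.
apply: (@ae_eq_mean _ _ _ U _ _ cube) => //.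
- by apply: bounded_mfun_comp => //; exact: measurable_point.
- exact: measurable_cube.
- exact: unif_cube_cube.
Qed.

(** First and mixed second conditional moments given the covariate: the
    conditional means are shifted by [u] and [v] from [p] and [q], and the
    mixed moment carries the extra constant [r]. *)
Definition moments u v r (P : probability obs R) :=
  [/\ forall B, measurable B -> P (@obsX R d @^-1` B) = U B,
      P (good C1 C2) = 1%E,
      forall g, bounded_mfun g -> mean P (fun z => cutA z * g (obsX z))
        = mean U (fun x => (cut p x + u) * g x),
      forall g, bounded_mfun g -> mean P (fun z => cutY z * g (obsX z))
        = mean U (fun x => (cut q x + v) * g x) &
      forall g, bounded_mfun g -> mean P (fun z => AY C1 C2 z * g (obsX z))
        = mean U (fun x => (cut p x * cut q x + v * cut p x + u * cut q x + r) * g x)].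

Let bA : bounded_mfun cutA := @bounded_cutA R d C1 C2.
Let bY : bounded_mfun cutY := @bounded_cutY R d C1 C2.
Let bAY : bounded_mfun _ := bounded_AY d C1 C2.
Let bp := bounded_p.
Let bq := bounded_q.

Lemma moments_point_law u v : `|u| <= eta -> `|v| <= eta ->
  moments u v (u * v) (point_law u v).
Proof.
move=> ue ve; split => //.
- apply/eqP; rewrite eq_le probability_le1/=; last exact: measurable_good.
  rewrite -(unif_cube_cube R d) /point_law /distribution /pushforward.
  apply: le_measure; rewrite ?inE.
  + exact: measurable_cube.
  + rewrite -[X in measurable X]setTI; apply: measurable_point => //.
    exact: measurable_good.
  + by move=> x cx; exact: good_point.
- move=> g bg; have bgX := bounded_obsX bg.
  apply: mean_point_law; [by bounded_tac..|] => x cx.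
  by rewrite cutAE ?cutE//; exact: good_point.
- move=> g bg; have bgX := bounded_obsX bg.
  apply: mean_point_law; [by bounded_tac..|] => x cx.
  by rewrite cutYE ?cutE//; exact: good_point.
- move=> g bg; have bgX := bounded_obsX bg.
  apply: mean_point_law; [by bounded_tac..|] => x cx.
  rewrite /AY cutAE ?cutYE ?cutE//; try exact: good_point.
  by rewrite /obsA /obsY /obsX /=; ring.
Qed.

Lemma moments_mixture u v r u' v' r' P Q : moments u v r P -> moments u' v' r' Q ->
  moments (2^-1 * (u + u')) (2^-1 * (v + v')) (2^-1 * (r + r')) (mixture P Q).
Proof.
have half2 (x : \bar R) : (2^-1%:E * x + 2^-1%:E * x = x)%E.
  rewrite -ge0_muleDl ?lee_fin ?invr_ge0// -EFinD.
  by rewrite (_ : 2^-1 + 2^-1 = 1) ?mul1e//; lra.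
move=> [PX PG PA PY PAY] [QX QG QA QY QAY]; split.
- by move=> B mB; rewrite [LHS]mixtureE PX// QX.
- by rewrite [LHS]mixtureE PG QG.
- move=> g bg; have bgX := bounded_obsX bg.
  rewrite mean_mixture ?PA ?QA; try by bounded_tac.
  rewrite -meanD -?meanZl; try by bounded_tac.
  by apply: eq_mean => x; field.
- move=> g bg; have bgX := bounded_obsX bg.
  rewrite mean_mixture ?PY ?QY; try by bounded_tac.
  rewrite -meanD -?meanZl; try by bounded_tac.
  by apply: eq_mean => x; field.
- move=> g bg; have bgX := bounded_obsX bg.
  rewrite mean_mixture ?PAY ?QAY; try by bounded_tac.
  rewrite -meanD -?meanZl; try by bounded_tac.
  by apply: eq_mean => x; field.
Qed.

(** The residuals are [eta] or [- eta] with equal probabilities, and they are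
    equal, opposite or independent; the conditional covariance is accordingly
    [eta ^ 2], [- eta ^ 2] or zero. *)
Definition law_pos := mixture (point_law eta eta) (point_law (- eta) (- eta)).
Definition law_neg := mixture (point_law eta (- eta)) (point_law (- eta) eta).
Definition law_nul := mixture law_pos law_neg.

Let ee : `|eta| <= eta. Proof. by rewrite gtr0_norm. Qed.
Let ne : `|- eta| <= eta. Proof. by rewrite normrN. Qed.

Lemma moments_pos : moments 0 0 (eta ^+ 2) law_pos.
Proof.
have := moments_mixture (moments_point_law ee ee) (moments_point_law ne ne).
by rewrite !subrr mulr0 mulrNN -expr2 (_ : 2^-1 * _ = eta ^+ 2)//; lra.
Qed.

Lemma moments_neg : moments 0 0 (- eta ^+ 2) law_neg.
Proof.
have := moments_mixture (moments_point_law ee ne) (moments_point_law ne ee).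
by rewrite subrr addNr mulr0 mulrN mulNr -expr2 (_ : 2^-1 * _ = - eta ^+ 2)//; lra.
Qed.

Lemma moments_nul : moments 0 0 0 law_nul.
Proof.
have := moments_mixture moments_pos moments_neg.
by rewrite !addr0 subrr mulr0.
Qed.

Section moments_model.
Variables (P : probability obs R) (r a b M : R).
Hypotheses (PM : moments 0 0 r P) (Hp : holder_ball W a M p) (Hq : holder_ball W b M q).

Lemma moments_regA g : bounded_mfun g ->
  mean P (fun z => cutA z * g (obsX z)) = mean U (fun x => cut p x * g x).
Proof. by case: PM => _ _ H _ _ /H ->; apply: eq_mean => x; rewrite addr0. Qed.

Lemma moments_regY g : bounded_mfun g ->
  mean P (fun z => cutY z * g (obsX z)) = mean U (fun x => cut q x * g x).
Proof. by case: PM => _ _ _ H _ /H ->; apply: eq_mean => x; rewrite addr0. Qed.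

Lemma moments_AY g : bounded_mfun g ->
  mean P (fun z => AY C1 C2 z * g (obsX z))
  = mean U (fun x => (cut p x * cut q x + r) * g x).
Proof.
case: PM => _ _ _ _ H /H ->; apply: eq_mean => x; congr (_ * _); ring.
Qed.

Lemma is_cond_exp_moments (V V' : obs -> R) (f : d.-tuple R -> R) : measurable_fun setT V ->
  bounded_mfun V' -> (forall z, good C1 C2 z -> V z = V' z) ->
  measurable_fun setT f -> (forall x, `|f x| <= range_bound C1 C2) ->
  (forall g, bounded_mfun g ->
    mean P (fun z => V' z * g (obsX z)) = mean U (fun x => cut f x * g x)) ->
  is_cond_exp P (@obsX R d) V f.
Proof.
move=> mV bV' VV' mf fB reg; have [PX PG _ _ _] := PM.
have bf : bounded_mfun f by split => //; exists (range_bound C1 C2).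
have bcf : bounded_mfun (cut f) by apply: (@bounded_cut _ _ _ (range_bound C1 C2)).
have bfX := bounded_obsX bf; have bcfX := bounded_obsX bcf.
split => //; first exact: bounded_mfun_integrable.
move=> B mB; have mG := @measurable_good R d C1 C2.
have mXB : measurable (@obsX R d @^-1` B).
  by rewrite -[X in measurable X]setTI; exact: measurable_obsX.
have b1 : bounded_mfun (\1_B : d.-tuple R -> R) by exact: bounded_mfun_indic.
rewrite (integral_good mG PG mXB mV (bounded_mfunW bV') VV').
rewrite (@integral_good _ _ _ P _ _ (fun z => f (obsX z)) (fun z => cut f (obsX z)) mG PG mXB).
- rewrite -!integral_indicX//; try exact: measurable_obsX.
  rewrite reg//; congr (_%:E).
  rewrite (@mean_pushforward _ _ _ _ _ P U (@obsX R d))//.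
  + exact: measurable_obsX.
  + by move=> A mA; rewrite PX.
  + by bounded_tac.
- exact: bounded_mfunW.
- exact: bounded_mfunW.
- by move=> z [cx _]; rewrite cutE.
Qed.

Lemma moments_model : model W a b M C1 C2 P.
Proof.
have [PX PG _ _ _] := PM; split => //.
- exists (~` good C1 C2); split.
  + by apply: measurableC; exact: measurable_good.
  + by rewrite [LHS]probability_setC ?PG ?subee//; exact: measurable_good.
  + by move=> z; apply: contra_not => -[].
- exists p => //; apply: (@is_cond_exp_moments _ cutA) => //.
  + exact: measurable_obsA.
  + by move=> z gz; rewrite cutAE.
  + by move=> x; case: (bound_range x).
  + exact: moments_regA.
- exists q => //; apply: (@is_cond_exp_moments _ cutY) => //.
  + exact: measurable_obsY.
  + by move=> z gz; rewrite cutYE.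
  + by move=> x; case: (bound_range x).
  + exact: moments_regY.
Qed.

Lemma mean_AY : mean P (AY C1 C2) = mean U (fun x => cut p x * cut q x) + r.
Proof.
have b1 := @bounded_mfun_cst _ (d.-tuple R) R 1.
have := moments_AY b1.
under eq_mean do rewrite mulr1; move=> ->.
under eq_mean do rewrite mulr1.
by rewrite meanD ?mean_cst//; bounded_tac.
Qed.

(** The regression functions that the model provides have the same inner product
    as [p] and [q], because each pair can be tested against the other. *)
Lemma psi_moments : psi P = r.
Proof.
have [p' [q' [[mp' [Bp' HBp'] _] [mq' [Bq' HBq'] _] regA regY ->]]] :=
  model_regression moments_model.
have bp' := bounded_cut mp' HBp'; have bq' := bounded_cut mq' HBq'.
rewrite -regA// moments_regA//.
under [X in _ - X]eq_mean do rewrite mulrC.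
rewrite -regY// moments_regY// -/(AY C1 C2) mean_AY.
under [X in _ - X]eq_mean do rewrite mulrC.
by rewrite addrAC subrr add0r.
Qed.

End moments_model.
End submodel.

(** * Interior regression functions and their perturbations *)

Lemma ae_le_mean d (T : measurableType d) (R : realType) (P : probability T R)
    (f g : T -> R) (A : set T) : bounded_mfun f -> bounded_mfun g ->
  measurable A -> P A = 1%E -> (forall x, A x -> f x <= g x) ->
  mean P f <= mean P g.
Proof.
move=> bf bg mA PA fg.
have b1 : bounded_mfun (\1_A : T -> R) by exact: bounded_mfun_indic.
rewrite (@ae_eq_mean _ _ _ P f (fun x => f x * \1_A x) A)//; last 2 first.
- by bounded_tac.
- by move=> x Ax; rewrite indicE mem_set// mulr1.
rewrite (@ae_eq_mean _ _ _ P g (fun x => g x * \1_A x) A)//; last 2 first.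
- by bounded_tac.
- by move=> x Ax; rewrite indicE mem_set// mulr1.
apply: le_mean; [by bounded_tac..|] => x; rewrite indicE.
have [Ax|Ax] := boolP (x \in A); last by rewrite !mulr0.
by rewrite !mulr1; apply: fg; exact: set_mem.
Qed.

Section ucont_closure.
Context (R : realType) (d : nat).
Implicit Types f g : d.-tuple R -> R.

Lemma ucontD f g : ucont f -> ucont g -> ucont (fun x => f x + g x).
Proof.
move=> uf ug e e0; have e2 : 0 < e / 2 by rewrite divr_gt0.
have [df df0 Hf] := uf _ e2; have [dg dg0 Hg] := ug _ e2.
exists (Num.min df dg); first by rewrite lt_min df0.
move=> x y cx cy xy; rewrite opprD addrACA (splitr e).
apply: le_lt_trans (ler_normD _ _) _; rewrite ltrD//.
  by apply: Hf => // i; have := xy i; rewrite lt_min => /andP[].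
by apply: Hg => // i; have := xy i; rewrite lt_min => /andP[].
Qed.

Lemma ucont_comp (phi0 : R -> R) (L : R) f : 0 < L ->
  (forall s t, `|phi0 s - phi0 t| <= L * `|s - t|) ->
  ucont f -> ucont (fun x => phi0 (f x)).
Proof.
move=> L0 Lphi uf e e0; have [df df0 Hf] := uf _ (divr_gt0 e0 L0).
exists df => // x y cx cy xy; apply: le_lt_trans (Lphi _ _) _.
by rewrite mulrC -ltr_pdivlMr//; exact: Hf.
Qed.

Lemma ucontZ (c : R) f : ucont f -> ucont (fun x => c * f x).
Proof.
apply: (@ucont_comp _ (`|c| + 1)); first by rewrite ltr_wpDl.
by move=> s t; rewrite -mulrBr normrM ler_wpM2r// lerDl.
Qed.

Lemma ucont_sum (I : finType) (F : I -> d.-tuple R -> R) :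
  (forall i, ucont (F i)) -> ucont (fun x => \sum_i F i x).
Proof.
move=> uF; elim: (index_enum I) => [|i s IH].
  move=> e e0; exists 1 => // x y *; by rewrite !big_nil subrr normr0.
rewrite (_ : (fun x => _) = fun x => F i x + \sum_(j <- s) F j x).
  exact: ucontD.
by apply/funext => x; rewrite big_cons.
Qed.

Lemma eq_ucont f g : (forall x, cube x -> f x = g x) -> ucont f -> ucont g.
Proof.
move=> fg uf e e0; have [df df0 Hf] := uf _ e0; exists df => // x y cx cy xy.
by rewrite -!fg//; exact: Hf.
Qed.

Lemma ucont_cut f : ucont f -> ucont (cut f).
Proof. by apply: eq_ucont => x cx; rewrite cutE. Qed.

End ucont_closure.

Section clamp.
Context (R : realType).
Variables lo hi : R.
Hypothesis lohi : lo <= hi.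

Definition clamp (y : R) := Num.max lo (Num.min hi y).

Lemma clamp_range y : lo <= clamp y <= hi.
Proof. by rewrite /clamp le_max lexx ge_max lohi ge_min lexx. Qed.

Lemma clamp_contraction s t : `|clamp s - clamp t| <= 1 * `|s - t|.
Proof.
rewrite mul1r /clamp.
have h1 := ler_norm (s - t); have h2 := ler_norm (t - s); rewrite (distrC t s) in h2.
have h3 := normr_ge0 (s - t); rewrite ler_norml.
have h4 : lo <= hi := lohi.
by case: (ltP hi s) => ?; case: (ltP hi t) => ?; rewrite ?(max_r lohi);
  case: (ltP lo s) => ?; case: (ltP lo t) => ?; apply/andP; split; lra.
Qed.

Lemma clamp_dist y : `|y - clamp y| = (y - hi) * (hi < y)%R%:R + (lo - y) * (y < lo)%R%:R.
Proof.
rewrite /clamp; have [yh|hy] := ltP hi y.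
  have -> : (y < lo) = false by apply/negbTE; rewrite -leNgt (le_trans lohi)// ltW.
  by rewrite max_r// ger0_norm ?subr_ge0 ?ltW// mulr1 mulr0 addr0.
rewrite mulr0 add0r; have [yl|ly] := ltP y lo.
  by rewrite ltr0_norm ?subr_lt0// opprB mulr1.
by rewrite subrr normr0 mulr0.
Qed.

End clamp.

Section clamped_regression.
Context (R : realType) (d : nat).
Local Notation obs := (d.-tuple R * R * R)%type.
Local Notation U := (@unif_cube R d).
Variables (P : probability obs R) (G : set obs) (V : obs -> R) (f : d.-tuple R -> R).
Variables (lo hi Bf : R).
Hypotheses (lohi : lo <= hi) (mG : measurable G) (PG : P G = 1%E)
  (bV : bounded_mfun V) (VG : forall z, G z -> lo <= V z <= hi)
  (mf : measurable_fun setT f) (fB : forall x, cube x -> `|f x| <= Bf).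
Hypothesis PX : forall g, bounded_mfun g -> mean P (fun z => g (obsX z)) = mean U g.
Hypothesis reg : forall g, bounded_mfun g ->
  mean P (fun z => V z * g (obsX z)) = mean U (fun x => cut f x * g x).

Let f1 x := clamp lo hi (f x).

Lemma measurable_clamp : measurable_fun setT f1.
Proof. by apply: measurable_maxr => //; exact: measurable_minr. Qed.

Lemma bounded_clamp : bounded_mfun (cut f1).
Proof.
apply: (@bounded_cut _ _ _ (range_bound lo hi)); first exact: measurable_clamp.
by move=> x _; apply: norm_le_range_bound; exact: clamp_range.
Qed.

(** A response with values between [lo] and [hi] has its regression function there
    almost everywhere: testing against the indicator of an exceedance set gives
    a nonpositive mean to a nonnegative excess. *)
Lemma mean_clamp g : bounded_mfun g ->
  mean U (fun x => cut f1 x * g x) = mean U (fun x => cut f x * g x).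
Proof.
move=> bg; have bf := bounded_cut mf fB; have bf1 := bounded_clamp.
have ind (A : set (d.-tuple R)) : measurable A -> bounded_mfun (\1_A : d.-tuple R -> R).
  exact: bounded_mfun_indic.
pose A1 := [set x | hi < f x]; pose A2 := [set x | f x < lo].
have b1 : bounded_mfun (\1_A1 : d.-tuple R -> R).
  apply: ind; rewrite (_ : A1 = f @^-1` `]hi, +oo[%classic).
    by rewrite -[X in measurable X]setTI; exact: mf.
  by apply/seteqP; split => x /=; rewrite /A1 /= in_itv /= ?andbT.
have b2 : bounded_mfun (\1_A2 : d.-tuple R -> R).
  apply: ind; rewrite (_ : A2 = f @^-1` `]-oo, lo[%classic).
    by rewrite -[X in measurable X]setTI; exact: mf.
  by apply/seteqP; split => x /=; rewrite /A2 /= in_itv.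
have b1X := bounded_obsX b1; have b2X := bounded_obsX b2.
have le1 : mean U (fun x => (cut f x - hi) * \1_A1 x) <= 0.
  rewrite (@eq_mean _ _ _ _ _ (fun x => cut f x * \1_A1 x - hi * \1_A1 x)); last first.
    by move=> x; ring.
  rewrite meanB ?meanZl -?reg -?PX; try by bounded_tac.
  rewrite -meanZl -?meanB; try by bounded_tac.
  rewrite -(mean_cst P 0); apply: (ae_le_mean _ _ mG PG) => //; try by bounded_tac.
  move=> z /VG /andP[_ Vz]; rewrite -mulrBl mulr_le0_ge0 ?subr_le0//.
have le2 : mean U (fun x => (lo - cut f x) * \1_A2 x) <= 0.
  rewrite (@eq_mean _ _ _ _ _ (fun x => lo * \1_A2 x - cut f x * \1_A2 x)); last first.
    by move=> x; ring.
  rewrite meanB ?meanZl -?reg -?PX; try by bounded_tac.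
  rewrite -meanZl -?meanB; try by bounded_tac.
  rewrite -(mean_cst P 0); apply: (ae_le_mean _ _ mG PG) => //; try by bounded_tac.
  move=> z /VG /andP[Vz _]; rewrite -mulrBl mulr_le0_ge0 ?subr_le0//.
have [_ [Bg HBg]] := bg.
have Bg0 : 0 <= Bg by exact: le_trans (HBg [tuple 0 | _ < d]).
apply/eqP; rewrite eq_sym -subr_eq0 -normr_le0 -meanB; try by bounded_tac.
pose E x := Bg * ((cut f x - hi) * \1_A1 x + (lo - cut f x) * \1_A2 x).
have bE : bounded_mfun E by rewrite /E; bounded_tac.
have Ele : mean U E <= 0.
  rewrite /E meanZl ?meanD; try by bounded_tac.
  by rewrite mulr_ge0_le0//; rewrite -[X in _ <= X]addr0 lerD.
have bound x : cube x -> `|cut f x * g x - cut f1 x * g x| <= E x.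
  move=> cx; rewrite -mulrBl normrM mulrC !cutE// /E cutE// ler_pM// clamp_dist//.
  by rewrite !indicE /A1 /A2 !mem_setE.
apply: le_trans Ele; rewrite ler_norml -{1}[mean U E]mul1r -mulNr -meanZl//.
apply/andP; split; apply: (ae_le_mean _ _ (measurable_cube (d := d)) (unif_cube_cube R d)) => //;
  try by bounded_tac.
- by move=> x /bound; rewrite ler_norml mulN1r => /andP[].
- by move=> x /bound; rewrite ler_norml => /andP[].
Qed.

End clamped_regression.

Section holder_perturbation.
Context (R : realType) (d S J0 : nat) (W : cdv_basis R d S J0).
Local Notation U := (@unif_cube R d).

(** The part of the Hoelder norm coming from the scaling functions. *)
Definition coarse_norm (a : R) (f : d.-tuple R -> R) : R :=
  2 `^ (J0%:R * (a + d%:R / 2)) * \big[Num.max/0]_(m : Z W J0) `|ip f (Phi m)|.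

Lemma holder_ballP a M f : holder_ball W a M f <-> ucont f /\
  (forall l (i : wtype d * Z W l), (J0 <= l)%N ->
    2 `^ (l%:R * (a + d%:R / 2)) * `|ip f (Psi i)| <= M - coarse_norm a f).
Proof.
rewrite /holder_ball -/(coarse_norm a f); split => -[uf H]; split => //.
  move=> l i Jl; rewrite lerBrDl -lee_fin EFinD; apply: le_trans H.
  by rewrite leeD2l//; apply: ereal_sup_ubound; exists l, i.
rewrite addeC -leeBrDr//; apply: ge_ereal_sup => _ [l [i [Jl ->]]].
by rewrite -EFinB lee_fin H.
Qed.

Lemma holder_ball_le a M M' f : M <= M' -> holder_ball W a M f -> holder_ball W a M' f.
Proof.
move=> MM' /holder_ballP[uf H]; apply/holder_ballP; split => // l i Jl.
by apply: le_trans (H l i Jl) _; rewrite lerD2r.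
Qed.

Lemma eq_holder_ball a M f g : ucont g ->
  (forall j (m : Z W j), (J0 <= j)%N -> ip g (Phi m) = ip f (Phi m)) ->
  (forall j (i : wtype d * Z W j), (J0 <= j)%N -> ip g (Psi i) = ip f (Psi i)) ->
  holder_ball W a M f -> holder_ball W a M g.
Proof.
move=> ug gfP gfW /holder_ballP[_ H]; apply/holder_ballP; split => // l i Jl.
rewrite gfW// /coarse_norm.
by under eq_bigr do rewrite gfP//; exact: H.
Qed.

Variable j : nat.
Hypothesis jJ : (J0 <= j)%N.

(** Adding up all the wavelets of one level gives a function of order one whose
    wavelet coefficients at that level are all equal. *)
Definition bump (x : d.-tuple R) : R :=
  \sum_(i : wtype d * Z W j) (Num.sqrt (dim R d j))^-1 * psi_ i x.

Let bpsi (i : wtype d * Z W j) : bounded_mfun (psi_ i) := bounded_psi i jJ.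

Lemma bounded_bump : bounded_mfun bump.
Proof. by rewrite /bump; bounded_tac. Qed.

Lemma bump_out x : ~ cube x -> bump x = 0.
Proof. by move=> cx; rewrite /bump big1// => i _; rewrite /psi_ cut_out ?mulr0. Qed.

Lemma cut_bump : cut bump = bump.
Proof.
apply/funext => x; have [cx|cx] := pselect (cube x); first by rewrite cutE.
by rewrite cut_out// bump_out.
Qed.

Lemma ucont_bump : ucont bump.
Proof.
apply: ucont_sum => i; apply: ucontZ; apply: ucont_cut; exact: ucont_Psi.
Qed.

Lemma mean_bump_mul g : bounded_mfun g -> mean U (fun x => bump x * g x)
  = \sum_(i : wtype d * Z W j) (Num.sqrt (dim R d j))^-1 * mean U (fun x => psi_ i x * g x).
Proof.
move=> bg; rewrite (@eq_mean _ _ _ _ _ (fun x => \sum_(i : wtype d * Z W j)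
    (Num.sqrt (dim R d j))^-1 * (psi_ i x * g x))).
  rewrite mean_sum; last by move=> i; bounded_tac.
  by apply: eq_bigr => i _; rewrite meanZl//; bounded_tac.
by move=> x; rewrite /bump mulr_suml; apply: eq_bigr => i _; rewrite -mulrA.
Qed.

Lemma bump_Phi i (m : Z W i) : (J0 <= i)%N -> (i <= j)%N ->
  mean U (fun x => bump x * phi m x) = 0.
Proof.
move=> Ji ij; rewrite mean_bump_mul; last exact: bounded_phi.
rewrite big1// => i' _; under eq_mean do rewrite mulrC.
by rewrite ortho_phi_psi ?mulr0.
Qed.

Lemma bump_Psi_other l (i : wtype d * Z W l) : (J0 <= l)%N -> l != j ->
  mean U (fun x => bump x * psi_ i x) = 0.
Proof.
move=> Jl lj; rewrite mean_bump_mul; last exact: bounded_psi.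
by rewrite big1// => i' _; rewrite -ip_mean orthogonal_Psi ?mulr0// eq_sym.
Qed.

Lemma bump_Psi (i : wtype d * Z W j) :
  mean U (fun x => bump x * psi_ i x) = (Num.sqrt (dim R d j))^-1.
Proof.
rewrite mean_bump_mul; last exact: bounded_psi.
rewrite (bigD1 i)//= big1 ?addr0; last first.
  by move=> i' ii'; rewrite ortho_psi// (negbTE ii') mulr0.
by rewrite ortho_psi// eqxx mulr1.
Qed.

Lemma mean_bump_sqr :
  mean U (fun x => bump x ^+ 2) = #|{: wtype d * Z W j}|%:R / dim R d j.
Proof.
rewrite /bump (mean_sqr_expansion bpsi (fun i i' => ortho_psi i i' jJ)).
rewrite sumr_const exprVn sqr_sqrtr; last exact/ltW/dim_gt0.
by rewrite mulr_natl.
Qed.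

(** At its own level the bump uses exactly the slack that the Hoelder ball
    leaves, and it is orthogonal to all other levels. *)
Lemma holder_ball_bump a M e s f : bounded_mfun (cut f) ->
  holder_ball W a (M - e) f -> `|s| <= e ->
  holder_ball W a M (fun x => f x + s * decay a ^+ j * bump x).
Proof.
move=> bf /holder_ballP[uf H] se; set c := s * decay a ^+ j.
have bb := bounded_bump.
have ipE g : bounded_mfun (cut g) -> ip (fun x => f x + c * bump x) g
    = ip f g + c * mean U (fun x => bump x * cut g x).
  move=> bg; rewrite !ip_mean -meanZl -?meanD; try by bounded_tac.
  apply: eq_mean => x; rewrite -{2}cut_bump /cut; ring.
apply/holder_ballP; split; first by apply: ucontD => //; apply: ucontZ; exact: ucont_bump.
have -> : coarse_norm a (fun x => f x + c * bump x) = coarse_norm a f.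
  rewrite /coarse_norm; congr (_ * _); apply: eq_bigr => m _.
  rewrite ipE; last exact: bounded_phi.
  by rewrite (bump_Phi m) ?mulr0 ?addr0.
move=> l i Jl; rewrite ipE; last exact: bounded_psi.
have e0 : 0 <= e by exact: le_trans se.
have Hi := H l i Jl.
have [lj|lj] := eqVneq l j; last first.
  rewrite -/(psi_ i) bump_Psi_other// mulr0 addr0; apply: le_trans Hi _; lra.
move: lj i Jl Hi => -> i Jl Hi; rewrite -/(psi_ i) bump_Psi//.
have pow : 2 `^ (j%:R * (a + d%:R / 2)) * (decay a ^+ j / Num.sqrt (dim R d j)) = 1.
  rewrite -powR12_sqrt; last exact/ltW/dim_gt0.
  rewrite /dim /decay -(@powR_mulrn R 2 (j * d))// -(@powR_mulrn R _ j) ?powR_ge0//.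
  have powD (x y : R) : 2 `^ (x + y) = 2 `^ x * 2 `^ y.
    by rewrite powRD// pnatr_eq0 implybT.
  rewrite -!powRrM -powRN -!powD -[RHS](powRr0 2); congr (_ `^ _).
  by rewrite natrM; field.
apply: (@le_trans _ _ (2 `^ (j%:R * (a + d%:R / 2)) * (`|ip f (Psi i)| + `|s| * (decay a ^+ j / Num.sqrt (dim R d j))))).
  apply: ler_wpM2l; first exact: powR_ge0.
  apply: le_trans (ler_normD _ _) _; rewrite lerD2l /c -mulrA normrM.
  by rewrite (@ger0_norm _ (_ / _))// divr_ge0 ?exprn_ge0// ?ltW// ?decay_gt0.
rewrite mulrDr [X in _ + X]mulrCA pow mulr1; lra.
Qed.

End holder_perturbation.

Lemma bump_le (R : realType) (d S J0 : nat) (W : cdv_basis R d S J0) :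
  exists2 C, 0 < C & forall j x, (J0 <= j)%N -> `|bump W j x| <= C.
Proof.
have [C [N [C0 H]]] := cut_localized (localized_Psi W).
exists (N%:R * Num.sqrt C + 1); first by rewrite ltr_wpDl// mulr_ge0// sqrtr_ge0.
move=> j x jJ; have [HC HN] := H j jJ.
rewrite /bump; apply: le_trans (ler_norm_sum _ _ _) _.
apply: (@le_trans _ _ (N%:R * Num.sqrt C)); last by rewrite lerDl.
apply: sum_sparse_le => [|i|]; first exact: sqrtr_ge0.
  rewrite normrM normfV (ger0_norm (sqrtr_ge0 _)) mulrC ler_pdivrMr ?sqrtr_gt0 ?dim_gt0//.
  rewrite -sqrtrM ?(ltW C0)// -sqrtr_sqr ler_sqrt; first exact: HC.
  by rewrite mulr_ge0 ?(ltW C0)// ltW// dim_gt0.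
apply: leq_trans (HN x); apply: subset_leq_card; apply/fintype.subsetP => i; rewrite !inE.
by apply: contraNN => /eqP; rewrite /psi_ => ->; rewrite mulr0 normr0.
Qed.

(** * Risk lower bounds *)

Section bias.
Context (R : realType) (d S J0 : nat) (W : cdv_basis R d S J0).
Local Notation U := (@unif_cube R d).

Definition kernel_diag j x : R := \sum_(m : Z W j) phi m x ^+ 2.

Lemma bounded_kernel_diag j : (J0 <= j)%N -> bounded_mfun (kernel_diag j).
Proof.
by move=> jJ; apply: bounded_mfun_sum => m; apply: bounded_mfunX; exact: bounded_phi.
Qed.

Lemma mean_kernel_diag j : (J0 <= j)%N -> mean U (kernel_diag j) = #|Z W j|%:R.
Proof.
move=> jJ; have bphi (m : Z W j) : bounded_mfun (phi m) := bounded_phi m jJ.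
rewrite mean_sum; last by move=> m; bounded_tac.
rewrite (eq_bigr (fun=> 1)) ?sumr_const// => m _.
rewrite -[RHS]/(true%:R) -(eqxx m) -(ortho_phi m m jJ).
by apply: eq_mean => x; rewrite expr2.
Qed.

(** The bias of the estimator when the conditional covariance vanishes. *)
Definition bias_form j (n : nat) (f g : d.-tuple R -> R) : R :=
  mean U (fun x => f x * g x) - n%:R^-1 * mean U (fun x => f x * g x * kernel_diag j x)
  - (1 - n%:R^-1) * \sum_(m : Z W j) coef U (@phi _ _ _ _ W j) f m * coef U (@phi _ _ _ _ W j) g m.

(** Being bilinear, the bias has a mixed second difference that does not involve
    the base point [(f, g)]; orthogonality of [u] to [V_j] removes the
    projections as well. *)
Lemma bias_form_difference j n f g u v : (J0 <= j)%N ->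
  bounded_mfun f -> bounded_mfun g -> bounded_mfun u -> bounded_mfun v ->
  (forall m : Z W j, coef U (@phi _ _ _ _ W j) u m = 0) ->
  bias_form j n (fun x => f x + u x) (fun x => g x + v x)
  - bias_form j n (fun x => f x + u x) (fun x => g x - v x)
  - bias_form j n (fun x => f x - u x) (fun x => g x + v x)
  + bias_form j n (fun x => f x - u x) (fun x => g x - v x)
  = 4 * mean U (fun x => u x * v x * (1 - n%:R^-1 * kernel_diag j x)).
Proof.
move=> jJ bf bg bu bv u0; have bk := bounded_kernel_diag jJ.
have bphi (m : Z W j) : bounded_mfun (phi m) := bounded_phi m jJ.
have coefP m : coef U (@phi _ _ _ _ W j) (fun x => f x + u x) m = coef U (@phi _ _ _ _ W j) f m.
  rewrite -[RHS]addr0 -(u0 m) /coef -meanD; try by bounded_tac.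
  by apply: eq_mean => x; rewrite mulrDl.
have coefN m : coef U (@phi _ _ _ _ W j) (fun x => f x - u x) m = coef U (@phi _ _ _ _ W j) f m.
  rewrite -[RHS]subr0 -(u0 m) /coef -meanB; try by bounded_tac.
  by apply: eq_mean => x; rewrite mulrBl.
have mixed h : bounded_mfun h ->
    mean U (fun x => (f x + u x) * (g x + v x) * h x)
    - mean U (fun x => (f x + u x) * (g x - v x) * h x)
    - mean U (fun x => (f x - u x) * (g x + v x) * h x)
    + mean U (fun x => (f x - u x) * (g x - v x) * h x)
    = 4 * mean U (fun x => u x * v x * h x).
  move=> bh; rewrite -!meanB -?meanD -?meanZl; try by bounded_tac.
  by apply: eq_mean => x; ring.
have m1 := mixed _ (@bounded_mfun_cst _ _ R 1); have mk := mixed _ bk.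
have mulr1' (F : d.-tuple R -> R) : mean U (fun x => F x * 1) = mean U F.
  by apply: eq_mean => x; rewrite mulr1.
rewrite !mulr1' in m1.
have -> : mean U (fun x => u x * v x * (1 - n%:R^-1 * kernel_diag j x))
    = mean U (fun x => u x * v x) - n%:R^-1 * mean U (fun x => u x * v x * kernel_diag j x).
  rewrite -meanZl -?meanB; try by bounded_tac.
  by apply: eq_mean => x; ring.
rewrite /bias_form.
rewrite [in RHS]mulrBr [in RHS]mulrCA -m1 -mk.
have sumP w : \sum_(m : Z W j) coef U (@phi _ _ _ _ W j) (fun x => f x + u x) m * w m
    = \sum_m coef U (@phi _ _ _ _ W j) f m * w m.
  by apply: eq_bigr => m _; rewrite coefP.
have sumN w : \sum_(m : Z W j) coef U (@phi _ _ _ _ W j) (fun x => f x - u x) m * w m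
    = \sum_m coef U (@phi _ _ _ _ W j) f m * w m.
  by apply: eq_bigr => m _; rewrite coefN.
rewrite !sumP !sumN; ring.
Qed.

End bias.

Section estimator_moments.
Context (R : realType) (d S J0 : nat) (W : cdv_basis R d S J0).
Local Notation obs := (d.-tuple R * R * R)%type.
Local Notation U := (@unif_cube R d).
Variables (C1 C2 eta : R) (p q : d.-tuple R -> R).
Hypotheses (eta0 : 0 < eta) (mp : measurable_fun setT p) (mq : measurable_fun setT q).
Hypotheses (p_range : forall x, C1 + eta <= p x <= C2 - eta)
  (q_range : forall x, C1 + eta <= q x <= C2 - eta).
Variables (j n : nat).
Hypotheses (jJ : (J0 <= j)%N) (n0 : (0 < n)%N).

Let bp : bounded_mfun (cut p) := bounded_p eta0 mp p_range q_range.
Let bq : bounded_mfun (cut q) := bounded_q eta0 mq p_range q_range.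
Let bphi (m : Z W j) : bounded_mfun (phi m) := bounded_phi m jJ.
Let bA : bounded_mfun _ := @bounded_cutA R d C1 C2.
Let bY : bounded_mfun _ := @bounded_cutY R d C1 C2.
Let bAm (m : Z W j) := bounded_Aphi C1 C2 m jJ.
Let bYm (m : Z W j) := bounded_Yphi C1 C2 m jJ.
Let bAY : bounded_mfun _ := bounded_AY d C1 C2.
Let nn0 : n%:R != 0 :> R. Proof. by rewrite pnatr_eq0 -lt0n. Qed.

(** In the double sum over observations, the off-diagonal terms factorise and the
    diagonal ones retain the conditional mean of [AY]. *)
Lemma mean_psi_cut P r : moments C1 C2 p q 0 0 r P ->
  mean (iid_law P n) (psi_cut W C1 C2 j (n := n)) - r
  = bias_form W j n (cut p) (cut q) - r * (#|Z W j|%:R / n%:R).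
Proof.
move=> PM; rewrite /psi_cut meanB; last 2 first.
- by apply: bounded_mfunM; [exact: bounded_mfun_cst|exact: bounded_mfun_Sum].
- apply: bounded_mfunM; first exact: bounded_mfun_cst.
  by apply: bounded_mfun_sum => m; apply: bounded_mfunM; exact: bounded_mfun_Sum.
rewrite meanZl ?mean_Sum//; last exact: bounded_mfun_Sum.
rewrite meanZl; last first.
  by apply: bounded_mfun_sum => m; apply: bounded_mfunM; exact: bounded_mfun_Sum.
rewrite mean_sum; last by move=> m; apply: bounded_mfunM; exact: bounded_mfun_Sum.
rewrite (mean_AY eta0 mp mq p_range q_range PM).
have bk := bounded_kernel_diag W jJ.
have -> : \sum_(m : Z W j) mean (iid_law P n) (fun t => Sum (Aphi C1 C2 m) t * Sum (Yphi C1 C2 m) t)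
    = n%:R * (mean U (fun x => cut p x * cut q x * kernel_diag W j x) + r * #|Z W j|%:R)
      + n%:R * (n%:R - 1) * \sum_(m : Z W j) coef U (@phi _ _ _ _ W j) (cut p) m
          * coef U (@phi _ _ _ _ W j) (cut q) m.
  rewrite -(mean_kernel_diag W jJ) -meanZl// -meanD; try by bounded_tac.
  rewrite (@eq_mean _ _ _ _ _ (fun x => \sum_(m : Z W j)
      (cut p x * cut q x + r) * phi m x ^+ 2)); last first.
    by move=> x; rewrite -mulrDl /kernel_diag mulr_sumr.
  rewrite mean_sum; last by move=> m; bounded_tac.
  rewrite !mulr_sumr -big_split /=; apply: eq_bigr => m _.
  rewrite mean_Sum2//; congr (_ + _ * (_ * _)).
  - congr (_ * _); rewrite -(moments_AY PM); last by bounded_tac.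
    by apply: eq_mean => z; rewrite /Aphi /Yphi /AY; ring.
  - by rewrite /Aphi (moments_regA PM).
  - by rewrite /Yphi (moments_regY PM).
by rewrite /bias_form; field.
Qed.

(** Correlating the estimator with the sample sum of the score of the
    conditional covariance at zero keeps only the diagonal terms. *)
Definition score (z : obs) :=
  (cutA C1 C2 z - cut p (obsX z)) * (cutY C1 C2 z - cut q (obsX z)).

Let bscore : bounded_mfun score.
Proof.
by have := bounded_obsX bp; have := bounded_obsX bq => *; rewrite /score; bounded_tac.
Qed.

Local Notation Q := (law_nul eta mp mq).

Lemma mean_law_nul (f : obs -> R) (f' : R -> R -> d.-tuple R -> R) :
  bounded_mfun f -> (forall u v, bounded_mfun (f' u v)) ->
  (forall u v x, `|u| <= eta -> `|v| <= eta -> cube x -> f (point p q u v x) = f' u v x) ->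
  mean Q f = mean U (fun x => 4^-1 * (f' eta eta x + f' (- eta) (- eta) x
    + f' eta (- eta) x + f' (- eta) eta x)).
Proof.
move=> bf bf' ff'; have ne : `|- eta| <= eta by rewrite normrN gtr0_norm.
have ee : `|eta| <= eta by rewrite gtr0_norm.
have b1 := bf' eta eta; have b2 := bf' (- eta) (- eta).
have b3 := bf' eta (- eta); have b4 := bf' (- eta) eta.
have pl u v : `|u| <= eta -> `|v| <= eta -> mean (point_law mp mq u v) f = mean U (f' u v).
  by move=> hu hv; apply: mean_point_law => // x cx; exact: ff'.
rewrite !mean_mixture// !pl// meanZl ?meanD; try by bounded_tac.
by field.
Qed.

Let pointE u v x : `|u| <= eta -> `|v| <= eta -> cube x ->
  [/\ cutA C1 C2 (point p q u v x) = cut p x + u,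
      cutY C1 C2 (point p q u v x) = cut q x + v &
      score (point p q u v x) = u * v].
Proof.
move=> hu hv cx; have gz := good_point p_range q_range hu hv cx.
rewrite /score cutAE// cutYE// !cutE//= /obsX/= /obsA /obsY /=; split => //; ring.
Qed.

Lemma mean_score : mean Q score = 0.
Proof.
rewrite (@mean_law_nul _ (fun u v _ => u * v))//.
- by rewrite (@eq_mean _ _ _ _ _ (fun=> 0)) ?mean_cst// => x; ring.
- by move=> u v; exact: bounded_mfun_cst.
- by move=> u v x hu hv cx; have [_ _ ->] := pointE hu hv cx.
Qed.

Lemma mean_score_sqr : mean Q (fun z => score z * score z) = eta ^+ 4.
Proof.
rewrite (@mean_law_nul _ (fun u v _ => (u * v) * (u * v))).
- by rewrite (@eq_mean _ _ _ _ _ (fun=> eta ^+ 4)) ?mean_cst// => x; field.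
- by bounded_tac.
- by move=> u v; bounded_tac.
- by move=> u v x hu hv cx; have [_ _ ->] := pointE hu hv cx.
Qed.

Lemma mean_Aphi_score (m : Z W j) : mean Q (fun z => Aphi C1 C2 m z * score z) = 0.
Proof.
rewrite (@mean_law_nul _ (fun u v x => (cut p x + u) * phi m x * (u * v))).
- by rewrite (@eq_mean _ _ _ _ _ (fun=> 0)) ?mean_cst// => x; ring.
- by bounded_tac.
- by move=> u v; bounded_tac.
- by move=> u v x hu hv cx; have [h1 _ ->] := pointE hu hv cx; rewrite /Aphi h1.
Qed.

Lemma mean_Yphi_score (m : Z W j) : mean Q (fun z => Yphi C1 C2 m z * score z) = 0.
Proof.
rewrite (@mean_law_nul _ (fun u v x => (cut q x + v) * phi m x * (u * v))).
- by rewrite (@eq_mean _ _ _ _ _ (fun=> 0)) ?mean_cst// => x; ring.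
- by bounded_tac.
- by move=> u v; bounded_tac.
- by move=> u v x hu hv cx; have [_ h2 ->] := pointE hu hv cx; rewrite /Yphi h2.
Qed.

Lemma mean_AY_score : mean Q (fun z => AY C1 C2 z * score z) = eta ^+ 4.
Proof.
rewrite (@mean_law_nul _ (fun u v x => (cut p x + u) * (cut q x + v) * (u * v))).
- by rewrite (@eq_mean _ _ _ _ _ (fun=> eta ^+ 4)) ?mean_cst// => x; field.
- by bounded_tac.
- by move=> u v; bounded_tac.
- by move=> u v x hu hv cx; have [h1 h2 ->] := pointE hu hv cx; rewrite /AY h1 h2.
Qed.

Lemma mean_AphiYphi_score (m : Z W j) :
  mean Q (fun z => Aphi C1 C2 m z * Yphi C1 C2 m z * score z) = eta ^+ 4.
Proof.
rewrite (@mean_law_nul _ (fun u v x => (cut p x + u) * phi m x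
    * ((cut q x + v) * phi m x) * (u * v))).
- rewrite (@eq_mean _ _ _ _ _ (fun x => eta ^+ 4 * (phi m x * phi m x))).
    by rewrite meanZl ?ortho_phi ?eqxx ?mulr1//; bounded_tac.
  by move=> x; field.
- by bounded_tac.
- by move=> u v; bounded_tac.
- by move=> u v x hu hv cx; have [h1 h2 ->] := pointE hu hv cx; rewrite /Aphi /Yphi h1 h2.
Qed.

Lemma mean_psi_cut_score :
  mean (iid_law Q n) (fun t => psi_cut W C1 C2 j t * Sum score t)
  = eta ^+ 4 * (1 - #|Z W j|%:R / n%:R).
Proof.
have bS := @bounded_mfun_Sum _ _ _ n _ bscore.
have bSA m := @bounded_mfun_Sum _ _ _ n _ (bAm m).
have bSY m := @bounded_mfun_Sum _ _ _ n _ (bYm m).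
have bSAY := @bounded_mfun_Sum _ _ _ n _ bAY.
have bt (m : Z W j) : bounded_mfun (fun t : n.-tuple obs =>
    Sum (Aphi C1 C2 m) t * Sum (Yphi C1 C2 m) t * Sum score t).
  by have := bSA m; have := bSY m => *; bounded_tac.
rewrite (@eq_mean _ _ _ _ _ (fun t => n%:R^-1 * (Sum (AY C1 C2) t * Sum score t)
  - n%:R^-1 ^+ 2 * \sum_(m : Z W j)
      Sum (Aphi C1 C2 m) t * Sum (Yphi C1 C2 m) t * Sum score t)); last first.
  by move=> t; rewrite /psi_cut mulrBl -[X in X - _]mulrA -[X in _ - X]mulrA -[in RHS]mulr_suml.
have bsum := bounded_mfun_sum (index_enum (Z W j)) bt.
rewrite meanB ?meanZl ?mean_sum//; try by bounded_tac.
rewrite mean_Sum2// mean_AY_score mean_score.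
rewrite (eq_bigr (fun=> n%:R * eta ^+ 4)); last first.
  move=> m _; rewrite mean_Sum3// ?mean_AphiYphi_score//.
  - exact: mean_score.
  - exact: mean_Aphi_score.
  - exact: mean_Yphi_score.
by rewrite sumr_const -[X in _ - _ * X]mulr_natl; field.
Qed.

(** This is Cauchy-Schwarz against the sample sum of the score, which has mean
    zero, whatever the centring constant [c]. *)
Lemma parametric_lower_bound c :
  eta ^+ 4 * (1 - #|Z W j|%:R / n%:R) ^+ 2 / n%:R
  <= mean (iid_law Q n) (fun t => (psi_cut W C1 C2 j t - c) ^+ 2).
Proof.
have bS := @bounded_mfun_Sum _ _ _ n _ bscore.
have bpsi := @bounded_psi_cut R d S J0 W C1 C2 j n jJ.
have bpc : bounded_mfun (fun t : n.-tuple obs => psi_cut W C1 C2 j t - c).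
  by apply: bounded_mfunB => //; exact: bounded_mfun_cst.
have := mean_Cauchy_Schwarz (iid_law Q n) bpc bS.
have -> : mean (iid_law Q n) (fun t => (psi_cut W C1 C2 j t - c) * Sum score t)
    = eta ^+ 4 * (1 - #|Z W j|%:R / n%:R).
  rewrite -mean_psi_cut_score.
  rewrite (@eq_mean _ _ _ _ _ (fun t => psi_cut W C1 C2 j t * Sum score t
      - c * Sum score t)); last by move=> t; ring.
  rewrite meanB ?meanZl//; last 2 first.
  - exact: bounded_mfunM.
  - by apply: bounded_mfunM => //; exact: bounded_mfun_cst.
  by rewrite mean_Sum// mean_score !mulr0 subr0.
have -> : mean (iid_law Q n) (fun t => Sum score t ^+ 2) = n%:R * eta ^+ 4.
  rewrite (@eq_mean _ _ _ _ _ (fun t => Sum score t * Sum score t))//.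
  by rewrite mean_Sum2// mean_score mean_score_sqr !mulr0 addr0.
have n_gt0 : 0 < n%:R :> R by rewrite ltr0n.
have e4 : 0 < eta ^+ 4 by rewrite exprn_gt0.
move=> H; rewrite ler_pdivrMr//.
rewrite -(ler_pM2r e4); apply: le_trans (le_trans H _); rewrite le_eqVlt;
  apply/orP; left; apply/eqP; ring.
Qed.

End estimator_moments.

Section risk_lower.
Context (R : realType) (d S J0 : nat) (W : cdv_basis R d S J0).
Local Notation obs := (d.-tuple R * R * R)%type.
Variables (alpha beta M C1 C2 : R).

Local Notation max_risk := (max_risk W alpha beta M C1 C2).

Lemma max_risk_ge P (j : nat -> nat) n : model W alpha beta M C1 C2 P ->
  (J0 <= j n)%N ->
  ((mean (iid_law P n) (fun t => (psi_cut W C1 C2 (j n) t - psi P) ^+ 2))%:E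
   <= max_risk j n)%E.
Proof.
move=> PM jJ; apply: ereal_sup_ubound; exists P => //.
exact: (risk_mean PM).
Qed.

(** Clamping changes the regression functions of a law with slack [e] only on a
    null set, and makes their range bounds hold everywhere. *)
Lemma interior_regression e : 0 < e ->
  model W alpha beta (M - e) (C1 + e) (C2 - e) !=set0 ->
  exists p q : d.-tuple R -> R,
  [/\ measurable_fun setT p, measurable_fun setT q,
      forall x, C1 + e <= p x <= C2 - e, forall x, C1 + e <= q x <= C2 - e &
      holder_ball W alpha (M - e) p /\ holder_ball W beta (M - e) q].
Proof.
move=> e0 [P PM]; set lo := C1 + e; set hi := C2 - e.
have PG := model_good PM.
have lohi : lo <= hi.
  have : (good lo hi : set obs) !=set0.
    apply/set0P/negP => /eqP G0; move: PG; rewrite G0 measure0 => /esym/eqP.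
    by rewrite onee_eq0.
  by move=> [z [_ [/andP[h1 h2] _]]]; exact: le_trans h1 h2.
have [p [q [[mp [Bp HBp] Hp] [mq [Bq HBq] Hq] regA regY _]]] := model_regression PM.
have mG := @measurable_good R d lo hi.
have AG (z : obs) : good lo hi z -> lo <= cutA lo hi z <= hi.
  by move=> gz; rewrite cutAE//; case: gz => _ [].
have YG (z : obs) : good lo hi z -> lo <= cutY lo hi z <= hi.
  by move=> gz; rewrite cutYE//; case: gz => _ [].
have clampA := mean_clamp lohi mG PG (@bounded_cutA R d lo hi) AG mp HBp (mean_obsX PM) regA.
have clampY := mean_clamp lohi mG PG (@bounded_cutY R d lo hi) YG mq HBq (mean_obsX PM) regY.
exists (fun x => clamp lo hi (p x)), (fun x => clamp lo hi (q x)).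
split; [exact: measurable_clamp|exact: measurable_clamp|..].
- by move=> x; exact: clamp_range.
- by move=> x; exact: clamp_range.
split.
- apply: (eq_holder_ball _ _ _ Hp).
  + apply: (ucont_comp ltr01 (clamp_contraction lohi)); exact: (proj1 Hp).
  + by move=> j m jJ; rewrite !ip_mean; apply: clampA; exact: (bounded_phi m jJ).
  + by move=> j m jJ; rewrite !ip_mean; apply: clampA; exact: (bounded_psi m jJ).
- apply: (eq_holder_ball _ _ _ Hq).
  + apply: (ucont_comp ltr01 (clamp_contraction lohi)); exact: (proj1 Hq).
  + by move=> j m jJ; rewrite !ip_mean; apply: clampY; exact: (bounded_phi m jJ).
  + by move=> j m jJ; rewrite !ip_mean; apply: clampY; exact: (bounded_psi m jJ).
Qed.

Section bias_risk.
Variables (eta : R) (p q : d.-tuple R -> R).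
Hypotheses (eta0 : 0 < eta) (mp : measurable_fun setT p) (mq : measurable_fun setT q).
Hypotheses (p_range : forall x, C1 + eta <= p x <= C2 - eta)
  (q_range : forall x, C1 + eta <= q x <= C2 - eta)
  (Hp : holder_ball W alpha M p) (Hq : holder_ball W beta M q).

Lemma risk_ge_bias P r (j : nat -> nat) n : moments C1 C2 p q 0 0 r P ->
  (J0 <= j n)%N -> (0 < n)%N ->
  (((bias_form W (j n) n (cut p) (cut q) - r * (#|Z W (j n)|%:R / n%:R)) ^+ 2)%:E
   <= max_risk j n)%E.
Proof.
move=> Pm jJ n0.
have PM := moments_model eta0 mp mq p_range q_range Pm Hp Hq.
have psiP := psi_moments eta0 mp mq p_range q_range Pm Hp Hq.
apply: le_trans (max_risk_ge PM jJ); rewrite psiP lee_fin.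
have bpsi := @bounded_psi_cut R d S J0 W C1 C2 (j n) n jJ.
rewrite -(mean_psi_cut W eta0 mp mq p_range q_range jJ n0 Pm).
rewrite -{1}(mean_cst (iid_law P n) r) -meanB//; last exact: bounded_mfun_cst.
by apply: sqr_mean_le; apply: bounded_mfunB => //; exact: bounded_mfun_cst.
Qed.

(** Two laws whose conditional covariances are opposite receive opposite
    contributions from the diagonal terms, and these cannot both be offset by
    the remaining bias, which they share. *)
Lemma risk_ge_diag (j : nat -> nat) n : (J0 <= j n)%N -> (0 < n)%N ->
  (((eta ^+ 2 * (#|Z W (j n)|%:R / n%:R)) ^+ 2)%:E <= max_risk j n)%E.
Proof.
move=> jJ n0; set D := _ * (_ / _).
have D0 : 0 <= D by rewrite mulr_ge0 ?sqr_ge0// divr_ge0.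
set b := bias_form W (j n) n (cut p) (cut q).
have sqr_le (x y : R) : 0 <= x -> x <= y -> x ^+ 2 <= y ^+ 2.
  by move=> x0 xy; rewrite lerXn2r// nnegrE (le_trans x0).
have [b0|b0] := leP 0 b.
  apply: le_trans (risk_ge_bias (moments_neg eta0 mp mq p_range q_range) jJ n0).
  by rewrite lee_fin -/b mulNr opprK -/D; apply: sqr_le => //; lra.
apply: le_trans (risk_ge_bias (moments_pos eta0 mp mq p_range q_range) jJ n0).
by rewrite lee_fin -/b -/D -[leRHS]sqrrN opprB; apply: sqr_le => //; lra.
Qed.

(** If the dimension exceeds half the sample size, the diagonal terms alone give
    a risk of constant order. *)
Lemma risk_ge_parametric (j : nat -> nat) n : (J0 <= j n)%N -> (0 < n)%N ->
  ((eta ^+ 4 / 4 * n%:R^-1)%:E <= max_risk j n)%E.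
Proof.
move=> jJ n0; have n_gt0 : 0 < n%:R :> R by rewrite ltr0n.
have n1 : n%:R^-1 <= 1 :> R by rewrite invf_le1// ler1n.
have e4 : 0 < eta ^+ 4 by rewrite exprn_gt0.
have n'0 : 0 < n%:R^-1 :> R by rewrite invr_gt0.
have [small|large] := leP (#|Z W (j n)|%:R / n%:R) (2^-1 : R).
  have Pm := moments_nul eta0 mp mq p_range q_range.
  have PM := moments_model eta0 mp mq p_range q_range Pm Hp Hq.
  apply: le_trans (max_risk_ge PM jJ); rewrite lee_fin.
  apply: le_trans (parametric_lower_bound W eta0 mp mq p_range q_range jJ n0 _).
  apply: ler_wpM2r; first exact: ltW.
  apply: ler_wpM2l; first exact: ltW.
  rewrite (_ : 4^-1 = 2^-1 ^+ 2); last by field.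
  by rewrite lerXn2r ?nnegrE//; lra.
apply: le_trans (risk_ge_diag jJ n0); rewrite lee_fin exprMn.
rewrite (_ : (eta ^+ 2) ^+ 2 = eta ^+ 4) -?exprM//.
rewrite -mulrA; apply: ler_wpM2l; first exact: ltW.
apply: (@le_trans _ _ (2^-1 ^+ 2)); last by rewrite lerXn2r ?nnegrE ?ltW//; lra.
rewrite (_ : 2^-1 ^+ 2 = 4^-1 * 1); last by field.
exact: ler_wpM2l.
Qed.

End bias_risk.
End risk_lower.

Section risk_lower_bound.
Context (R : realType) (d S J0 : nat) (W : cdv_basis R d S J0).
Local Notation U := (@unif_cube R d).
Hypothesis d_gt0 : (0 < d)%N.
Variables (alpha beta M C1 C2 : R).
Hypotheses (alpha_gt0 : 0 < alpha) (beta_gt0 : 0 < beta).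
Variables (e : R) (p q : d.-tuple R -> R).
Hypotheses (e0 : 0 < e) (mp : measurable_fun setT p) (mq : measurable_fun setT q).
Hypotheses (p_range : forall x, C1 + e <= p x <= C2 - e)
  (q_range : forall x, C1 + e <= q x <= C2 - e)
  (Hp : holder_ball W alpha (M - e) p) (Hq : holder_ball W beta (M - e) q).

Local Notation max_risk := (max_risk W alpha beta M C1 C2).

Let bp : bounded_mfun (cut p) := bounded_p e0 mp p_range q_range.
Let bq : bounded_mfun (cut q) := bounded_q e0 mq p_range q_range.

Lemma card_wtype_gt0 : (0 < #|{: wtype d}|)%N.
Proof.
apply/card_gt0P.
have H : [ffun=> true] != [ffun=> false] :> {ffun 'I_d -> bool}.
  by apply/eqP => /ffunP /(_ (Ordinal d_gt0)); rewrite !ffunE.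
by exists (exist (fun f : {ffun 'I_d -> bool} => is_true (f != [ffun=> false])) _ H).
Qed.

Lemma decay_pow_le1 a j : 0 < a -> decay a ^+ j <= 1 :> R.
Proof. by move=> a0; rewrite exprn_ile1// ltW// ?decay_gt0 ?decay_lt1. Qed.

Section perturbed.
Variables (s : R) (j : nat).
Hypotheses (s0 : 0 <= s) (se : s <= e) (jJ : (J0 <= j)%N).
Hypothesis sB : forall x, s * `|bump W j x| <= e / 2.

Lemma perturb_range a c (f : d.-tuple R -> R) x : 0 < a -> `|c| <= s ->
  (forall x, C1 + e <= f x <= C2 - e) ->
  C1 + e / 2 <= f x + c * decay a ^+ j * bump W j x <= C2 - e / 2.
Proof.
move=> a0 cs f_range; have /andP[f1 f2] := f_range x.
have : `|c * decay a ^+ j * bump W j x| <= e / 2.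
  apply: le_trans (sB x); rewrite !normrM; apply: ler_wpM2r => //.
  rewrite -[leRHS]mulr1 ler_pM//.
  by rewrite ger0_norm ?decay_pow_le1// exprn_ge0// ltW// decay_gt0.
by rewrite ler_norml => /andP[h1 h2]; apply/andP; split; lra.
Qed.

Lemma cut_perturb a c (f : d.-tuple R -> R) :
  cut (fun x => f x + c * decay a ^+ j * bump W j x)
  = fun x => cut f x + c * decay a ^+ j * bump W j x.
Proof.
by apply/funext => x; rewrite -{2}(cut_bump W j) /cut; ring.
Qed.

Lemma risk_ge_perturb (c c' : R) (jj : nat -> nat) n : jj n = j -> (0 < n)%N ->
  `|c| <= s -> `|c'| <= s ->
  ((bias_form W j n (fun x => cut p x + c * decay alpha ^+ j * bump W j x)
     (fun x => cut q x + c' * decay beta ^+ j * bump W j x) ^+ 2)%:E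
   <= max_risk jj n)%E.
Proof.
move=> jE n0 cs cs'; have e2 : 0 < e / 2 by rewrite divr_gt0.
have mb : measurable_fun setT (bump W j) by case: (bounded_bump W jJ).
have mpert (a k : R) (f : d.-tuple R -> R) : measurable_fun setT f ->
    measurable_fun setT (fun x => f x + k * decay a ^+ j * bump W j x).
  by move=> mf; apply: measurable_funD => //; apply: measurable_funM.
have rp := fun x => @perturb_range _ _ _ x alpha_gt0 cs p_range.
have rq := fun x => @perturb_range _ _ _ x beta_gt0 cs' q_range.
have mp' := mpert alpha c p mp; have mq' := mpert beta c' q mq.
have Pm := moments_nul e2 mp' mq' rp rq.
have Jn : (J0 <= jj n)%N by rewrite jE.
have := risk_ge_bias e2 mp' mq' rp rq
  (holder_ball_bump jJ bp Hp (le_trans cs se))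
  (holder_ball_bump jJ bq Hq (le_trans cs' se)) Pm Jn n0.
by rewrite mul0r subr0 !cut_perturb jE.
Qed.

(** At the four sign combinations the biases cannot all be small, since their
    mixed difference is the truncated inner product of the two bumps. *)
Lemma risk_ge_mixed (jj : nat -> nat) n : jj n = j -> (0 < n)%N ->
  (((mean U (fun x => s * decay alpha ^+ j * bump W j x
       * (s * decay beta ^+ j * bump W j x)
       * (1 - n%:R^-1 * kernel_diag W j x))) ^+ 2)%:E <= max_risk jj n)%E.
Proof.
move=> jE n0; have bb := bounded_bump W jJ.
set u := fun x => s * decay alpha ^+ j * bump W j x.
set v := fun x => s * decay beta ^+ j * bump W j x.
have bu : bounded_mfun u by rewrite /u; bounded_tac.
have bv : bounded_mfun v by rewrite /v; bounded_tac.
have u0 (m : Z W j) : coef U (@phi _ _ _ _ W j) u m = 0.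
  have bphi := bounded_phi m jJ.
  rewrite /coef (@eq_mean _ _ _ _ _ (fun x => s * decay alpha ^+ j * (bump W j x * phi m x))).
    by rewrite meanZl ?bump_Phi ?mulr0//; bounded_tac.
  by move=> x; rewrite /u mulrA.
have := bias_form_difference n jJ bp bq bu bv u0; set D := mean U _.
have ss : `|s| <= s by rewrite ger0_norm.
have ns : `|- s| <= s by rewrite normrN.
have r1 := risk_ge_perturb jE n0 ss ss; have r2 := risk_ge_perturb jE n0 ss ns.
have r3 := risk_ge_perturb jE n0 ns ss; have r4 := risk_ge_perturb jE n0 ns ns.
have negE (f : d.-tuple R -> R) k : (fun x => f x + - s * k * bump W j x)
    = (fun x => f x - s * k * bump W j x).
  by apply/funext => x; rewrite !mulNr.
rewrite !negE in r2 r3 r4.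
move: r1 r2 r3 r4; rewrite -/u -/v.
set b1 := bias_form _ _ _ _ _; set b2 := bias_form _ _ _ _ _.
set b3 := bias_form _ _ _ _ _; set b4 := bias_form _ _ _ _ _.
case: (max_risk jj n) => [r| |]; rewrite ?lee_fin ?leey// => r1 r2 r3 r4 E.
have -> : D = (b1 - b2 - b3 + b4) / 4 by rewrite E; field.
have := sqr_ge0 (b1 + b2); have := sqr_ge0 (b1 + b3); have := sqr_ge0 (b1 - b4).
have := sqr_ge0 (b2 - b3); have := sqr_ge0 (b2 + b4); have := sqr_ge0 (b3 + b4).
by nra.
Qed.

End perturbed.

(** If the dimension is comparable with [n], the contribution of the diagonal
    terms is of constant order and dominates the truncation bias. Otherwise the
    kernel diagonal divided by [n] is at most one half, so that the mixed
    difference keeps half of the inner product of the bumps. *)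
Lemma risk_lower : exists2 c, 0 < c & forall (j : nat -> nat) n,
  (J0 <= j n)%N -> (0 < n)%N ->
  ((c * risk_order d alpha beta (j n) n)%:E <= max_risk j n)%E.
Proof.
have [CK CK0 HCK] := kernel_diag_le W.
have [CB CB0 HCB] := bump_le W.
have [cZ [CZ [cZ0 HZ]]] := card_Z W.
(* the slack [e] has to accommodate both the Hoelder norm of the bumps and, up
   to one half, their size *)
pose s := Num.min e (e / (2 * CB)).
have s0 : 0 < s by rewrite lt_min e0 divr_gt0// mulr_gt0.
have HpM : holder_ball W alpha M p by apply: holder_ball_le Hp; rewrite lerBlDr lerDl ltW.
have HqM : holder_ball W beta M q by apply: holder_ball_le Hq; rewrite lerBlDr lerDl ltW.
pose c1 := (e ^+ 2 * cZ) ^+ 2.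
pose c2 := Num.min ((s ^+ 2 * (cZ / 2)) ^+ 2) (c1 / (2 * CK) ^+ 2).
pose c3 := e ^+ 4 / 4.
have c10 : 0 < c1 by rewrite exprn_gt0// mulr_gt0// exprn_gt0.
have c20 : 0 < c2.
  rewrite lt_min; apply/andP; split.
    by apply: exprn_gt0; apply: mulr_gt0; [exact: exprn_gt0|exact: divr_gt0].
  by apply: divr_gt0 => //; apply: exprn_gt0; exact: mulr_gt0.
have c30 : 0 < c3 by rewrite divr_gt0// exprn_gt0.
pose c := Num.min c1 (Num.min c2 c3) / 3.
have c0 : 0 < c by rewrite divr_gt0// lt_min c10 lt_min c20.
exists c => // j n jJ n0; have n_gt0 : 0 < n%:R :> R by rewrite ltr0n.
have d0 := dim_gt0 R d (j n).
have r1 : ((c1 * (dim R d (j n) / n%:R) ^+ 2)%:E <= max_risk j n)%E.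
  apply: le_trans (risk_ge_diag e0 mp mq p_range q_range HpM HqM jJ n0).
  rewrite lee_fin /c1 -exprMn lerXn2r ?nnegrE//.
  - by apply: mulr_ge0; [apply: mulr_ge0; [exact: sqr_ge0|exact: ltW]|
      apply: divr_ge0 => //; exact: ltW].
  - by apply: mulr_ge0; [exact: sqr_ge0|exact: divr_ge0].
  rewrite -mulrA; apply: ler_wpM2l; first exact: sqr_ge0.
  rewrite mulrA; apply: ler_wpM2r; first by rewrite invr_ge0.
  by have /andP[] := HZ _ jJ.
have r2 : ((c2 * ((decay alpha * decay beta) ^+ j n) ^+ 2)%:E <= max_risk j n)%E.
  set dd := (_ ^+ j n).
  have dd0 : 0 < dd by rewrite exprn_gt0// mulr_gt0// decay_gt0.
  have dd1 : dd <= 1.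
    rewrite /dd exprMn mulr_ile1 ?decay_pow_le1// exprn_ge0// ltW// decay_gt0//.
  have [small|large] := leP (CK * (dim R d (j n) / n%:R)) 2^-1; last first.
    apply: le_trans r1; rewrite lee_fin.
    apply: (@le_trans _ _ (c1 / (2 * CK) ^+ 2 * 1)).
      apply: ler_pM; rewrite ?(ltW c20) ?sqr_ge0//; last by rewrite expr_le1// ltW.
      by rewrite ge_min lexx orbT.
    have k : (2 * CK)^-1 <= dim R d (j n) / n%:R.
      rewrite -[leLHS]mul1r ler_pdivrMr ?mulr_gt0// (mulrC _ (2 * CK)) -mulrA; lra.
    rewrite mulr1 -exprVn; apply: ler_wpM2l; first exact: ltW.
    by apply: lerXn2r => //; rewrite nnegrE ?invr_ge0 ?divr_ge0 ?mulr_ge0// ltW.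
  have sB x : s * `|bump W (j n) x| <= e / 2.
    apply: (@le_trans _ _ (e / (2 * CB) * CB)).
      by rewrite ler_pM ?(ltW s0)// ?HCB// ge_min lexx orbT.
    by rewrite invfM !mulrA mulfVK// gt_eqF.
  have se : s <= e by rewrite ge_min lexx.
  apply: le_trans (risk_ge_mixed (ltW s0) se jJ sB erefl n0).
  have bb := bounded_bump W jJ; have bk := bounded_kernel_diag W jJ.
  rewrite lee_fin.
  have pt x : s ^+ 2 * dd / 2 * (bump W (j n) x ^+ 2)
      <= s * decay alpha ^+ j n * bump W (j n) x * (s * decay beta ^+ j n * bump W (j n) x)
         * (1 - n%:R^-1 * kernel_diag W (j n) x).
    rewrite (_ : s * _ * _ * _ = s ^+ 2 * dd * bump W (j n) x ^+ 2); last first.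
      by rewrite /dd exprMn; ring.
    rewrite mulrAC; apply: ler_wpM2l.
      by apply: mulr_ge0; [apply: mulr_ge0; [exact: sqr_ge0|exact: ltW]|exact: sqr_ge0].
    have : n%:R^-1 * kernel_diag W (j n) x <= 2^-1.
      apply: le_trans small; rewrite mulrC mulrA; apply: ler_wpM2r; first by rewrite invr_ge0.
      exact: HCK.
    by lra.
  have lower : s ^+ 2 * (cZ / 2) * dd <= mean U (fun x => s ^+ 2 * dd / 2 * (bump W (j n) x ^+ 2)).
    rewrite meanZl; last by bounded_tac.
    rewrite mean_bump_sqr// (_ : s ^+ 2 * (cZ / 2) * dd = s ^+ 2 * dd / 2 * cZ); last by field.
    apply: ler_wpM2l.
      by apply: divr_ge0 => //; apply: mulr_ge0; [exact: sqr_ge0|exact: ltW].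
    rewrite ler_pdivlMr// card_prod natrM.
    have /andP[lo _] := HZ _ jJ; apply: le_trans lo _.
    by rewrite ler_peMl// ler1n card_wtype_gt0.
  have L0 : 0 <= s ^+ 2 * (cZ / 2) * dd.
    apply: mulr_ge0; last exact: ltW.
    by apply: mulr_ge0; [exact: sqr_ge0|apply: divr_ge0 => //; exact: ltW].
  set I := mean U _; have upper : s ^+ 2 * (cZ / 2) * dd <= I.
    apply: (le_trans lower); apply: le_mean; [by bounded_tac..|exact: pt].
  apply: (@le_trans _ _ ((s ^+ 2 * (cZ / 2) * dd) ^+ 2)).
    rewrite [leRHS]exprMn; apply: ler_wpM2r; first exact: sqr_ge0.
    by rewrite ge_min lexx.
  by apply: lerXn2r => //; rewrite nnegrE// (le_trans L0).
have r3 := risk_ge_parametric e0 mp mq p_range q_range HpM HqM jJ n0.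
rewrite /risk_order; rewrite -/c3 in r3.
move: r1 r2 r3; set x := n%:R^-1; set y := (_ ^+ j n) ^+ 2; set z := _ ^+ 2.
have x0 : 0 <= x by rewrite invr_ge0.
have y0 : 0 <= y by exact: sqr_ge0.
have z0 : 0 <= z by exact: sqr_ge0.
have h1 : c <= c1 / 3 by rewrite ler_pM2r ?invr_gt0// ge_min lexx.
have h2 : c <= c2 / 3 by rewrite ler_pM2r ?invr_gt0// ge_min; apply/orP; right; rewrite ge_min lexx.
have h3 : c <= c3 / 3 by rewrite ler_pM2r ?invr_gt0// ge_min; apply/orP; right; rewrite ge_min lexx orbT.
case: (max_risk j n) => [r| |]; rewrite ?lee_fin ?leey// => r1 r2 r3.
have := ler_wpM2r x0 h3; have := ler_wpM2r y0 h2; have := ler_wpM2r z0 h1.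
by rewrite !mulrDr; lra.
Qed.

End risk_lower_bound.

(** * Balancing the risk *)

Section rates.
Context (R : realType) (d : nat) (alpha beta : R).
Hypotheses (d_gt0 : (0 < d)%N) (alpha_gt0 : 0 < alpha) (beta_gt0 : 0 < beta).

Definition gamma : R := (alpha + beta) / d%:R.

(** Exponent of the resolution [n ^ balance] that balances truncation bias
    against the diagonal terms, down to the parametric rate. *)
Definition balance : R :=
  if d%:R / 2 <= (alpha + beta) / 2 then 2^-1 else d%:R / (alpha + beta + d%:R).

Let d0 : 0 < d%:R :> R. Proof. by rewrite ltr0n. Qed.
Let ab0 : 0 < alpha + beta. Proof. exact: addr_gt0. Qed.

Lemma gamma_gt0 : 0 < gamma. Proof. exact: divr_gt0. Qed.

Let powX (x y : R) n : (x `^ y) ^+ n = x `^ (y * n%:R).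
Proof. by rewrite powRrM powR_mulrn ?powR_ge0. Qed.

Let powD (x y z : R) : 0 < x -> x `^ (y + z) = x `^ y * x `^ z.
Proof. by move=> x0; rewrite powRD// (gt_eqF x0) implybT. Qed.

Lemma decay_dim j : ((decay alpha * decay beta) ^+ j) ^+ 2 = dim R d j `^ (- (2 * gamma)).
Proof.
rewrite /dim -(@powR_mulrn R 2 (j * d))// -powRrM /decay -powD// !powX; congr (_ `^ _).
by rewrite /gamma natrM; field; rewrite gt_eqF.
Qed.

Lemma rate_balance n : (0 < n)%N ->
  rate_NR d alpha beta n = n%:R `^ (2 * balance - 2) :> R.
Proof.
move=> n0; rewrite /rate_NR /balance; case: ifPn => _.
  by rewrite -powR_inv1//; congr (_ `^ _); field.
by congr (_ `^ _); field; rewrite gt_eqF// addr_gt0.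
Qed.

Lemma balance_ge_half : 2^-1 <= balance.
Proof.
rewrite /balance; case: ifPn => //; rewrite -ltNge => h.
rewrite ler_pdivlMr ?addr_gt0//; lra.
Qed.

Lemma balance_gamma : 1 <= balance * (1 + gamma).
Proof.
rewrite /balance /gamma; case: ifPn => [|_].
  rewrite ler_pM2r ?invr_gt0// => h.
  have : 1 <= (alpha + beta) / d%:R by rewrite ler_pdivlMr// mul1r.
  lra.
rewrite le_eqVlt; apply/orP; left; apply/eqP; field.
by rewrite !gt_eqF// addr_gt0.
Qed.

Lemma balance_gamma_lt : (alpha + beta) / 2 < d%:R / 2 -> balance * (1 + gamma) = 1.
Proof.
rewrite ltNge /balance /gamma => /negbTE ->; field.
by rewrite !gt_eqF// addr_gt0.
Qed.

(** Above the resolution [n ^ balance] the diagonal terms exceed the rate; below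
    it the truncation bias does. *)
Lemma rate_le_risk_order j n : (0 < n)%N ->
  rate_NR d alpha beta n <= risk_order d alpha beta j n.
Proof.
move=> n0; rewrite /risk_order decay_dim.
have n1 : 1 <= n%:R :> R by rewrite ler1n.
have n_gt0 : 0 < n%:R :> R by rewrite ltr0n.
have x0 : 0 <= n%:R^-1 :> R by rewrite invr_ge0.
have y0 : 0 <= dim R d j `^ (- (2 * gamma)) by exact: powR_ge0.
have z0 : 0 <= (dim R d j / n%:R) ^+ 2 by exact: sqr_ge0.
have [h|h] := leP (d%:R / 2) ((alpha + beta) / 2).
  by rewrite /rate_NR h -addrA lerDl addr_ge0.
rewrite rate_balance//.
have [k|k] := leP (n%:R `^ balance) (dim R d j).
  apply: (@le_trans _ _ ((dim R d j / n%:R) ^+ 2)); last by rewrite lerDr addr_ge0.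
  rewrite (_ : n%:R `^ _ = (n%:R `^ balance / n%:R) ^+ 2).
    by apply: lerXn2r; rewrite ?nnegrE ?divr_ge0 ?powR_ge0 ?(ltW (dim_gt0 R d j))// ler_pM2r ?invr_gt0.
  rewrite -[X in _ / X]powRr1// -powRN -powD// powX; congr (_ `^ _); ring.
apply: (@le_trans _ _ (dim R d j `^ (- (2 * gamma)))).
  have -> : 2 * balance - 2 = balance * (- (2 * gamma)).
    by have := balance_gamma_lt h; lra.
  rewrite powRrM !powRN lef_pV2 ?posrE ?powR_gt0// ?dim_gt0//.
  by apply: ge0_ler_powR; rewrite ?nnegrE ?powR_ge0 ?(ltW (dim_gt0 R d j)) ?(ltW k)// mulr_ge0// ltW// gamma_gt0.
by rewrite -addrA addrCA lerDl addr_ge0.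
Qed.

Section balanced_resolution.
Variable J0 : nat.

(** The largest level whose resolution does not exceed [n ^ balance], unless this
    is coarser than [J0]. *)
Definition balanced_level (n : nat) : nat :=
  maxn J0 (trunc_log 2 (Num.truncn (n%:R `^ (balance / d%:R) : R))).

Lemma balanced_level_ge n : (0 < n)%N ->
  n%:R `^ balance / 2 ^+ d <= dim R d (balanced_level n).
Proof.
move=> n0; have n1 : 1 <= n%:R :> R by rewrite ler1n.
have b0 : 0 < balance by apply: lt_le_trans balance_ge_half; rewrite invr_gt0.
set y : R := n%:R `^ (balance / d%:R).
have y1 : 1 <= y.
  by rewrite -(powRr0 n%:R) ler_powR// divr_ge0// ltW.
have -> : n%:R `^ balance = y ^+ d by rewrite powX divfK// gt_eqF.
rewrite -expr_div_n /dim exprM; apply: lerXn2r; rewrite ?nnegrE ?exprn_ge0 ?divr_ge0//.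
  by rewrite (le_trans _ y1).
rewrite ler_pdivrMr// -exprSr; apply: ltW.
apply: (@lt_le_trans _ _ (2 ^+ (trunc_log 2 (Num.truncn y)).+1)).
  apply: lt_le_trans (truncnS_gt y) _.
  by rewrite -natrX ler_nat; apply: trunc_log_ltn.
by rewrite ler_eXn2l ?ltr1n// ltnS leq_maxr.
Qed.

Lemma balanced_level_le n : (0 < n)%N ->
  dim R d (balanced_level n) <= dim R d J0 * n%:R `^ balance.
Proof.
move=> n0; have n1 : 1 <= n%:R :> R by rewrite ler1n.
have b0 : 0 < balance by apply: lt_le_trans balance_ge_half; rewrite invr_gt0.
set y : R := n%:R `^ (balance / d%:R).
have y1 : 1 <= y.
  by rewrite -(powRr0 n%:R) ler_powR// divr_ge0// ltW.
have -> : n%:R `^ balance = y ^+ d by rewrite powX divfK// gt_eqF.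
rewrite /dim !exprM -exprMn; apply: lerXn2r; rewrite ?nnegrE ?exprn_ge0 ?mulr_ge0 ?exprn_ge0//.
  by rewrite (le_trans _ y1).
have ty : 2 ^+ trunc_log 2 (Num.truncn y) <= y.
  apply: (@le_trans _ _ (Num.truncn y)%:R).
    by rewrite -natrX ler_nat; apply: trunc_logP => //; rewrite truncn_gt0.
  by rewrite truncn_le (le_trans _ y1).
rewrite /balanced_level -/y; move: ty; generalize (trunc_log 2 (Num.truncn y)) => t ty.
have [tJ|Jt] := leqP t J0.
  by rewrite ler_peMr// exprn_ge0.
apply: (le_trans ty).
by rewrite ler_peMl ?(le_trans _ y1)// exprn_ege1// ler1n.
Qed.

Lemma risk_order_balanced : exists2 C : R, 0 < C & forall n, (0 < n)%N ->
  risk_order d alpha beta (balanced_level n) n <= C * rate_NR d alpha beta n.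
Proof.
have g0 := gamma_gt0; have bh := balance_ge_half; have bg := balance_gamma.
exists (1 + (2 ^+ d) `^ (2 * gamma) + dim R d J0 ^+ 2).
  by rewrite !addr_gt0// ?powR_gt0 ?exprn_gt0 ?dim_gt0.
move=> n n0; have n1 : 1 <= n%:R :> R by rewrite ler1n.
have n_gt0 : 0 < n%:R :> R by rewrite ltr0n.
rewrite rate_balance// /risk_order decay_dim.
rewrite [leRHS]mulrDl [X in _ <= X + _]mulrDl [X in _ <= X + _ + _]mul1r.
have kd := dim_gt0 R d (balanced_level n).
apply: lerD; first apply: lerD.
- rewrite -(@powR_inv1 _ n%:R)//; apply: ler_powR => //; lra.
- apply: (@le_trans _ _ ((n%:R `^ balance / 2 ^+ d) `^ (- (2 * gamma)))).
    rewrite !powRN lef_pV2 ?posrE ?powR_gt0// ?divr_gt0 ?powR_gt0 ?exprn_gt0//.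
    apply: ge0_ler_powR; rewrite ?nnegrE ?divr_ge0 ?powR_ge0 ?exprn_ge0 ?(ltW kd)//.
      by rewrite mulr_ge0// ltW.
    exact: balanced_level_ge.
  rewrite powRM ?powR_ge0 ?invr_ge0 ?exprn_ge0// -powR_inv1 ?exprn_ge0// -!powRrM mulrC.
  rewrite mulrNN mul1r; apply: ler_wpM2l; first exact: powR_ge0.
  apply: ler_powR => //; nra.
- have -> : n%:R `^ (2 * balance - 2) = (n%:R `^ balance / n%:R) ^+ 2.
    rewrite -[X in _ / X]powRr1// -powRN -powD// powX; congr (_ `^ _); ring.
  rewrite -exprMn mulrA; apply: lerXn2r.
  + by rewrite nnegrE divr_ge0// ltW.
  + by rewrite nnegrE divr_ge0// mulr_ge0 ?powR_ge0// ltW// dim_gt0.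
  by rewrite ler_pM2r ?invr_gt0//; exact: balanced_level_le.
Qed.

End balanced_resolution.

Lemma powR_near (e A : R) : 0 < e -> \forall n \near \oo, A <= n%:R `^ e.
Proof.
move=> e0; near=> n; apply: (@le_trans _ _ (Num.max A 0)); first by rewrite le_max lexx.
have M0 : 0 <= Num.max A 0 by rewrite le_max lexx orbT.
have -> : Num.max A 0 = (Num.max A 0 `^ e^-1) `^ e by rewrite -powRrM mulVf ?gt_eqF// powRr1.
apply: ge0_ler_powR; rewrite ?nnegrE ?powR_ge0// ?ltW//.
by near: n; exact: nbhs_infty_gtr.
Unshelve. all: by end_near. Qed.

End rates.

Section resolution_growth.
Context (R : realType) (d : nat) (alpha beta c2 : R) (j : nat -> nat) (B : R).
Hypotheses (d_gt0 : (0 < d)%N) (alpha_gt0 : 0 < alpha) (beta_gt0 : 0 < beta)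
  (c2_gt0 : 0 < c2) (B_gt0 : 0 < B).
Hypothesis near_optimal : \forall n \near \oo,
  risk_order d alpha beta (j n) n <= B * rate_NR d alpha beta n.

Local Notation kappa := (d%:R / (2 * beta + d%:R) : R).

Let d0 : 0 < d%:R :> R. Proof. by rewrite ltr0n. Qed.

Lemma k_pred_gt0 n : (0 < n)%N -> 0 < k_pred d beta c2 n.
Proof. by move=> n0; rewrite mulr_gt0// powR_gt0// ltr0n. Qed.

(** The truncation bias alone forces the resolution up. *)
Lemma undersmoothing_growth : alpha < Num.min beta (d%:R / 2) ->
  much_greater (resolution R d j) (k_pred d beta c2).
Proof.
rewrite lt_min => /andP[ab ad].
have g0 := gamma_gt0 d_gt0 alpha_gt0 beta_gt0.
set g := gamma d alpha beta in g0 *; set a := balance d alpha beta.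
(* a bias within the rate forces growth of the resolution like [n ^ ((1 - a) / g)] *)
pose e := (1 - a) / g - kappa.
have e0 : 0 < e.
  rewrite subr_gt0 /a /g /balance /gamma; case: ifPn => [h|]; last rewrite -ltNge => h.
    rewrite (_ : (1 - 2^-1) / _ = d%:R / (2 * (alpha + beta))); last first.
      by field; rewrite !gt_eqF// addr_gt0.
    rewrite ltr_pM2l// ltf_pV2 ?posrE ?mulr_gt0 ?addr_gt0 ?mulr_gt0//.
    by move: ad; rewrite ltr_pdivlMr//; lra.
  rewrite (_ : (1 - _) / _ = d%:R / (alpha + beta + d%:R)); last first.
    by field; rewrite !gt_eqF// !addr_gt0.
  by rewrite ltr_pM2l// ltf_pV2 ?posrE ?addr_gt0 ?mulr_gt0//; lra.
pose K := B `^ (- (2 * g)^-1) / c2.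
have K0 : 0 < K by rewrite divr_gt0// powR_gt0.
suff H : \forall n \near \oo, K * n%:R `^ e <= resolution R d j n / k_pred d beta c2 n.
  apply/cvgryPge => A; near=> n.
  apply: (@le_trans _ _ (K * n%:R `^ e)); last by near: n.
  rewrite mulrC -ler_pdivrMr//.
  by near: n; exact: powR_near.
near=> n.
have n0 : (0 < n)%N by near: n; exact: nbhs_infty_gt.
have n_gt0 : 0 < n%:R :> R by rewrite ltr0n.
have : risk_order d alpha beta (j n) n <= B * rate_NR d alpha beta n by near: n.
rewrite rate_balance// -/a /risk_order (decay_dim alpha beta d_gt0) -/g.
have kd := dim_gt0 R d (j n); set k := dim R d (j n) in kd *.
have x0 : 0 <= n%:R^-1 :> R by rewrite invr_ge0 ltW.
have z0 : 0 <= (k / n%:R) ^+ 2 by exact: sqr_ge0.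
move=> H; have {H} : k `^ (- (2 * g)) <= B * n%:R `^ (2 * a - 2).
  by apply: le_trans H; rewrite -addrA addrCA lerDl addr_ge0.
move=> H; rewrite /resolution -/(dim R d (j n)) -/k ler_pdivlMr ?k_pred_gt0//.
have kE : k = (k `^ (- (2 * g))) `^ (- (2 * g)^-1).
  rewrite -powRrM (_ : _ * _ = 1); first by rewrite powRr1// ltW.
  by field; rewrite gt_eqF.
rewrite kE; apply: (@le_trans _ _ ((B * n%:R `^ (2 * a - 2)) `^ (- (2 * g)^-1))).
  have -> : K * n%:R `^ e * k_pred d beta c2 n
      = B `^ (- (2 * g)^-1) * (n%:R `^ e * n%:R `^ kappa).
    by rewrite /K /k_pred; field; rewrite gt_eqF.
  rewrite (powRM _ (ltW B_gt0) (powR_ge0 _ _)) -[X in _ <= _ * X]powRrM.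
  rewrite -powRD ?(gt_eqF n_gt0) ?implybT// le_eqVlt; apply/orP; left; apply/eqP.
  congr (_ * _ `^ _); rewrite /e; field.
  by rewrite !gt_eqF// addr_gt0// mulr_gt0.
have Br0 : 0 < B * n%:R `^ (2 * a - 2) by rewrite mulr_gt0// powR_gt0.
rewrite [leLHS]powRN [leRHS]powRN lef_pV2 ?posrE ?powR_gt0//.
have s0 : 0 <= (2 * g)^-1 by rewrite invr_ge0 mulr_ge0// ltW.
by apply: (ge0_ler_powR s0); rewrite ?nnegrE ?powR_ge0 ?(ltW Br0).
Unshelve. all: by end_near. Qed.

(** The diagonal terms alone keep the resolution down. *)
Lemma oversmoothing_growth : beta < Num.min alpha (d%:R / 2) ->
  much_less (resolution R d j) (k_pred d beta c2).
Proof.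
rewrite lt_min => /andP[ba bd].
set a := balance d alpha beta.
(* diagonal terms within the rate keep the resolution of order [n ^ a] *)
pose e := kappa - a.
have e0 : 0 < e.
  rewrite subr_gt0 /a /balance; case: ifPn => [h|]; last rewrite -ltNge => h.
    rewrite ltr_pdivlMr ?addr_gt0 ?mulr_gt0//.
    by move: bd; rewrite ltr_pdivlMr//; lra.
  by rewrite ltr_pM2l// ltf_pV2 ?posrE ?addr_gt0 ?mulr_gt0//; lra.
pose K := Num.sqrt B / c2.
have K0 : 0 < K by rewrite divr_gt0// sqrtr_gt0.
have H : \forall n \near \oo, resolution R d j n / k_pred d beta c2 n <= K / n%:R `^ e.
  near=> n.
  have n0 : (0 < n)%N by near: n; exact: nbhs_infty_gt.
  have n_gt0 : 0 < n%:R :> R by rewrite ltr0n.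
  have : risk_order d alpha beta (j n) n <= B * rate_NR d alpha beta n by near: n.
  rewrite rate_balance// -/a /risk_order.
  have kd := dim_gt0 R d (j n); set k := dim R d (j n) in kd *.
  have x0 : 0 <= n%:R^-1 :> R by rewrite invr_ge0 ltW.
  have y0 : 0 <= ((decay alpha * decay beta) ^+ j n) ^+ 2 by exact: sqr_ge0.
  move=> H; have {H} : (k / n%:R) ^+ 2 <= B * n%:R `^ (2 * a - 2).
    by apply: le_trans H; rewrite lerDr addr_ge0.
  rewrite (_ : _ * _ `^ _ = (Num.sqrt B * (n%:R `^ a / n%:R)) ^+ 2); last first.
    rewrite exprMn sqr_sqrtr ?ltW//; congr (_ * _).
    rewrite -[X in _ / X]powRr1 ?ltW// -powRN -powRD ?(gt_eqF n_gt0) ?implybT//.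
    by rewrite -powR_mulrn ?powR_ge0// -powRrM; congr (_ `^ _); ring.
  rewrite ler_sqr ?nnegrE ?mulr_ge0 ?sqrtr_ge0 ?divr_ge0 ?powR_ge0 ?(ltW kd) ?(ltW n_gt0)//.
  rewrite mulrA ler_pM2r ?invr_gt0// => H.
  rewrite /resolution -/(dim R d (j n)) -/k ler_pdivrMr ?k_pred_gt0//.
  apply: (le_trans H); rewrite le_eqVlt; apply/orP; left; apply/eqP.
  rewrite /K /k_pred (_ : n%:R `^ kappa = n%:R `^ a * n%:R `^ e).
    by field; rewrite !gt_eqF// powR_gt0.
  by rewrite -powRD ?(gt_eqF n_gt0) ?implybT//; congr (_ `^ _); rewrite /e; ring.
apply/cvgr0Pnorm_le => eps eps0; near=> n.
have n0 : (0 < n)%N by near: n; exact: nbhs_infty_gt.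
have n_gt0 : 0 < n%:R :> R by rewrite ltr0n.
have ne : 0 < n%:R `^ e :> R by rewrite powR_gt0.
rewrite ger0_norm; last by rewrite divr_ge0 ?(ltW (dim_gt0 R d (j n)))// ltW// k_pred_gt0.
apply: (@le_trans _ _ (K / n%:R `^ e)); first by near: n.
rewrite ler_pdivrMr// mulrC -ler_pdivrMr//.
by near: n; exact: powR_near.
Unshelve. all: by end_near. Qed.

End resolution_growth.

Theorem corollary15 (R : realType) (d : nat) (d_gt0 : (0 < d)%N)
    (alpha beta M C1 C2 : R)
    (alpha_gt0 : 0 < alpha) (beta_gt0 : 0 < beta) (M_gt0 : 0 < M)
    (S J0 : nat) (S_ge1 : (1 <= S)%N) (S_gt : Num.max alpha beta < S%:R)
    (J0_ge : (S <= 2 ^ J0)%N) (W : cdv_basis R d S J0)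
    (nondegenerate : exists2 e : R, 0 < e &
       model W alpha beta (M - e) (C1 + e) (C2 - e) !=set0)
    (c2 : R) (c2_gt0 : 0 < c2) :
  let risk := max_risk W alpha beta M C1 C2 in
  let r := rate_NR d alpha beta in
  [/\ is_best_rate J0 risk r,
      alpha < Num.min beta (d%:R / 2) ->
        requires_undersmoothing d J0 risk r (k_pred d beta c2) &
      beta < Num.min alpha (d%:R / 2) ->
        requires_oversmoothing d J0 risk r (k_pred d beta c2)].
Proof.
move=> risk r.
have [e e0 /(interior_regression e0)[p [q [mp mq p_range q_range [Hp Hq]]]]] := nondegenerate.
have [C C0 upper] := risk_upper W M C1 C2 alpha_gt0 beta_gt0.
have [c c0 lower] := risk_lower d_gt0 alpha_gt0 beta_gt0 e0 mp mq p_range q_range Hp Hq.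
have near_optimal j : admissible J0 j -> achieves risk r j ->
    exists2 B : R, 0 < B & \forall n \near \oo,
      risk_order d alpha beta (j n) n <= B * rate_NR d alpha beta n.
  move=> jJ [B B0 jB]; exists (B / c); first exact: divr_gt0.
  near=> n; have n0 : (0 < n)%N by near: n; exact: nbhs_infty_gt.
  rewrite mulrAC ler_pdivlMr// mulrC -lee_fin.
  apply: le_trans (lower j n (jJ n) n0) _; rewrite EFinM.
  by near: n; exact: jB.
split; first split.
- exists (balanced_level d alpha beta J0); first by move=> n; exact: leq_maxl.
  have [B B0 HB] := risk_order_balanced d_gt0 alpha_gt0 beta_gt0 J0.
  exists (C * B); first exact: mulr_gt0.
  near=> n; have n0 : (0 < n)%N by near: n; exact: nbhs_infty_gt.
  apply: le_trans (upper (balanced_level d alpha beta J0) n (leq_maxl _ _) n0) _.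
  by rewrite -EFinM lee_fin -mulrA ler_wpM2l ?HB// ltW.
- move=> j jJ; exists c^-1; first by rewrite invr_gt0.
  near=> n; have n0 : (0 < n)%N by near: n; exact: nbhs_infty_gt.
  apply: (@le_trans _ _ ((c^-1 * (c * risk_order d alpha beta (j n) n))%:E)).
    by rewrite lee_fin mulKf ?gt_eqF//; exact: rate_le_risk_order.
  by rewrite EFinM lee_wpmul2l ?lee_fin ?invr_ge0 ?(ltW c0)//; exact: lower.
- move=> small j jJ /(near_optimal j jJ)[B B0 jB].
  exact: undersmoothing_growth d_gt0 alpha_gt0 beta_gt0 c2_gt0 B0 jB small.
- move=> small j jJ /(near_optimal j jJ)[B B0 jB].
  exact: oversmoothing_growth d_gt0 alpha_gt0 beta_gt0 c2_gt0 B0 jB small.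
Unshelve. all: by end_near. Qed.
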